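(* The topology of $\dot{\mathcal B}'$ is generated by the seminorms $p_\varphi$, $\varphi\in\mathcal D$, or alternatively $\varphi\in\mathcal S$, defined by $$\dot{\mathcal B}'\ni S\mapsto p_\varphi(S)=\|\varphi*S\|_\infty.$$
   Context: All spaces are on $\mathbb R^n$. $\mathcal D$ is the space of test functions, $\mathcal S$ the Schwartz space. $\mathcal D_{L^1}=\{f\in C^\infty:\partial^\alpha f\in L^1\ \forall\alpha\in\mathbb N_0^n\}$ with the topology generated by $\sup_{|\alpha|\le m}\|\partial^\alpha f\|_1$, $m\in\mathbb N_0$; $\mathcal D'_{L^\infty}$ is its dual with the strong topology $\beta(\mathcal D'_{L^\infty},\mathcal D_{L^1})$. $\dot{\mathcal B}'$ (not the dual of $\dot{\mathcal B}$) is the closure in $\mathcal D'_{L^\infty}$ of the space $\mathcal E'$ of compactly supported distributions, with the topology induced by $\mathcal D'_{L^\infty}$. For $S\in\mathcal D'_{L^\infty}$, $(\varphi*S)(x)=\langle S,\varphi(x-\cdot)\rangle$. *)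

(* Defs.v *)
From HB Require Import structures.
From mathcomp Require Import all_boot all_order all_algebra.
From mathcomp Require Import complex.
From mathcomp Require Import all_classical all_reals all_analysis.

Import Order.TTheory GRing.Theory Num.Theory.
Import numFieldNormedType.Exports.

Set Implicit Arguments.
Unset Strict Implicit.
Unset Printing Implicit Defensive.

Local Open Scope classical_set_scope.
Local Open Scope ring_scope.
Local Open Scope complex_scope.

(* Distributions are complex valued; the regular algebra R[i]^o carries the
   topology and the vector space structure of the scalar field R[i]. *)
Notation Cplx R := (R[i]^o).
Notation normc := ComplexField.Normc.normc.

Lemma continuous_lin (K : numFieldType) (T : topologicalType) (c : K)
    (f g : T -> K^o) :
  continuous f -> continuous g -> continuous (c *: f + g).
Proof.
move=> cf cg x; apply: (@cvgD K K^o T (nbhs x)); last exact: cg.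
exact: (@cvgZl_tmp K K^o T (nbhs x) _ c _ _ (cf x)).
Qed.

Section LebesgueTuple.
Context {R : realType}.

Definition cons_pair n (p : R * n.-tuple R) : n.+1.-tuple R :=
  [tuple of p.1 :: p.2].

(* Lebesgue measure on R^n, carried by n.-tuple R, on which the library puts
   the product sigma-algebra *)
Fixpoint lebesgue_tuple n : set (n.-tuple R) -> \bar R :=
  match n with
  | 0 => \d_[tuple]
  | m.+1 => pushforward (lebesgue_measure \x @lebesgue_tuple m)%E (@cons_pair m)
  end.

Lemma measurable_cons_pair n : measurable_fun setT (@cons_pair n).
Proof. by apply: measurable_cons; [exact: measurable_fst|exact: measurable_snd]. Qed.

Lemma pushforward_cons_sigma_finite n
    (m1 : {sigma_finite_measure set (measurableTypeR R) -> \bar R})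
    (m2 : {sigma_finite_measure set (n.-tuple R) -> \bar R}) :
  exists mu : {sigma_finite_measure set (n.+1.-tuple R) -> \bar R},
    pushforward (m1 \x m2)%E (@cons_pair n) = mu.
Proof.
have mh := @measurable_cons_pair n.
pose nu : {measure set (n.+1.-tuple R) -> \bar R} :=
  measure_function_pushforward__canonical__measure_function_Measure
    (lebesgue_integral_fubini_product_measure1__canonical__measure_function_Measure
      m1 m2) mh.
have sf : sigma_finite setT nu.
  have /sigma_finiteP[F [TF ndF Foo]] := sigma_finiteT m1.
  have /sigma_finiteP[G [TG ndG Goo]] := sigma_finiteT m2.
  pose g (t : n.+1.-tuple R) := (thead t, [tuple of behead t]).
  have gK p : g (cons_pair p) = p.
    by case: p => x t; rewrite /g/=; congr pair; exact/val_inj.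
  have mg : measurable_fun setT g.
    apply/measurable_fun_pairP; split; last exact: measurable_behead.
    exact: (@measurable_tnth _ _ _ ord0).
  exists (fun k => g @^-1` (F k `*` G k)).
    rewrite -preimage_bigcup (_ : \bigcup_i _ = setT) ?preimage_setT//.
    rewrite -subTset => -[x y] _.
    have [k _ Fkx] : (\bigcup_i F i) x by rewrite -TF.
    have [l _ Gly] : (\bigcup_i G i) y by rewrite -TG.
    exists (maxn k l) => //; split => /=.
    - by move: x Fkx; exact/subsetPset/ndF/leq_maxl.
    - by move: y Gly; exact/subsetPset/ndG/leq_maxr.
  move=> k; have [? ?] := Foo k; have [? ?] := Goo k; split.
    by rewrite -[X in measurable X]setTI; apply: mg => //; exact: measurableX.
  rewrite /nu /= /pushforward -comp_preimage (_ : _ \o _ = id); last first.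
    by apply/funext => p; exact: gK.
  by rewrite preimage_id product_measure1E// lte_mul_pinfty// ge0_fin_numE.
pose sm := Measure_isSigmaFinite.Build _ _ _ nu sf.
pose nu' : {sigma_finite_measure set (n.+1.-tuple R) -> \bar R} :=
  HB.pack (nu : set _ -> \bar R) nu sm.
by exists nu'.
Qed.

Lemma lebesgue_tuple_sigma_finite_measure n :
  exists mu : {sigma_finite_measure set (n.-tuple R) -> \bar R},
    @lebesgue_tuple n = mu.
Proof.
elim: n => [|n [mu IH]]; first by exists (\d_[tuple]).
by rewrite /= IH; exact: pushforward_cons_sigma_finite.
Qed.

Section instances.
Variable n : nat.

Let leb0 : @lebesgue_tuple n set0 = 0%E.
Proof. by have [mu ->] := lebesgue_tuple_sigma_finite_measure n. Qed.

Let leb_ge0 A : (0 <= @lebesgue_tuple n A)%E.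
Proof. by have [mu ->] := lebesgue_tuple_sigma_finite_measure n. Qed.

Let leb_sigma_additive : semi_sigma_additive (@lebesgue_tuple n).
Proof.
have [mu ->] := lebesgue_tuple_sigma_finite_measure n.
exact: measure_semi_sigma_additive.
Qed.

HB.instance Definition _ := isMeasure.Build _ _ _ (@lebesgue_tuple n)
  leb0 leb_ge0 leb_sigma_additive.

Let leb_sigma_finite : sigma_finite setT (@lebesgue_tuple n).
Proof.
have [mu ->] := lebesgue_tuple_sigma_finite_measure n.
exact: sigma_finiteT.
Qed.

HB.instance Definition _ := Measure_isSigmaFinite.Build _ _ _
  (@lebesgue_tuple n) leb_sigma_finite.

End instances.

End LebesgueTuple.

Section SeminormTopology.
Context {R : realType} {E : zmodType}.
Implicit Types (X U : set E) (P : set (E -> \bar R)).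

(* The open sets of the topology generated on X by the seminorms in P.
   The seminorms take values in \bar R, so that suprema need no side
   condition. *)
Definition seminorm_open X P U :=
  U `<=` X /\
  forall x, U x -> exists (F : set (E -> \bar R)) (e : R),
    [/\ finite_set F, F `<=` P, 0 < e &
      forall y, X y -> (forall p, F p -> (p (y - x)%R < e%:E)%E) -> U y].

Lemma seminorm_openT X P : seminorm_open X P X.
Proof. by split => // x _; exists set0, 1; split. Qed.

Lemma seminorm_openI X P : setI_closed (seminorm_open X P).
Proof.
move=> U V [UX Uo] [VX Vo]; split; first by move=> x [/UX].
move=> x [Ux Vx].
have [F [e [finF FP e0 FU]]] := Uo _ Ux.
have [G [d [finG GP d0 GV]]] := Vo _ Vx.
exists (F `|` G), (Num.min e d); split.
- by rewrite finite_setU.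
- by move=> p [/FP|/GP].
- by rewrite lt_min e0.
- move=> y Xy FGy; split; [apply: FU|apply: GV] => // p Fp.
  + by apply: lt_le_trans (FGy p (or_introl Fp)) _; rewrite lee_fin ge_min lexx.
  + by apply: lt_le_trans (FGy p (or_intror Fp)) _;
      rewrite lee_fin ge_min lexx orbT.
Qed.

Lemma seminorm_open_bigcup X P (I : Type) (f : I -> set E) :
  (forall i, seminorm_open X P (f i)) -> seminorm_open X P (\bigcup_i f i).
Proof.
move=> fo; split=> [x [i _ fx]|x [i _ fx]]; first exact: (fo i).1 _ fx.
have [F [e [finF FP e0 Ff]]] := (fo i).2 _ fx.
by exists F, e; split => // y Xy Fy; exists i => //; exact: Ff.
Qed.

End SeminormTopology.

Definition induced_open (T : topologicalType) (X : set T) : set (set T) :=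
  [set V `&` X | V in open].

Definition von_neumann_bounded {K : numFieldType}
    {E : preTopologicalLmodType K} (B : set E) :=
  forall U, nbhs (0 : E) U -> exists2 r : K, 0 < r &
    forall c : K, r <= `|c| -> B `<=` [set c *: u | u in U].

Section Smooth.
Context {R : realType} {n : nat}.
Local Notation fct := ('rV[R]_n -> Cplx R).
Implicit Types (f g : fct) (i : 'I_n) (s : seq 'I_n) (a b : 'I_n -> nat).

Definition partial i f : fct := fun x =>
  ('D_(delta_mx 0 i) (fun y => complex.Re (f y)) x) +i*
  ('D_(delta_mx 0 i) (fun y => complex.Im (f y)) x).

Definition partials s f : fct := foldr partial f s.

Definition smooth f := forall s,
  continuous (partials s f) /\
  forall i x,
    derivable (fun y => complex.Re (partials s f y)) x (delta_mx 0 i) /\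
    derivable (fun y => complex.Im (partials s f y)) x (delta_mx 0 i).

Definition multi_index_seq a : seq 'I_n :=
  flatten [seq nseq (a i) i | i <- enum 'I_n].

Definition mpartial a f : fct := partials (multi_index_seq a) f.

Definition fsupport f : set 'rV[R]_n := closure [set x | f x != 0].

Definition test_function : set fct :=
  [set f | smooth f /\ compact (fsupport f)].

Definition schwartz : set fct :=
  [set f | smooth f /\ forall a b, exists M : R, forall x : 'rV[R]_n,
    (\prod_(i < n) `|x 0 i| ^+ b i) * normc (mpartial a f x) <= M].

Definition row_of_tuple (t : n.-tuple R) : 'rV[R]_n := \row_i tnth t i.

Definition in_L1 f :=
  (@lebesgue_tuple R n).-integrable setT
    (fun t => (complex.Re (f (row_of_tuple t)))%:E) /\
  (@lebesgue_tuple R n).-integrable setT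
    (fun t => (complex.Im (f (row_of_tuple t)))%:E).

Definition L1norm f : \bar R :=
  (\int[@lebesgue_tuple R n]_t (normc (f (row_of_tuple t)))%:E)%E.

Lemma Re_lin (c : R[i]) f g y : complex.Re ((c *: f + g) y) =
  complex.Re c * complex.Re (f y) - complex.Im c * complex.Im (f y)
  + complex.Re (g y).
Proof.
rewrite -[(c *: f + g) y]/(c * f y + g y).
by case: c (f y) (g y) => ? ? [? ?] [? ?].
Qed.

Lemma Im_lin (c : R[i]) f g y : complex.Im ((c *: f + g) y) =
  complex.Re c * complex.Im (f y) + complex.Im c * complex.Re (f y)
  + complex.Im (g y).
Proof.
rewrite -[(c *: f + g) y]/(c * f y + g y).
by case: c (f y) (g y) => ? ? [? ?] [? ?].
Qed.

Section linear_combination.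
Variables (c : R[i]) (f g : fct) (i : 'I_n).
Let dfble (h : fct) := forall x,
  derivable (fun y => complex.Re (h y)) x (delta_mx 0 i) /\
  derivable (fun y => complex.Im (h y)) x (delta_mx 0 i).
Hypotheses (df : dfble f) (dg : dfble g).

Let is_derive_Re x : is_derive x (delta_mx 0 i : 'rV[R]_n)
  (fun y => complex.Re ((c *: f + g) y))
  (complex.Re ((c *: partial i f + partial i g) x)).
Proof.
have [/derivableP f1 /derivableP f2] := df x.
have [/derivableP g1 /derivableP g2] := dg x.
rewrite Re_lin [X in is_derive _ _ X](_ : _ =
  (complex.Re c \*: (fun y => complex.Re (f y))) -
  (complex.Im c \*: (fun y => complex.Im (f y))) +
  (fun y => complex.Re (g y))); last by apply/funext => y; rewrite Re_lin.
exact: is_deriveD.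
Qed.

Let is_derive_Im x : is_derive x (delta_mx 0 i : 'rV[R]_n)
  (fun y => complex.Im ((c *: f + g) y))
  (complex.Im ((c *: partial i f + partial i g) x)).
Proof.
have [/derivableP f1 /derivableP f2] := df x.
have [/derivableP g1 /derivableP g2] := dg x.
rewrite Im_lin [X in is_derive _ _ X](_ : _ =
  (complex.Re c \*: (fun y => complex.Im (f y))) +
  (complex.Im c \*: (fun y => complex.Re (f y))) +
  (fun y => complex.Im (g y))); last by apply/funext => y; rewrite Im_lin.
exact: is_deriveD.
Qed.

Lemma derivable_lin : dfble (c *: f + g).
Proof. by move=> x; split; [exact: (@ex_derive _ _ _ _ _ _ _ (is_derive_Re x))|
  exact: (@ex_derive _ _ _ _ _ _ _ (is_derive_Im x))]. Qed.

Lemma partial_lin : partial i (c *: f + g) = c *: partial i f + partial i g.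
Proof.
apply/funext => x; rewrite /partial.
rewrite (@derive_val _ _ _ _ _ _ _ (is_derive_Re x)).
rewrite (@derive_val _ _ _ _ _ _ _ (is_derive_Im x)).
by case: ((c *: partial i f + partial i g) x).
Qed.

End linear_combination.

Lemma partials_lin (c : R[i]) f g s : smooth f -> smooth g ->
  partials s (c *: f + g) = c *: partials s f + partials s g.
Proof.
move=> sf sg; elim: s => //= i s ->; apply: partial_lin => x.
  exact: (sf s).2.
exact: (sg s).2.
Qed.

Lemma smooth_lin (c : R[i]) f g : smooth f -> smooth g -> smooth (c *: f + g).
Proof.
move=> sf sg s; rewrite partials_lin//; split.
  exact: continuous_lin (sf s).1 (sg s).1.
move=> i; apply: derivable_lin; [exact: (sf s).2|exact: (sg s).2].
Qed.

Lemma in_L1_lin (c : R[i]) f g : in_L1 f -> in_L1 g -> in_L1 (c *: f + g).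
Proof.
move=> [f1 f2] [g1 g2]; split.
- under eq_fun do rewrite Re_lin EFinD EFinB !EFinM.
  apply: integrableD => //; apply: integrableB => //; exact: integrableZl.
- under eq_fun do rewrite Im_lin !EFinD !EFinM.
  apply: integrableD => //; apply: integrableD => //; exact: integrableZl.
Qed.

Lemma partials0 s : partials s 0 = 0.
Proof.
elim: s => //= i s ->; apply/funext => x.
rewrite /partial (_ : (fun y => complex.Re _) = cst 0)//.
by rewrite !derive_cst.
Qed.

Lemma smooth0 : smooth 0.
Proof.
move=> s; rewrite partials0; split; first exact: cst_continuous.
by move=> i x; split; exact: (derivable_cst (0 : R)).
Qed.

Lemma in_L10 : in_L1 0.
Proof. by split; exact: integrable0. Qed.

End Smooth.

Section DL1.
Variables (R : realType) (n : nat).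
Local Notation fct := ('rV[R]_n -> Cplx R).

Definition DL1_pred : {pred fct} :=
  [pred f : fct | `[< smooth f /\ forall a, in_L1 (mpartial a f) >]].

Lemma DL1_submod_closed : submod_closed DL1_pred.
Proof.
split=> [|c f g].
  rewrite inE; split; first exact: smooth0.
  by move=> a; rewrite /mpartial partials0; exact: in_L10.
move=> /asboolP[sf If] /asboolP[sg Ig]; rewrite inE; split.
  exact: smooth_lin.
by move=> a; rewrite /mpartial partials_lin//; exact: in_L1_lin (If a) (Ig a).
Qed.

HB.instance Definition _ :=
  GRing.isSubmodClosed.Build R[i] fct DL1_pred DL1_submod_closed.

Record DL1 := MkDL1 { DL1_fun :> fct; _ : DL1_fun \in DL1_pred }.

HB.instance Definition _ := [isSub for DL1_fun].
HB.instance Definition _ := [Choice of DL1 by <:].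
HB.instance Definition _ := [SubChoice_isSubLmodule of DL1 by <:].

Definition DL1_seminorm (m : nat) (f : DL1) : \bar R :=
  ereal_sup [set L1norm (mpartial a f) | a in
    [set a : 'I_n -> nat | (\sum_i a i <= m)%N]].

Let DL1_open : set_system DL1 := seminorm_open setT (range DL1_seminorm).

HB.instance Definition _ := isOpenTopological.Build DL1
  (seminorm_openT _ _ : DL1_open setT)
  (@seminorm_openI _ _ _ _ : setI_closed DL1_open)
  (@seminorm_open_bigcup _ _ _ _).

End DL1.

Section Dual.
Variables (R : realType) (n : nat).
Local Notation fct := ('rV[R]_n -> Cplx R).
Local Notation E := (DL1 R n).

(* D'_{L^oo} is the dual of D_{L^1}, whence the name DLoo' below. *)
Definition dual_pred : {pred E -> Cplx R} :=
  [pred S : E -> Cplx R | `[< (forall (c : R[i]) (f g : E), S (c *: f + g) = c * S f + S g)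
                /\ continuous S >]].

Lemma dual_submod_closed : submod_closed dual_pred.
Proof.
split=> [|c S T].
  rewrite inE; split; last exact: cst_continuous.
  by move=> c f g; rewrite /= mulr0 addr0.
move=> /asboolP[lS cS] /asboolP[lT cT]; rewrite inE; split.
  move=> d f g; rewrite -[LHS]/(c * S _ + T _) lS lT.
  rewrite -[X in _ = _ * X + _]/(c * S _ + T _) -[X in _ = _ + X]/(c * S _ + T _).
  by rewrite !mulrDr addrACA mulrCA.
exact: continuous_lin.
Qed.

HB.instance Definition _ :=
  GRing.isSubmodClosed.Build R[i] (E -> Cplx R) dual_pred dual_submod_closed.

Record DLoo' := MkDLoo' { DLoo'_fun :> E -> Cplx R; _ : DLoo'_fun \in dual_pred }.

HB.instance Definition _ := [isSub for DLoo'_fun].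
HB.instance Definition _ := [Choice of DLoo' by <:].
HB.instance Definition _ := [SubChoice_isSubLmodule of DLoo' by <:].

Definition strong_seminorm (B : set E) (S : DLoo') : \bar R :=
  ereal_sup [set (normc (S f))%:E | f in B].

Let strong_open : set_system DLoo' :=
  seminorm_open setT [set strong_seminorm B | B in @von_neumann_bounded R[i] E].

HB.instance Definition _ := isOpenTopological.Build DLoo'
  (seminorm_openT _ _ : strong_open setT)
  (@seminorm_openI _ _ _ _ : setI_closed strong_open)
  (@seminorm_open_bigcup _ _ _ _).

Definition vanishes_on (S : DLoo') (U : set 'rV[R]_n) :=
  forall f : E, test_function f -> fsupport f `<=` U -> S f = 0.

Definition dsupport (S : DLoo') : set 'rV[R]_n :=
  ~` \bigcup_(U in [set U | open U /\ vanishes_on S U]) U.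

(* A compactly supported distribution extends uniquely to a continuous linear
   functional on D_{L^1}, which is how E' is a subspace of D'_{L^oo}. *)
Definition compactly_supported : set DLoo' := [set S | compact (dsupport S)].

(* Despite the notation, not the dual of the space \dot{B}. *)
Definition Bdot' : set DLoo' := closure compactly_supported.

(* The translates x |-> phi (x - .) of a Schwartz function belong to D_{L^1},
   hence the default value 0 of insubd is never used for such phi. *)
Definition convolution (phi : fct) (S : DLoo') : fct :=
  fun x => S (insubd 0 (fun y => phi (x - y))).

(* phi * S is continuous, so its L^oo norm is the plain supremum. *)
Definition conv_seminorm (phi : fct) (S : DLoo') : \bar R :=
  ereal_sup (range (fun x => (normc (convolution phi S x))%:E)).

End Dual.

(* Main.v *)
From HB Require Import structures.
Require Import Defs.
From mathcomp Require Import all_boot all_order all_algebra.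
From mathcomp Require Import complex.
From mathcomp Require Import all_classical all_reals all_analysis.
From mathcomp Require Import measurable_realfun.
From mathcomp Require Import lra ring.

Import Order.TTheory GRing.Theory Num.Theory.
Import numFieldNormedType.Exports.

Set Implicit Arguments.
Unset Strict Implicit.
Unset Printing Implicit Defensive.

Local Open Scope classical_set_scope.
Local Open Scope ring_scope.

(** A bounded set of D_{L^1} is a set of functions whose derivatives of each
order are bounded in L^1 (seminorm_bounded, bounded_von_neumann), and the
strong topology is generated by the suprema of |S f| over such sets.

The translates of one Schwartz function form a bounded set, because the
L^1 norms of derivatives do not change under translation and reflection
(schwartz_translates_bounded).  As the seminorm of phi is the supremum of
|S| over the translates of the reflected phi, it is one of the strong
seminorms (conv_seminormE), and the convolution seminorms give nothing new.

The converse is a quantitative form of the Dixmier-Malliavin factorization: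
for a bounded set B there are one test function phi and one constant K with

    sup_{f in B} |S f| <= K ||phi * S||_oo   for every S

(test_function_bound).  By taking real and imaginary parts it is enough to
treat real functions and real functionals T (factor_bound).  Put
U_f(y) = T(f(. - y)); this is phi * T up to a reflection when f = phi, and
the integral of u U_f is T(u * f) in disguise.  Let L_1, L_2, ... be the
operators 1 + d_i / lambda_k, where i runs through the coordinates again and
again and lambda_k grows very fast.  The kernel of the inverse of
1 + d / lambda is the exponential density of rate lambda, which has
unbounded support; here it is truncated to an interval of length 2^-(k+1).
An infinite convolution of truncated exponential densities is a smooth
probability density psi supported in [0, 1] (kernel), and splitting off one
factor gives

    (1 - e)(psi_m + psi_m' / lambda_m) = psi_{m+1} - e psi_{m+1}(. - w),

with e = exp(- lambda_m w) (kernel_recursion).  The tensor products of such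
densities are the test functions used below (kernel_tensor).

The truncation costs nothing.  If w(y) is the integral of psi_{m+1} U_g(. + y),
the displayed identity and an integration by parts show that
w(y) - e w(y + v) is (1 - e) times the same integral with psi_m in place of
psi_{m+1} and L g in place of g.  A bound c on the latter bounds w by c as
well, since sup |w| <= (1 - e) c + e sup |w| (contraction_bound, pair_step).
Iterating, the integral of psi_N U_f is bounded by that of
psi_0 U_{L_1 ... L_N f}, that is, up to the exchange of the two factors
(pair_swap), by ||L_1 ... L_N f||_1 sup |U_{psi_0}|.  With lambda_k large
compared with the bounds on the derivatives of the elements of B, the L^1
norm stays bounded uniformly in N and f (raise_L1).  When N grows, the
densities psi_N concentrate at 0, so that the left side tends to T f.  The
test function psi_0 depends on these bounds only, not on T.

The functional T is only defined on smooth functions and only known to be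
linear and bounded by finitely many L^1 norms, so T cannot be moved through
an integral directly.  Convolutions are therefore replaced by Riemann sums
over the cells of a grid, which converge in L^1 with all derivatives; two
pairs of functions with equal convolutions then give equal integrals
(pairing_eq).  The exchange of factors and the integration by parts are both
instances of this. *)

(** * Partial derivatives of smooth real functions *)

HB.lock Definition dpart (R : realType) (n : nat) (i : 'I_n)
  (f : 'rV[R]_n -> R) : 'rV[R]_n -> R := fun x => 'D_(delta_mx 0 i) f x.

Arguments dpart {R n}.

Section Calculus.
Context {R : realType} {n : nat}.
Local Notation E := 'rV[R]_n.
Implicit Types (f g : E -> R) (i j : 'I_n) (s : seq 'I_n) (x y v : E).

Lemma dpartE i f x : dpart i f x = 'D_(delta_mx 0 i) f x.
Proof. by rewrite unlock. Qed.

Definition dparts s f : E -> R := foldr dpart f s.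
Definition csmooth f := forall s, continuous (dparts s f) /\
  forall i x, derivable (dparts s f) x (delta_mx 0 i).
Definition tr y f : E -> R := fun x => f (x - y).

Lemma line_quotient f x v (t : R) :
  (fun h : R => h^-1 *: (((fun t : R => f (x + t *: v)) \o shift t) (h *: (1 : R))
     - f (x + t *: v))) =
  (fun h : R => h^-1 *: ((f \o shift (x + t *: v)) (h *: v) - f (x + t *: v))).
Proof.
apply/funext => h /=; congr (_ *: (f _ - _)).
by rewrite [h%:A]mulr1 scalerDl addrCA.
Qed.

Lemma is_derive_line f x v (t : R) : derivable f (x + t *: v) v ->
  is_derive t (1 : R) (fun t : R => f (x + t *: v)) ('D_v f (x + t *: v)).
Proof.
move=> df; split; first by rewrite /derivable line_quotient.
by rewrite /derive line_quotient.
Qed.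

Lemma derivable_line f x v : derivable (fun t : R => f (x + t *: v)) (0 : R) 1 ->
  derivable f x v.
Proof. by rewrite /derivable line_quotient scale0r addr0. Qed.

Lemma derive_line f x v : 'D_1 (fun t : R => f (x + t *: v)) (0 : R) = 'D_v f x.
Proof. by rewrite /derive line_quotient scale0r addr0. Qed.

Lemma comp_continuous (T U V : topologicalType) (h : T -> U) (k : U -> V) :
  continuous h -> continuous k -> continuous (fun t => k (h t)).
Proof. by move=> ch ck t; exact: continuous_comp (ch t) (ck (h t)). Qed.

Lemma csmooth_cont f : csmooth f -> continuous f.
Proof. by move=> /(_ [::])[]. Qed.

Lemma csmooth_derivable f i x : csmooth f -> derivable f x (delta_mx 0 i).
Proof. by move=> /(_ [::])[_]; apply. Qed.

Lemma csmooth_dparts f s : csmooth f -> csmooth (dparts s f).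
Proof. by move=> sf t; rewrite /dparts -foldr_cat; exact: sf (t ++ s). Qed.

Lemma csmooth_dpart f i : csmooth f -> csmooth (dpart i f).
Proof. exact: (@csmooth_dparts f [:: i]). Qed.

Lemma dpartsD s f g : csmooth f -> csmooth g ->
  dparts s (fun x => f x + g x) = (fun x => dparts s f x + dparts s g x).
Proof.
move=> sf sg; elim: s => //= i s IH; rewrite IH; apply/funext => x.
by rewrite !dpartE deriveD//; [apply: (sf s).2|apply: (sg s).2].
Qed.

Lemma dpartsZ s (c : R) f : csmooth f ->
  dparts s (fun x => c * f x) = (fun x => c * dparts s f x).
Proof.
move=> sf; elim: s => //= i s IH; rewrite IH; apply/funext => x.
by rewrite !dpartE deriveZ//; exact: (sf s).2.
Qed.

Lemma csmoothD f g : csmooth f -> csmooth g -> csmooth (fun x => f x + g x).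
Proof.
move=> sf sg s; rewrite dpartsD//; split.
  move=> x; apply: (@continuousD _ _ _ (dparts s f) (dparts s g)).
    exact: (sf s).1.
  exact: (sg s).1.
by move=> i x; apply: derivableD; [exact: (sf s).2|exact: (sg s).2].
Qed.

Lemma csmoothZ (c : R) f : csmooth f -> csmooth (fun x => c * f x).
Proof.
move=> sf s; rewrite dpartsZ//; split.
  move=> x; apply: (@continuousM _ _ (cst c) (dparts s f)).
    exact: cst_continuous.
  exact: (sf s).1.
by move=> i x; apply: derivableZ; exact: (sf s).2.
Qed.

Lemma tr_quotient y f x v :
  (fun h : R => h^-1 *: ((tr y f \o shift x) (h *: v) - tr y f x)) =
  (fun h : R => h^-1 *: ((f \o shift (x - y)) (h *: v) - f (x - y))).
Proof. by apply/funext => h /=; rewrite /tr addrA. Qed.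

Lemma dpart_tr i y f : dpart i (tr y f) = tr y (dpart i f).
Proof. by apply/funext => x; rewrite [RHS]/tr !dpartE /derive tr_quotient. Qed.

Lemma dparts_tr s y f : dparts s (tr y f) = tr y (dparts s f).
Proof. by elim: s => //= i s ->; exact: dpart_tr. Qed.

Lemma csmooth_tr y f : csmooth f -> csmooth (tr y f).
Proof.
move=> sf s; rewrite dparts_tr; split.
  by apply: comp_continuous (sf s).1 => x;
    apply: (@continuousB _ _ _ id (cst y)); [exact: cvg_id|exact: cst_continuous].
by move=> i x; rewrite /derivable tr_quotient; exact: (sf s).2.
Qed.

Lemma csmooth_derive1 f x i (t : R) : csmooth f ->
  is_derive t (1 : R) (fun t : R => f (x + t *: delta_mx 0 i))
    (dpart i f (x + t *: delta_mx 0 i)).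
Proof.
by move=> sf; rewrite dpartE; apply: is_derive_line; exact: csmooth_derivable.
Qed.

Lemma line_continuous f x v : continuous f ->
  continuous (fun t : R => f (x + t *: v)).
Proof.
move=> cf; apply: comp_continuous cf => t; rewrite /continuous_at.
apply: cvgD; first exact: cvg_cst.
exact: scalel_continuous.
Qed.

Lemma line_MVT f x i (a b : R) : csmooth f -> a < b ->
  exists2 c, c \in `]a, b[ &
   f (x + b *: delta_mx 0 i) - f (x + a *: delta_mx 0 i) =
   dpart i f (x + c *: delta_mx 0 i) * (b - a).
Proof.
move=> sf ab.
apply: (@MVT R (fun t => f (x + t *: delta_mx 0 i))
  (fun t => dpart i f (x + t *: delta_mx 0 i))) => //.
  by move=> t _; exact: csmooth_derive1.
by apply: continuous_subspaceT; apply: line_continuous; exact: csmooth_cont.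
Qed.

Lemma normr_delta_mx i : `|delta_mx 0 i : E| <= 1.
Proof.
rewrite [X in X <= _]mx_normrE; apply/bigmax_leP; split => // -[k j] _ /=.
by rewrite mxE; case: (_ && _); rewrite ?normr1 ?normr0.
Qed.

(** Applying the mean value theorem along i and then along j; the expression is
symmetric in i and j, which is what the symmetry of second derivatives uses. *)
Lemma square_MVT f x i j (h : R) : csmooth f -> 0 < h -> exists y,
  `|y - x| <= h + h /\
  f (x + h *: delta_mx 0 i + h *: delta_mx 0 j) - f (x + h *: delta_mx 0 i)
  - f (x + h *: delta_mx 0 j) + f x = dpart j (dpart i f) y * h * h.
Proof.
move=> sf h0.
pose g := fun x => f (x + h *: delta_mx 0 j) - f x.
have gE : g = (fun x => tr (- (h *: delta_mx 0 j)) f x + -1 * f x).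
  by apply/funext => z; rewrite /g /tr opprK mulN1r.
have sg : csmooth g.
  by rewrite gE; apply: csmoothD; [exact: csmooth_tr|exact: csmoothZ].
have dg : dpart i g = (fun z => dpart i f (z + h *: delta_mx 0 j) - dpart i f z).
  have := @dpartsD [:: i] _ _ (csmooth_tr (- (h *: delta_mx 0 j)) sf)
    (csmoothZ (-1) sf).
  rewrite -gE /= => ->; apply/funext => z.
  have /= -> := @dpartsZ [:: i] (-1) _ sf.
  by rewrite dpart_tr /tr opprK mulN1r.
have [c + Ec] := line_MVT x i sg h0; rewrite in_itv/= => /andP[c0 ch].
have [d + Ed] := line_MVT (x + c *: delta_mx 0 i) j (csmooth_dpart i sf) h0.
rewrite in_itv/= => /andP[d0 dh].
exists (x + c *: delta_mx 0 i + d *: delta_mx 0 j); split.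
  rewrite -[x + _ + _]addrA [x + _]addrC addrK (le_trans (ler_normD _ _))//.
  rewrite !normrZ !gtr0_norm//; apply: lerD.
    by rewrite (le_trans (ler_wpM2l (ltW c0) (normr_delta_mx i)))// mulr1 ltW.
  by rewrite (le_trans (ler_wpM2l (ltW d0) (normr_delta_mx j)))// mulr1 ltW.
move: Ec; rewrite dg scale0r addr0 !subr0.
move: Ed; rewrite scale0r addr0 subr0 => ->.
by rewrite /g => <-; move: (f _) (f _) (f _) (f _) => p q r s; ring.
Qed.

(** Both mixed derivatives at x are limits of the same second difference, read
in the two orders. *)
Lemma dpartC f i j : csmooth f -> dpart i (dpart j f) = dpart j (dpart i f).
Proof.
move=> sf; apply/funext => x; apply/eqP; rewrite -subr_eq0 -normr_le0.
apply/ler_addgt0Pl => e e0; rewrite addr0.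
have c1 := (sf [:: i; j]).1 x; have c2 := (sf [:: j; i]).1 x.
have /cvgrPdist_lt/(_ (e / 2) (divr_gt0 e0 (ltr0n _ 2)))/nbhs_normP[d1 /= d10 h1] := c1.
have /cvgrPdist_lt/(_ (e / 2) (divr_gt0 e0 (ltr0n _ 2)))/nbhs_normP[d2 /= d20 h2] := c2.
(* the mean value points lie within 2 h of x, hence the division by 3 *)
pose h := Num.min d1 d2 / 3.
have m0 : 0 < Num.min d1 d2 by rewrite lt_min d10.
have h0 : 0 < h by rewrite divr_gt0.
have hd1 : h + h < d1.
  by apply: (@lt_le_trans _ _ (Num.min d1 d2)); [rewrite /h; lra|rewrite ge_min lexx].
have hd2 : h + h < d2.
  by apply: (@lt_le_trans _ _ (Num.min d1 d2)); [rewrite /h; lra|rewrite ge_min lexx orbT].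
have [y [yx Ey]] := square_MVT x i j sf h0.
have [z [zx Ez]] := square_MVT x j i sf h0.
have E : dpart j (dpart i f) y = dpart i (dpart j f) z.
  apply: (mulIf (lt0r_neq0 h0)); apply: (mulIf (lt0r_neq0 h0)).
  rewrite -{}Ey -{}Ez (addrAC x (h *: delta_mx 0 i)).
  move: (f (x + _ + _)) (f (x + _)) (f (x + _)) (f x) => p q r s.
  by ring.
have /= H1 := h1 z (ltac:(rewrite /= distrC; exact: le_lt_trans zx hd1)).
have /= H2 := h2 y (ltac:(rewrite /= distrC; exact: le_lt_trans yx hd2)).
move: H1 H2 E; set a1 := dpart i _ x; set a2 := dpart j _ x.
move: a1 a2 (dpart i _ z) (dpart j _ y) => a1 a2 b1 b2 H1 H2 E.
rewrite (_ : a1 - a2 = (a1 - b1) - (a2 - b2)); last by rewrite E; ring.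
by rewrite (le_trans (ler_normB _ _))// (splitr e) lerD// ltW.
Qed.

Lemma dpart_dparts f i s : csmooth f -> dpart i (dparts s f) = dparts s (dpart i f).
Proof.
move=> sf; elim: s => //= j s <-.
exact: dpartC (csmooth_dparts s sf).
Qed.

(** This reconciles iterated derivatives indexed by lists with multi-indices: any
list can be sorted. *)
Lemma dparts_perm f s t : csmooth f -> perm_eq s t -> dparts s f = dparts t f.
Proof.
move=> sf st; pose P (u : seq 'I_n) := dparts s f = dparts u f.
have PcatCA s1 s2 s3 : P (s1 ++ s2 ++ s3) -> P (s2 ++ s1 ++ s3).
  rewrite /P => ->; rewrite /dparts !foldr_cat -/(dparts s3 f).
  have : csmooth (dparts s3 f) by exact: csmooth_dparts.
  move: (dparts s3 f) => g sg; elim: s1 => //= i s1 ->.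
  rewrite -/(dparts s1 g) -!/(dparts s2 _).
  exact: dpart_dparts (csmooth_dparts s1 sg).
exact: (catCA_perm_ind PcatCA st (erefl _)).
Qed.

End Calculus.

(** * Grids and step functions *)

Section Grid.
Context {R : realType} {n : nat}.
Local Notation E := 'rV[R]_n.
Local Notation T := (n.-tuple R).

Definition grid_index N := {ffun 'I_n -> 'I_(N.+1 * N.+1).*2}.

(** The lower left corners of the cells: the cube of side 2(N+1) centred at 0 is
cut into cubes of side 1/(N+1), so that both the mesh and the uncovered part
vanish in the limit. *)
Definition grid_point N (z : grid_index N) : E :=
  \row_i ((z i)%:R / N.+1%:R - N.+1%:R).

Definition in_cell N (z : grid_index N) (t : T) : bool :=
  [forall i, (z i)%:R <= N.+1%:R * (tnth t i + N.+1%:R) < (z i).+1%:R].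

(** A step function that vanishes off the cube; its integral against f is
a Riemann sum weighted by the masses of f on the cells. *)
Definition grid_step N (F : E -> R) (t : T) : R :=
  \sum_(z : grid_index N) (in_cell z t)%:R * F (grid_point z).

Lemma in_cell_inj N (z z' : grid_index N) t :
  in_cell z t -> in_cell z' t -> z = z'.
Proof.
move=> /forallP zt /forallP z't; apply/ffunP => i; apply/val_inj/eqP.
move: (zt i) (z't i) => /andP[a b] /andP[c d].
have := le_lt_trans a d; have := le_lt_trans c b.
by rewrite !ltr_nat !ltnS eqn_leq => -> ->.
Qed.

Lemma in_cell_close N (z : grid_index N) t :
  in_cell z t -> `|grid_point z - row_of_tuple t| <= N.+1%:R^-1.
Proof.
move=> /forallP zt; rewrite [X in X <= _]mx_normrE; apply/bigmax_leP; split.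
  by rewrite invr_ge0.
move=> [k j] _ /=; rewrite !mxE; move: (zt j) => /andP[].
set m : R := N.+1%:R; have m0 : 0 < m by rewrite ltr0n.
rewrite -natr1; move: (tnth t j) ((z j)%:R : R) => r q h1 h2.
have -> : q / m - m - r = (q - m * (r + m)) / m by field; rewrite gt_eqF.
have mV0 : 0 <= m^-1 by rewrite invr_ge0 ltW.
rewrite normrM (ger0_norm mV0); apply: ler_piMl => //.
by rewrite ler_norml; apply/andP; split; lra.
Qed.

(** Any point is covered as soon as the cube is larger than the sum of the
absolute values of its coordinates. *)
Lemma in_cell_near t : exists N0, forall N, (N0 <= N)%N ->
  exists z : grid_index N, in_cell z t.
Proof.
pose s : R := \sum_i `|tnth t i|.
have [N0 sN0] : exists N0 : nat, s < N0%:R.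
  by exists (Num.bound s); apply: archi_boundP; rewrite /s sumr_ge0.
exists N0 => N N0N.
set m : R := N.+1%:R; have m0 : 0 < m by rewrite ltr0n.
have tm i : `|tnth t i| < m.
  have sm : s < m by rewrite (lt_le_trans sN0)// ler_nat leqW.
  apply: le_lt_trans sm.
  by rewrite /s (bigD1 i)//= lerDl sumr_ge0.
pose q i := m * (tnth t i + m).
have q0 i : 0 <= q i.
  by have := tm i; rewrite /q ltr_norml => /andP[h1 h2]; rewrite mulr_ge0//; lra.
have q1 i : (Num.truncn (q i) < (N.+1 * N.+1).*2)%N.
  rewrite -(@ltr_nat R); apply: le_lt_trans (_ : q i < _).
    by rewrite truncn_le.
  rewrite -mul2n !natrM -/m /q; have := tm i; rewrite ltr_norml => /andP[h1 h2].
  by rewrite mulrCA ltr_pM2l//; lra.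
exists [ffun i => Ordinal (q1 i)]; apply/forallP => i; rewrite ffunE /=.
by have /andP[-> ->] := truncn_itv (q0 i).
Qed.

Lemma grid_stepE N F t (z : grid_index N) :
  in_cell z t -> grid_step N F t = F (grid_point z).
Proof.
move=> zt; rewrite /grid_step (bigD1 z)//= zt mul1r big1 ?addr0// => z' z'z.
case: (boolP (in_cell z' t)) => [z't|_]; last by rewrite mul0r.
by move: z'z; rewrite (in_cell_inj z't zt) eqxx.
Qed.

Lemma grid_step_le N F t (M : R) : (forall x, `|F x| <= M) ->
  `|grid_step N F t| <= M.
Proof.
move=> FM; have [[z zt]|h] := pselect (exists z : grid_index N, in_cell z t).
  by rewrite (grid_stepE F zt).
rewrite /grid_step big1 => [|z _].
  by rewrite normr0 (le_trans _ (FM 0)).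
by case: (boolP (in_cell z t)) => [zt|_]; [case: h; exists z|rewrite mul0r].
Qed.

Lemma grid_step_cvg (F : E -> R) t : continuous F ->
  grid_step N F t @[N --> \oo] --> F (row_of_tuple t).
Proof.
move=> cF; apply/cvgrPdist_lt => e e0.
have /cvgrPdist_lt/(_ _ e0)/nbhs_normP[d /= d0 h] := cF (row_of_tuple t).
have [N0 HN0] := in_cell_near t.
near=> N.
have N0N : (N0 <= N)%N by near: N; exact: nbhs_infty_ge.
have [z zt] := HN0 N N0N.
rewrite (grid_stepE F zt); apply: h => /=; rewrite distrC.
apply: le_lt_trans (in_cell_close zt) _.
by near: N; exact: near_infty_natSinv_lt (PosNum d0).
Unshelve. all: by end_near. Qed.

Lemma measurable_in_cell N (z : grid_index N) :
  measurable_fun setT (fun t : T => (in_cell z t)%:R : R).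
Proof.
have -> : (fun t : T => (in_cell z t)%:R : R) = (fun t =>
    \prod_(i < n)
      ((z i)%:R <= N.+1%:R * (tnth t i + N.+1%:R) < (z i).+1%:R)%R%:R).
  apply/funext => t; have [/forallP h|/forallPn[i hi]] := boolP (in_cell z t).
    by rewrite big1// => i _; rewrite h.
  by rewrite (bigD1 i)//= (negbTE hi) mul0r.
apply: measurable_prod => i _.
have mi : measurable_fun setT (fun t : T => N.+1%:R * (tnth t i + N.+1%:R)).
  apply: measurable_funM => //; apply: measurable_funD => //.
  exact: measurable_tnth.
rewrite (_ : (fun t : T => _) = (\1_(`[(z i)%:R, (z i).+1%:R[ : set R)) \o
   (fun t : T => N.+1%:R * (tnth t i + N.+1%:R))); last first.
  apply/funext => t /=; rewrite indicE; congr (_%:R); congr nat_of_bool.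
  by apply/idP/idP => [h|]; rewrite ?inE/= ?in_itv//= inE/= in_itv.
by apply: measurableT_comp => //; exact: measurable_indic.
Qed.

Lemma measurable_grid_step N F : measurable_fun setT (grid_step N F).
Proof.
apply: measurable_sum => z; apply: measurable_funM => //.
exact: measurable_in_cell.
Qed.

(** The sigma-algebra is the product one on tuples, which says nothing of the
topology of row vectors; a continuous function is measurable as the limit of
its grid step functions. *)
Lemma measurable_cont_row (F : E -> R) : continuous F ->
  measurable_fun setT (fun t : T => F (row_of_tuple t)).
Proof.
move=> cF; apply: (@measurable_fun_cvg _ _ _ _ (grid_step ^~ F)) => [N|t _].
  exact: measurable_grid_step.
exact: grid_step_cvg.
Qed.

End Grid.

(** * Invariance of the Lebesgue measure under translations and reflections *)

Section Invariance.
Context {R : realType}.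
Local Notation mu := (@lebesgue_measure R).

Notation leb n := (@lebesgue_tuple R n).

(** The image of the Lebesgue measure gives each interval its length, hence is
the Lebesgue measure by uniqueness. *)
Lemma integral_lebesgue_affine (c s : R) (G : R -> \bar R) : `|s| = 1 ->
  measurable_fun setT G -> (forall x, 0 <= G x)%E ->
  (\int[mu]_x G (c + s * x)%R = \int[mu]_x G x)%E.
Proof.
move=> s1 mG G0.
have s1' : s = 1 \/ s = -1.
  by move: s1; case: (ger0P s) => _ sE; [left|right]; rewrite // -sE opprK.
have mh : measurable_fun setT (fun x : measurableTypeR R => (c + s * x)%R : measurableTypeR R).
  by apply: measurable_funD => //; exact: measurable_funM.
pose nu := measure_function_pushforward__canonical__measure_function_Measure mu mh.
have E A : measurable A -> mu A = nu A.
  apply: lebesgue_measure_unique => X [[a b] /= _ <-].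
  rewrite /nu/= /pushforward lebesgue_measure_itv/=.
  have [-> {s1 s1'}|-> {s1 s1'}] := s1'.
    rewrite (_ : _ @^-1` _ = `]a - c, b - c]%classic); last first.
      apply/seteqP; split => x /=; rewrite !in_itv/= mul1r;
        by rewrite ltrBlDl lerBrDl.
    by rewrite lebesgue_measure_itv/= !lte_fin ltrD2r -!EFinB opprB addrA subrK.
  rewrite (_ : _ @^-1` _ = `[c - b, c - a[%classic); last first.
    apply/seteqP; split => x /=; rewrite !in_itv/= mulN1r => /andP[h1 h2];
      by apply/andP; split; lra.
  rewrite lebesgue_measure_itv/= !lte_fin ltrD2l ltrN2 -!EFinB.
  by case: ifP => // _; congr EFin; ring.
rewrite [RHS](eq_measure_integral nu); last by move=> A mA _; exact: E.
by rewrite ge0_integral_pushforward.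
Qed.

Lemma lebesgue_tuple_fubini n (F : n.+1.-tuple R -> \bar R) :
  measurable_fun setT F -> (forall t, 0 <= F t)%E ->
  (\int[leb n.+1]_t F t = \int[mu]_x \int[leb n]_t F (cons_pair (x, t)))%E.
Proof.
move=> mF F0.
have mh : measurable_fun (setT : set (measurableTypeR R * n.-tuple R)%type)
  (@cons_pair R n) by exact: measurable_cons_pair.
transitivity (\int[(mu \x leb n)]_p F (cons_pair p))%E.
  have E : @lebesgue_tuple R n.+1 = pushforward (mu \x leb n)%E (@cons_pair R n) by [].
  rewrite E.
  rewrite (@ge0_integral_pushforward _ _ _ _ R _ mh (lebesgue_integral_fubini_product_measure1__canonical__measure_function_Measure mu (leb n)) setT F)//.
rewrite (@fubini_tonelli1 _ _ _ _ R mu (leb n) (F \o @cons_pair R n))//.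
  exact: measurableT_comp.
by move=> x; exact: F0.
Qed.

Definition affine_tuple n (c : n.-tuple R) (s : R) (t : n.-tuple R) :=
  [tuple tnth c i + s * tnth t i | i < n].

Lemma measurable_affine_tuple n (c : n.-tuple R) s :
  measurable_fun setT (affine_tuple c s).
Proof.
apply/measurable_fun_tnthP => i; rewrite /comp /affine_tuple.
under eq_fun do rewrite tnth_mktuple.
apply: measurable_funD => //; apply: measurable_funM => //.
exact: measurable_tnth.
Qed.

(** One coordinate at a time, by Tonelli. *)
Lemma integral_affine_tuple n (c : n.-tuple R) s (F : n.-tuple R -> \bar R) :
  `|s| = 1 -> measurable_fun setT F -> (forall t, 0 <= F t)%E ->
  (\int[leb n]_t F (affine_tuple c s t) = \int[leb n]_t F t)%E.
Proof.
move=> s1; elim: n c F => [|n IH] c F mF F0.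
  by apply: eq_integral => t _; congr F; apply: eq_from_tnth => -[].
have mcons (a : R) : measurable_fun setT (fun t : n.-tuple R => cons_pair (a, t)).
  apply: (measurableT_comp (@measurable_cons_pair R n)).
  exact: measurable_pair1.
have mF' : measurable_fun setT (F \o affine_tuple c s).
  by apply: measurableT_comp => //; exact: measurable_affine_tuple.
rewrite (lebesgue_tuple_fubini mF F0) (lebesgue_tuple_fubini mF' (fun=> F0 _)).
move=> {mF'}; case/tupleP: c => c0 c.
pose G z := (\int[leb n]_t F (cons_pair (z, t)))%E.
have -> : (fun x => \int[leb n]_t F (affine_tuple [tuple of c0 :: c] s (cons_pair (x, t))))%E =
  (fun x => G (c0 + s * x)).
  apply/funext => x; rewrite /G.
  rewrite -(IH c (fun t => F (cons_pair (c0 + s * x, t))))//; last first.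
    exact: measurableT_comp.
  apply: eq_integral => t _; congr F; apply: eq_from_tnth => i.
  rewrite tnth_mktuple; case: (unliftP ord0 i) => [j ->|->]; last by rewrite !tnth0.
  by rewrite !tnthS tnth_mktuple.
apply: (integral_lebesgue_affine c0 s1); last by move=> x; exact: integral_ge0.
have mF' : measurable_fun setT (F \o @cons_pair R n).
  by apply: measurableT_comp => //; exact: measurable_cons_pair.
exact: (@measurable_fun_fubini_tonelli_F _ _ _ _ R (leb n) _ mF' (fun=> F0 _)).
Qed.

End Invariance.

(** * L^1 norms and integrals of continuous functions *)

Section L1space.
Context {R : realType} {n : nat}.
Local Notation E := 'rV[R]_n.
Local Notation mu := (@lebesgue_measure R).
Local Notation leb := (@lebesgue_tuple R n).
Implicit Types (f g : E -> R) (x y v : E).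

Local Notation row := (@row_of_tuple R n).

Definition tuple_of_row (x : E) : n.-tuple R := [tuple x 0 i | i < n].

Lemma tuple_of_rowK x : row (tuple_of_row x) = x.
Proof. by apply/rowP => i; rewrite mxE tnth_mktuple. Qed.

Lemma row_affine_tuple c s t :
  row (affine_tuple c s t) = row c + s *: row t.
Proof. by apply/rowP => i; rewrite !mxE tnth_mktuple. Qed.

Definition L1 f : \bar R := (\int[leb]_t `|f (row t)|%:E)%E.
Definition integ f := leb.-integrable setT (fun t : n.-tuple R => (f (row t))%:E).
Definition Int f : R := (\int[leb]_t f (row t))%R.

Lemma measurable_cont_rowE f : continuous f ->
  measurable_fun setT (fun t : n.-tuple R => (f (row t))%:E).
Proof. by move=> cf; apply/measurable_EFinP; exact: measurable_cont_row. Qed.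

Lemma measurable_cont_row_norm f : continuous f ->
  measurable_fun setT (fun t : n.-tuple R => `|f (row t)|%:E).
Proof.
move=> cf; apply/measurable_EFinP; apply: measurableT_comp => //.
exact: measurable_cont_row.
Qed.

Lemma L1_ge0 f : (0 <= L1 f)%E.
Proof. by apply: integral_ge0 => t _; rewrite lee_fin. Qed.

Lemma integP f : continuous f -> integ f <-> (L1 f < +oo)%E.
Proof.
move=> cf; split => [/integrableP[_]|fo]; first by under eq_integral do rewrite abse_EFin.
apply/integrableP; split; first exact: measurable_cont_rowE.
by under eq_integral do rewrite abse_EFin.
Qed.

Lemma L1_affine f c s : continuous f -> `|s| = 1 ->
  L1 (fun x => f (c + s *: x)) = L1 f.
Proof.
move=> cf s1; rewrite /L1.
rewrite -(integral_affine_tuple (tuple_of_row c) s1 (measurable_cont_row_norm cf))//.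
by apply: eq_integral => t _; rewrite row_affine_tuple tuple_of_rowK.
Qed.

Lemma L1_shift f c : continuous f -> L1 (fun x => f (x + c)) = L1 f.
Proof.
move=> cf; rewrite -(@L1_affine f c 1 cf) ?normr1//; congr L1.
by apply/funext => x; rewrite scale1r addrC.
Qed.

Lemma L1_tr f y : continuous f -> L1 (tr y f) = L1 f.
Proof. exact: L1_shift. Qed.

Lemma affine_continuous f c (s : R) : continuous f ->
  continuous (fun x => f (c + s *: x)).
Proof.
move=> cf; apply: (comp_continuous _ cf) => x; rewrite /continuous_at.
apply: (@cvgD R E E (nbhs x) _ (cst c) ( *:%R s)); first exact: cvg_cst.
exact: scaler_continuous.
Qed.

Lemma shift_continuous f c : continuous f -> continuous (fun x => f (x + c)).
Proof.
move=> cf; rewrite (_ : (fun x => _) = (fun x => f (c + 1 *: x))).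
  exact: affine_continuous.
by apply/funext => x; rewrite scale1r addrC.
Qed.

Lemma Int_affine f c s : continuous f -> `|s| = 1 ->
  Int (fun x => f (c + s *: x)) = Int f.
Proof.
move=> cf s1; rewrite /Int /Rintegral; congr fine.
have mf := measurable_cont_rowE cf.
pose h (t : n.-tuple R) := (f (row t))%:E.
pose a := affine_tuple (tuple_of_row c) s.
have -> : (fun t => (f (c + s *: row t))%:E) = h \o a.
  by apply/funext => t /=; rewrite /h row_affine_tuple tuple_of_rowK.
rewrite [LHS]integralE [RHS]integralE.
rewrite (_ : (h \o a)^\+%E = h^\+%E \o a); last exact: funepos_comp.
rewrite (_ : (h \o a)^\-%E = h^\-%E \o a); last exact: funeneg_comp.
have p0 t := funepos_ge0 (fun t => (f (row t))%:E) t.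
have m0 t := funeneg_ge0 (fun t => (f (row t))%:E) t.
rewrite -(integral_affine_tuple (tuple_of_row c) s1 (measurable_funepos mf) p0).
by rewrite -(integral_affine_tuple (tuple_of_row c) s1 (measurable_funeneg mf) m0) -/a /comp.
Qed.

Lemma L1_le f g : continuous f -> continuous g -> (forall x, `|f x| <= `|g x|) ->
  (L1 f <= L1 g)%E.
Proof.
move=> cf cg fg; apply: (ge0_le_integral _ measurableT) => [t _|||t _].
- by rewrite lee_fin.
- exact: measurable_cont_row_norm.
- exact: measurable_cont_row_norm.
- by rewrite lee_fin.
Qed.

Lemma continuousDf f g : continuous f -> continuous g ->
  continuous (fun x => f x + g x).
Proof.
move=> cf cg x.
by apply: (@cvgD R R E (nbhs x) _ f g); [exact: cf|exact: cg].
Qed.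

Lemma continuousMf f g : continuous f -> continuous g ->
  continuous (fun x => f x * g x).
Proof.
move=> cf cg x.
by apply: (@cvgM R E (nbhs x) _ f g); [exact: cf|exact: cg].
Qed.

Lemma continuousZf f c : continuous f -> continuous (fun x => c * f x).
Proof. by apply: continuousMf; exact: cst_continuous. Qed.

Lemma continuousBf f g : continuous f -> continuous g ->
  continuous (fun x => f x - g x).
Proof.
move=> cf cg x.
by apply: (@cvgB R R E (nbhs x) _ f g); [exact: cf|exact: cg].
Qed.

Lemma L1D f g : continuous f -> continuous g ->
  (L1 (fun x => f x + g x)%R <= L1 f + L1 g)%E.
Proof.
move=> cf cg; have mf := measurable_cont_row_norm cf.
have mg := measurable_cont_row_norm cg.
rewrite /L1 -(ge0_integralD _ measurableT)//.
apply: (ge0_le_integral _ measurableT) => [t _|||t _].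
- by rewrite lee_fin.
- exact: measurable_cont_row_norm (continuousDf cf cg).
- exact: emeasurable_funD.
- by rewrite -EFinD lee_fin ler_normD.
Qed.

Lemma L1Z f c : continuous f -> (L1 (fun x => c * f x)%R = `|c|%:E * L1 f)%E.
Proof.
move=> cf; have mf := measurable_cont_row_norm cf.
rewrite /L1 -(ge0_integralZl _ measurableT mf)//.
by apply: eq_integral => t _; rewrite normrM EFinM.
Qed.

Lemma Int_le f : continuous f -> (`|Int f|%:E <= L1 f)%E.
Proof.
move=> cf; have [fo|] := ltP (L1 f) +oo%E; last by rewrite leye_eq => /eqP ->; rewrite leey.
have If : integ f by exact/integP.
rewrite /Int EFin_normr_Rintegral//.
apply: le_trans (le_abse_integral _ measurableT (measurable_cont_rowE cf)) _.
by under eq_integral do rewrite abse_EFin.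
Qed.

End L1space.

(** * Differences along coordinate lines *)

Section LineIntegrals.
Context {R : realType} {n : nat}.
Local Notation E := 'rV[R]_n.
Local Notation mu := (@lebesgue_measure R).
Local Notation leb := (@lebesgue_tuple R n).
Local Notation row := (@row_of_tuple R n).
Implicit Types (f g h k : E -> R) (x y v : E) (i : 'I_n).

(** Only the derivative in one direction matters when integrating along lines;
this applies to products such as y |-> u y * k (x - y) without differentiating
them in the other directions. *)
Definition derivable_along i h k := forall x (t : R),
  is_derive t (1 : R) (fun t : R => h (x + t *: delta_mx 0 i))
    (k (x + t *: delta_mx 0 i)).

Lemma csmooth_derivable_along f i : csmooth f -> derivable_along i f (dpart i f).
Proof. by move=> sf x t; exact: csmooth_derive1. Qed.

Lemma line_FTC h k i x (a : R) : continuous h -> continuous k ->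
  derivable_along i h k -> 0 < a ->
  (\int[mu]_(s in `[0%R, a]) (k (x + s *: delta_mx 0 i)%R)%:E =
   (h (x + a *: delta_mx 0 i)%R - h x)%:E)%E.
Proof.
move=> ch ck hk a0.
have lh := @line_continuous R n h x (delta_mx 0 i) ch.
rewrite (@continuous_FTC2 R (fun s => k (x + s *: delta_mx 0 i))
  (fun s : R => h (x + s *: delta_mx 0 i)) 0 a)//.
- by rewrite scale0r addr0.
- by apply: continuous_subspaceT; exact: line_continuous.
- split.
  + by move=> s _; exact: (@ex_derive _ _ _ _ _ _ _ (hk x s)).
  + by apply: cvg_at_right_filter; exact: lh.
  + by apply: cvg_at_left_filter; exact: lh.
- by move=> s _; rewrite derive1E; exact: (@derive_val _ _ _ _ _ _ _ (hk x s)).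
Qed.

Lemma measurable_line_pair i k : continuous k ->
  measurable_fun setT (fun p : measurableTypeR R * n.-tuple R =>
    k (row p.2 + p.1 *: delta_mx 0 i)).
Proof.
move=> ck.
have mt : measurable_fun setT (fun p : measurableTypeR R * n.-tuple R =>
    tuple_of_row (row p.2 + p.1 *: delta_mx 0 i)).
  apply/measurable_fun_tnthP => j; rewrite /comp.
  under eq_fun do rewrite tnth_mktuple !mxE.
  apply: measurable_funD.
    by apply: (measurableT_comp (measurable_tnth j)); exact: measurable_snd.
  by apply: measurable_funM => //; exact: measurable_fst.
rewrite (_ : (fun p => _) = (fun t => k (row t)) \o
  (fun p : measurableTypeR R * n.-tuple R =>
    tuple_of_row (row p.2 + p.1 *: delta_mx 0 i))).
  by apply: measurableT_comp mt; exact: measurable_cont_row.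
by apply/funext => p /=; rewrite tuple_of_rowK.
Qed.

(** The difference is the integral of the derivative over a segment; by Tonelli
and translation invariance its L^1 norm is at most that of the derivative
times the length. *)
Lemma L1_line_difference h k i (a : R) : continuous h -> continuous k ->
  derivable_along i h k -> 0 < a ->
  (L1 (fun x => h (x + a *: delta_mx 0 i) - h x)%R <= a%:E * L1 k)%E.
Proof.
move=> ch ck hk a0.
pose F (p : measurableTypeR R * n.-tuple R) : \bar R :=
  ((\1_(`[0, a] : set R) p.1 * `|k (row p.2 + p.1 *: delta_mx 0 i)|)%:E)%E.
have mF : measurable_fun setT F.
  apply/measurable_EFinP; apply: measurable_funM.
    apply: measurableT_comp; last exact: measurable_fst.
    exact: measurable_indic.
  by apply: measurableT_comp => //; exact: measurable_line_pair.
have F0 p : (0 <= F p)%E by rewrite lee_fin mulr_ge0.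
have FE s t : F (s, t) = ((\1_(`[0, a] : set R) s)%:E *
    `|k (row t + s *: delta_mx 0 i)|%:E)%E by rewrite /F EFinM.
have cB : continuous (fun x => h (x + a *: delta_mx 0 i) - h x).
  exact: continuousBf (shift_continuous (c := a *: delta_mx 0 i) ch) ch.
have mB := measurable_cont_row_norm cB.
apply: (@le_trans _ _ (\int[leb]_t \int[mu]_s F (s, t))%E).
  apply: (ge0_le_integral _ measurableT) => [t _|||t _].
  - by rewrite lee_fin.
  - exact: mB.
  - exact: (@measurable_fun_fubini_tonelli_G _ _ (measurableTypeR R) _ R mu F mF F0).
  - rewrite -abse_EFin -(line_FTC _ ch ck hk a0).
    have mk : measurable_fun `[0, a] (fun s => (k (row t + s *: delta_mx 0 i))%:E).
      apply: measurable_funTS; apply/measurable_EFinP.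
      by apply: continuous_measurable_fun; exact: line_continuous.
    apply: (le_trans (le_abse_integral mu (measurable_itv `[0, a]) mk)).
    rewrite [leLHS]integral_mkcond le_eqVlt; apply/orP; left; apply/eqP.
    apply: eq_integral => s _; rewrite FE patchE indicE.
    by case: ifPn => _; rewrite ?mul1e ?mul0e.
rewrite -(fubini_tonelli _ mF F0).
rewrite (_ : (fun s => \int[leb]_t F (s, t))%E = (fun s => L1 k * (\1_(`[0, a] : set R) s)%:E)%E); last first.
  apply/funext => s; under eq_integral do rewrite FE.
  rewrite (ge0_integralZl _ measurableT (measurable_cont_row_norm (shift_continuous (c := s *: delta_mx 0 i) ck)))//.
  by rewrite muleC; congr (_ * _)%E; exact: (L1_shift (s *: delta_mx 0 i) ck).
rewrite ge0_integralZl//; last 2 first.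
  by apply/measurable_EFinP; exact: measurable_indic.
  exact: L1_ge0.
have mua : mu `[0, a]%classic = a%:E.
  by rewrite lebesgue_measure_itv/= lte_fin a0 oppr0 adde0.
by rewrite integral_indic// setIT [X in (_ * X <= _)%E]mua muleC.
Qed.

End LineIntegrals.

Section L1Derivatives.
Context {R : realType} {n : nat}.
Local Notation E := 'rV[R]_n.
Local Notation mu := (@lebesgue_measure R).
Local Notation leb := (@lebesgue_tuple R n).
Local Notation row := (@row_of_tuple R n).
Implicit Types (f g h k : E -> R) (x y v : E) (i : 'I_n).

Lemma IntB f g : integ f -> integ g -> Int (fun x => f x - g x) = Int f - Int g.
Proof. by move=> If Ig; exact: RintegralB. Qed.

Lemma Int_fin f : integ f -> (\int[leb]_t (f (row t))%:E = (Int f)%:E)%E.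
Proof.
move=> If; rewrite /Int /Rintegral fineK//.
exact: (@integrable_fin_num _ _ _ leb setT measurableT _ If).
Qed.

(** No decay at infinity is assumed.  Integrate k over the segment from x to
x + delta_i, and then over x: by Fubini this is Int k, and it is also
Int (h (. + delta_i)) - Int h, which vanishes by translation invariance. *)
Lemma Int_derivative h k i : continuous h -> continuous k ->
  derivable_along i h k -> (L1 h < +oo)%E -> (L1 k < +oo)%E -> Int k = 0.
Proof.
move=> ch ck hk hoo koo.
pose F (p : measurableTypeR R * n.-tuple R) : \bar R :=
  ((\1_(`[0, 1] : set R) p.1 * k (row p.2 + p.1 *: delta_mx 0 i))%:E)%E.
have mu01 : mu `[0, 1]%classic = 1%:E.
  by rewrite lebesgue_measure_itv/= lte_fin ltr01 oppr0 adde0.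
have mF : measurable_fun setT F.
  apply/measurable_EFinP; apply: measurable_funM.
    apply: measurableT_comp; last exact: measurable_fst.
    exact: measurable_indic.
  exact: measurable_line_pair.
have FE s t : F (s, t) = ((\1_(`[0, 1] : set R) s)%:E *
    (k (row t + s *: delta_mx 0 i))%:E)%E by rewrite /F EFinM.
have cks s : continuous (fun x => k (x + s *: delta_mx 0 i)).
  exact: shift_continuous.
have L1ks s : L1 (fun x => k (x + s *: delta_mx 0 i)) = L1 k by exact: L1_shift.
have Intks s : Int (fun x => k (x + s *: delta_mx 0 i)) = Int k.
  rewrite -(Int_affine (s *: delta_mx 0 i) ck (normr1 _)); congr Int.
  by apply/funext => x; rewrite scale1r addrC.
have Fint : (mu \x leb)%E.-integrable setT F.
  apply/(integrable12ltyP _ _ mF).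
  rewrite (_ : (fun s => \int[leb]_t `|F (s, t)|)%E =
      (fun s => L1 k * (\1_(`[0, 1] : set R) s)%:E)%E); last first.
    apply/funext => s; under eq_integral do rewrite FE abseM !abse_EFin ger0_norm//.
    rewrite (ge0_integralZl _ measurableT (measurable_cont_row_norm (cks s)))//.
    by rewrite muleC; congr (_ * _)%E; exact: L1ks.
  rewrite ge0_integralZl//; last 2 first.
    by apply/measurable_EFinP; exact: measurable_indic.
    exact: L1_ge0.
  by rewrite integral_indic// setIT [X in (_ * X < _)%E]mu01 mule1.
have /esym := Fubini Fint.
rewrite (_ : (fun s => \int[leb]_t F (s, t))%E =
      (fun s => (Int k)%:E * (\1_(`[0, 1] : set R) s)%:E)%E); last first.
  apply/funext => s; under eq_integral do rewrite FE.
  have Iks : integ (fun x => k (x + s *: delta_mx 0 i)).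
    by apply/integP; rewrite ?L1ks.
  rewrite integralZl//; have := Int_fin Iks; rewrite Intks => ->.
  by rewrite muleC.
rewrite integralZl//; last first.
  apply/integrableP; split; first by apply/measurable_EFinP; exact: measurable_indic.
  under eq_integral do rewrite abse_EFin ger0_norm//.
  by rewrite integral_indic// setIT [X in (X < _)%E]mu01 ltry.
rewrite integral_indic// setIT [X in (_ = _ * X)%E]mu01 mule1.
rewrite (_ : (fun t => \int[mu]_s F (s, t))%E =
   (fun t => (h (row t + 1 *: delta_mx 0 i) - h (row t))%:E)); last first.
  apply/funext => t; rewrite -(line_FTC _ ch ck hk ltr01).
  rewrite [in RHS]integral_mkcond; apply: eq_integral => s _.
  by rewrite FE patchE indicE; case: ifPn => _; rewrite ?mul1e ?mul0e.
have ch1 : continuous (fun x => h (x + 1 *: delta_mx 0 i)).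
  exact: shift_continuous.
have Ih : integ h by exact/integP.
have Ih1 : integ (fun x => h (x + 1 *: delta_mx 0 i)).
  by apply/integP => //; rewrite L1_shift.
have IB : integ (fun x => h (x + 1 *: delta_mx 0 i) - h x).
  exact: (integrableB measurableT Ih1 Ih).
rewrite (Int_fin IB) (IntB Ih1 Ih) => -[<-].
rewrite -[X in _ - X](Int_affine (1 *: delta_mx 0 i) ch (normr1 _)).
apply/eqP; rewrite subr_eq0; apply/eqP; congr Int.
by apply/funext => x; rewrite [1 *: x]scale1r addrC.
Qed.

Lemma L1_line_difference_abs f i (a : R) : csmooth f ->
  (L1 (fun x => f (x + a *: delta_mx 0 i) - f x)%R <= `|a|%:E * L1 (dpart i f))%E.
Proof.
move=> sf; have cf := csmooth_cont sf.
have cdf := csmooth_cont (csmooth_dpart i sf).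
have fd := csmooth_derivable_along i sf.
have [a0|a0|->] := ltrgtP a 0; last first.
- rewrite (_ : (fun _ => _) = fun=> 0); last first.
    by apply/funext => x; rewrite scale0r addr0 subrr.
  by rewrite normr0 mul0e /L1 normr0 integral0.
- by rewrite gtr0_norm//; exact: L1_line_difference.
have a0' : 0 < - a by rewrite oppr_gt0.
rewrite ltr0_norm//; apply: le_trans (L1_line_difference cf cdf fd a0').
have cs : continuous (fun x => f (x + - a *: delta_mx 0 i) - f x).
  exact: continuousBf (shift_continuous (c := - a *: delta_mx 0 i) cf) cf.
rewrite -[leRHS](L1_shift (a *: delta_mx 0 i) cs).
apply: L1_le => [||x].
- exact: continuousBf (shift_continuous (c := a *: delta_mx 0 i) cf) cf.
- exact: (shift_continuous (c := a *: delta_mx 0 i) cs).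
- by rewrite -addrA scaleNr subrr addr0 distrC.
Qed.

(** Move from x to x + v one coordinate at a time. *)
Lemma L1_difference f v : csmooth f ->
  (L1 (fun x => f (x + v) - f x)%R <= \sum_i `|v 0 i|%:E * L1 (dpart i f))%E.
Proof.
move=> sf; have cf := csmooth_cont sf.
pose w (s : seq 'I_n) : E := \sum_(i <- s) v 0 i *: delta_mx 0 i.
rewrite (_ : v = w (index_enum 'I_n)); last by rewrite /w -row_sum_delta.
rewrite [leRHS](_ : _ = (\sum_(i <- index_enum 'I_n) `|v 0 i|%:E * L1 (dpart i f))%E); last first.
  by apply: eq_bigr => i _; rewrite /w -row_sum_delta.
elim: (index_enum _) => [|i s IH].
  rewrite /w !big_nil (_ : (fun _ => _) = fun=> 0); last first.
    by apply/funext => x; rewrite addr0 subrr.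
  by rewrite /L1 normr0 integral0.
have cs c : continuous (fun x => f (x + c)) by exact: shift_continuous.
have cd c : continuous (fun x => f (x + c) - f x) by exact: continuousBf (cs c) cf.
rewrite big_cons; apply: le_trans (leeD (L1_line_difference_abs i (v 0 i) sf) IH).
rewrite -[X in (_ <= X + _)%E](L1_shift (w s) (cd _)).
apply: le_trans (L1D (shift_continuous (c := w s)
  (cd (v 0 i *: delta_mx 0 i))) (cd (w s))).
rewrite le_eqVlt; apply/orP; left; apply/eqP; congr L1; apply/funext => x.
rewrite [RHS]addrA subrK; congr (f _ - _).
by rewrite /w big_cons -/(w s) -[in RHS]addrA; congr (_ + _); exact: addrC.
Qed.

End L1Derivatives.

(** * Riemann sums of convolutions *)

Section GridConvolution.
Context {R : realType} {n : nat}.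
Local Notation E := 'rV[R]_n.
Local Notation leb := (@lebesgue_tuple R n).
Local Notation row := (@row_of_tuple R n).
Local Notation tup := (n.-tuple R).
Implicit Types (f g h k : E -> R) (x y v : E) (i : 'I_n).

Lemma Rintegral_sum (I : Type) (s : seq I) (h : I -> tup -> R) :
  (forall z, leb.-integrable setT (EFin \o h z)) ->
  leb.-integrable setT (EFin \o (fun t => \sum_(z <- s) h z t)) /\
  (\int[leb]_t (\sum_(z <- s) h z t) = \sum_(z <- s) \int[leb]_t h z t)%R.
Proof.
move=> ih; elim: s => [|z s [IH1 IH2]].
  rewrite (_ : (fun t => _) = cst 0); last by apply/funext => t; rewrite big_nil.
  by split; [exact: integrable0|rewrite big_nil Rintegral_cst// mul0r].
rewrite (_ : (fun t => _) = (fun t => h z t + \sum_(z <- s) h z t)); last first.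
  by apply/funext => t; rewrite big_cons.
split; first exact: (integrableD measurableT (ih z) IH1).
by rewrite big_cons -IH2 RintegralD.
Qed.

Definition cell_mass N (z : grid_index (n := n) N) f : R :=
  (\int[leb]_t ((in_cell z t)%:R * f (row t)))%R.

(** The Riemann sum for the convolution of f and k.  It is a finite linear
combination of translates of k, so that a linear functional can be applied
term by term. *)
Definition grid_conv N f k : E -> R :=
  fun x => \sum_(z : grid_index N) cell_mass z f * k (x - grid_point z).

Definition conv f k : E -> R := fun x => Int (fun y => f y * k (x - y)).

Lemma integrable_cell N (z : grid_index (n := n) N) f : integ f ->
  leb.-integrable setT (EFin \o (fun t => (in_cell z t)%:R * f (row t))).
Proof.
move=> If; have mf : measurable_fun setT (fun t => f (row t)).
  by apply/measurable_EFinP; case/integrableP: If.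
apply: (le_integrable measurableT _ _ If).
  by apply/measurable_EFinP; apply: measurable_funM => //; exact: measurable_in_cell.
move=> t _ /=; rewrite lee_fin normrM.
by case: (in_cell z t); rewrite ?normr1 ?normr0 ?mul1r ?mul0r.
Qed.

Lemma Int_grid_step N f F : integ f ->
  leb.-integrable setT (EFin \o (fun t => f (row t) * grid_step N F t)) /\
  (\int[leb]_t (f (row t) * grid_step N F t) =
   \sum_(z : grid_index N) cell_mass z f * F (grid_point z))%R.
Proof.
move=> If.
have E t : f (row t) * grid_step N F t =
    \sum_(z : grid_index N) (F (grid_point z) * ((in_cell z t)%:R * f (row t))).
  rewrite /grid_step mulr_sumr; apply: eq_bigr => z _.
  by rewrite mulrCA [f _ * _]mulrC mulrCA.
rewrite (_ : (fun t => _) = (fun t =>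
  \sum_(z : grid_index N) (F (grid_point z) * ((in_cell z t)%:R * f (row t)))));
  last by apply/funext => t; exact: E.
have [|-> ->] := @Rintegral_sum _ (index_enum _)
  (fun (z : grid_index N) t => F (grid_point z) * ((in_cell z t)%:R * f (row t))).
  by move=> z; exact: (integrableZl measurableT _ (integrable_cell z If)).
split=> //; apply: eq_bigr => z _.
by rewrite RintegralZl//; [rewrite mulrC|exact: integrable_cell].
Qed.

(** A majorant of the distance between the Riemann sum and the convolution whose
integral in x can be computed by Tonelli. *)
Definition grid_err N f k x : \bar R :=
  (\int[leb]_t (`|f (row t)| *
     `|grid_step N (fun y => k (x - y)) t - k (x - row t)|)%:E)%E.

Lemma reflect_continuous k x : continuous k -> continuous (fun y => k (x - y)).
Proof.
move=> ck; rewrite (_ : (fun y => _) = (fun y => k (x + (-1) *: y))).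
  exact: affine_continuous.
by apply/funext => y; rewrite scaleN1r.
Qed.

Lemma grid_conv_err N f k x : continuous f -> continuous k -> integ f ->
  integ (fun y => f y * k (x - y)) ->
  (`|grid_conv N f k x - conv f k x|%:E <= grid_err N f k x)%E.
Proof.
move=> cf ck If Ifk.
have [I1 E1] := Int_grid_step N (fun y => k (x - y)) If.
have mf := measurable_cont_row cf.
have mk := measurable_cont_row (reflect_continuous (x := x) ck).
have ms := measurable_grid_step N (fun y => k (x - y)).
rewrite /grid_conv -E1 /conv /Int -RintegralB//.
have IB : leb.-integrable setT (EFin \o (fun t => f (row t) *
    grid_step N (fun y => k (x - y)) t - f (row t) * k (x - row t))).
  exact: (integrableB measurableT I1 Ifk).
rewrite EFin_normr_Rintegral//; have [mIB _] := integrableP _ _ _ IB.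
apply: le_trans (le_abse_integral leb measurableT mIB) _.
rewrite le_eqVlt; apply/orP; left; apply/eqP; apply: eq_integral => t _ /=.
by rewrite -normrM mulrBr.
Qed.

Lemma measurable_tuple_pair (k : E -> R) :
  continuous k -> measurable_fun setT (fun p : tup * tup => k (row p.1 - row p.2)).
Proof.
move=> ck.
have mt : measurable_fun setT (fun p : tup * tup => tuple_of_row (row p.1 - row p.2)).
  apply/measurable_fun_tnthP => j; rewrite /comp.
  under eq_fun do rewrite tnth_mktuple !mxE.
  apply: measurable_funB.
    by apply: (measurableT_comp (measurable_tnth j)); exact: measurable_fst.
  by apply: (measurableT_comp (measurable_tnth j)); exact: measurable_snd.
rewrite (_ : (fun p => _) = (fun t => k (row t)) \o
  (fun p : tup * tup => tuple_of_row (row p.1 - row p.2))).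
  by apply: measurableT_comp mt; exact: measurable_cont_row.
by apply/funext => p /=; rewrite tuple_of_rowK.
Qed.

Lemma measurable_grid_err_pair N f k : continuous f -> continuous k ->
  measurable_fun setT (fun p : tup * tup => (`|f (row p.2)| *
     `|grid_step N (fun y => k (row p.1 - y)) p.2 - k (row p.1 - row p.2)|)%:E).
Proof.
move=> cf ck; apply/measurable_EFinP; apply: measurable_funM.
  apply: measurableT_comp => //.
  by apply: (measurableT_comp (measurable_cont_row cf)); exact: measurable_snd.
apply: measurableT_comp => //; apply: measurable_funB; last exact: measurable_tuple_pair.
apply: measurable_sum => z; apply: measurable_funM.
  by apply: (measurableT_comp (measurable_in_cell z)); exact: measurable_snd.
have := measurable_cont_row (shift_continuous (c := - grid_point z) ck).
by move=> /measurableT_comp; apply; exact: measurable_fst.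
Qed.

Lemma grid_err_ge0 N f k x : (0 <= grid_err N f k x)%E.
Proof. by apply: integral_ge0 => t _; rewrite lee_fin mulr_ge0. Qed.

Lemma measurable_grid_err N f k : continuous f -> continuous k ->
  measurable_fun setT (fun t : tup => grid_err N f k (row t)).
Proof.
move=> cf ck; have m := measurable_grid_err_pair N cf ck.
apply: (@measurable_fun_fubini_tonelli_F _ _ _ _ R leb _ m).
by move=> p; rewrite lee_fin mulr_ge0.
Qed.

(** How much k varies in mean over the cell containing y. *)
Definition grid_osc N k (y : tup) : \bar R :=
  L1 (fun x => grid_step N (fun z => k (x - z)) y - k (x - row y)).

Lemma grid_step_tr_continuous N k (y : tup) : continuous k ->
  continuous (fun x => grid_step N (fun z => k (x - z)) y).
Proof.
move=> ck; have [[z zy]|h] := pselect (exists z : grid_index N, in_cell z y).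
  rewrite (_ : (fun x => _) = (fun x => k (x + - grid_point z))).
    exact: shift_continuous.
  by apply/funext => x; rewrite (grid_stepE _ zy).
rewrite (_ : (fun x => _) = cst 0); first exact: cst_continuous.
apply/funext => x; rewrite /grid_step big1// => z _.
by case: (boolP (in_cell z y)) => [zy|_]; [case: h; exists z|rewrite mul0r].
Qed.

Lemma coord_le_norm v i : `|v 0 i| <= `|v|.
Proof.
rewrite [leRHS]mx_normrE.
exact: (le_bigmax _ (fun ij : 'I_1 * 'I_n => `|v ij.1 ij.2|) (0, i)).
Qed.

Lemma grid_osc_cell N k (y : tup) (z : grid_index N) (B : R) : csmooth k ->
  (\sum_i L1 (dpart i k) <= B%:E)%E -> in_cell z y ->
  (grid_osc N k y <= (N.+1%:R^-1 * B)%:E)%E.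
Proof.
move=> sk kB zy; have ck := csmooth_cont sk.
rewrite /grid_osc (_ : (fun x => _) = (fun x => k (x - grid_point z) - k (x - row y))); last first.
  by apply/funext => x; rewrite (grid_stepE _ zy).
have cd : continuous (fun x => k (x - grid_point z) - k (x - row y)).
  exact: continuousBf (shift_continuous (c := - grid_point z) ck)
    (shift_continuous (c := - row y) ck).
rewrite -(L1_shift (row y) cd) (_ : (fun x => _) =
  (fun x => k (x + (row y - grid_point z)) - k x)); last first.
  by apply/funext => x; rewrite addrK addrA.
apply: le_trans (L1_difference _ sk) _.
rewrite EFinM; apply: (@le_trans _ _ (\sum_i (N.+1%:R^-1)%:E * L1 (dpart i k))%E).
  apply: lee_sum => i _; apply: lee_wpmul2r; first exact: L1_ge0.
  rewrite lee_fin; apply: le_trans (in_cell_close zy).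
  by rewrite [leRHS]distrC; exact: coord_le_norm.
rewrite -ge0_sume_distrr => [|i _]; last exact: L1_ge0.
by apply: lee_wpmul2l => //; rewrite lee_fin invr_ge0.
Qed.

(** A bound that is uniform in N and y, including the points y that the grid does not cover,
where the step function is 0; it provides the dominating function of
grid_err_cvg. *)
Lemma grid_osc_le N k (y : tup) (B : R) : csmooth k ->
  (\sum_i L1 (dpart i k) <= B%:E)%E -> (L1 k <= B%:E)%E ->
  (grid_osc N k y <= B%:E)%E.
Proof.
move=> sk kB kB'; have B0 : 0 <= B by rewrite -lee_fin (le_trans (L1_ge0 _) kB').
have [[z zy]|h] := pselect (exists z : grid_index N, in_cell z y).
  apply: le_trans (grid_osc_cell sk kB zy) _.
  by rewrite lee_fin ler_piMl// invf_le1 ?ltr0n// ler1n.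
have ck := csmooth_cont sk.
rewrite /grid_osc (_ : (fun x => _) = (fun x => - 1 * k (x - row y))); last first.
  apply/funext => x; rewrite /grid_step big1 ?sub0r ?mulN1r// => z _.
  by case: (boolP (in_cell z y)) => [zy|_]; [case: h; exists z|rewrite mul0r].
rewrite (L1Z (-1) (shift_continuous (c := - row y) ck)) normrN1 mul1e.
by rewrite (L1_shift (- row y) ck).
Qed.

Lemma grid_osc_cvg k (y : tup) (B : R) : csmooth k ->
  (\sum_i L1 (dpart i k) <= B%:E)%E -> (grid_osc N k y @[N --> \oo] --> 0)%E.
Proof.
move=> sk kB; have [N0 HN0] := in_cell_near y.
apply: (@squeeze_cvge _ _ _ _ (cst 0%E) _ (fun N => (N.+1%:R^-1 * B)%:E)).
- near=> N; apply/andP; split; first exact: L1_ge0.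
  have N0N : (N0 <= N)%N by near: N; exact: nbhs_infty_ge.
  by have [z zy] := HN0 N N0N; exact: grid_osc_cell zy.
- exact: cvg_cst.
- apply/fine_cvgP; split; first by near=> N.
  rewrite [X in _ --> X](_ : _ = 0 * B); last by rewrite mul0r.
  by apply: cvgM; [exact: cvg_harmonic|exact: cvg_cst].
Unshelve. all: by end_near. Qed.

Lemma grid_osc_mull N k (y : tup) (c : R) : continuous k ->
  (\int[leb]_x (`|c|%:E *
     `|grid_step N (fun z => k (row x - z)) y - k (row x - row y)|%:E) =
   `|c|%:E * grid_osc N k y)%E.
Proof.
move=> ck.
have cs : continuous (fun x => grid_step N (fun z => k (x - z)) y - k (x - row y)).
  exact: (continuousBf (grid_step_tr_continuous (N := N) (y := y) ck)
    (shift_continuous (c := - row y) ck)).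
by apply: (ge0_integralZl _ measurableT (measurable_cont_row_norm cs)).
Qed.

Lemma grid_err_tonelli N f k : continuous f -> csmooth k ->
  (\int[leb]_x grid_err N f k (row x) =
   \int[leb]_y (`|f (row y)|%:E * grid_osc N k y))%E.
Proof.
move=> cf sk; have ck := csmooth_cont sk.
have m := measurable_grid_err_pair N cf ck.
have m0 (p : tup * tup) : (0 <= (`|f (row p.2)| * `|grid_step N
    (fun y => k (row p.1 - y)) p.2 - k (row p.1 - row p.2)|)%:E)%E.
  by rewrite lee_fin mulr_ge0.
rewrite [LHS](fubini_tonelli _ m m0); apply: eq_integral => y _.
under eq_integral do rewrite EFinM.
exact: (grid_osc_mull N y (f (row y)) ck).
Qed.

(** After exchanging the integrals, the error is the integral of |f| against the
oscillations of k, which tend to 0 and are bounded: dominated convergence. *)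
Lemma grid_err_cvg f k : continuous f -> integ f -> csmooth k ->
  (L1 k < +oo)%E -> (forall i, L1 (dpart i k) < +oo)%E ->
  (\int[leb]_x grid_err N f k (row x) @[N --> \oo] --> 0)%E.
Proof.
move=> cf If sk koo dkoo; have ck := csmooth_cont sk.
pose B := fine (L1 k + \sum_i L1 (dpart i k))%E.
have S0 : (0 <= \sum_i L1 (dpart i k))%E by apply: sume_ge0 => i _; exact: L1_ge0.
have BE : (B%:E = L1 k + \sum_i L1 (dpart i k))%E.
  rewrite /B fineK// ge0_fin_numE; last by rewrite adde_ge0// L1_ge0.
  by rewrite lte_add_pinfty// lte_sum_pinfty.
have kB : (\sum_i L1 (dpart i k) <= B%:E)%E by rewrite BE leeDr// L1_ge0.
have kB' : (L1 k <= B%:E)%E by rewrite BE leeDl.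
under eq_fun do rewrite (grid_err_tonelli _ cf sk).
have osc0 N (y : tup) : (0 <= grid_osc N k y)%E by exact: L1_ge0.
have mosc N : measurable_fun setT (fun y : tup => `|f (row y)|%:E * grid_osc N k y)%E.
  have m := measurable_grid_err_pair N cf ck.
  have m0 (p : tup * tup) : (0 <= (`|f (row p.2)| * `|grid_step N
    (fun y => k (row p.1 - y)) p.2 - k (row p.1 - row p.2)|)%:E)%E.
    by rewrite lee_fin mulr_ge0.
  have := @measurable_fun_fubini_tonelli_G _ _ _ _ R leb _ m m0.
  congr measurable_fun; apply/funext => y; rewrite /fubini_G.
  under eq_integral do rewrite EFinM.
  by rewrite -(grid_osc_mull N y _ ck).
pose h N (y : tup) : \bar R := (`|f (row y)|%:E * grid_osc N k y)%E.
pose b (y : tup) : \bar R := (B%:E * `|f (row y)|%:E)%E.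
have h0 : {ae leb, forall t, [set: tup] t -> h N t @[N --> \oo] --> (cst 0%E : tup -> \bar R) t}.
  apply: aeW => y _; rewrite /h /= -(mule0 `|f (row y)|%:E).
  by apply: cvgeZl => //; exact: grid_osc_cvg kB.
have bint : leb.-integrable setT b.
  apply: integrableZl => //.
  rewrite (_ : (fun y : tup => _) = (fun y : tup => `|(f (row y))%:E|%E)).
    exact: integrable_abse.
  by apply/funext => y; rewrite abse_EFin.
have hb : {ae leb, forall t, forall N, [set: tup] t -> (`|h N t| <= b t)%E}.
  apply: aeW => y N _; rewrite /h /b gee0_abs ?mule_ge0 ?lee_fin//.
  by rewrite muleC lee_wpmul2r ?lee_fin//; exact: grid_osc_le.
have [_ _] := dominated_convergence measurableT mosc (measurable_cst _) h0 bint hb.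
by rewrite integral0.
Qed.

End GridConvolution.

(** * Functionals on real functions with integrable derivatives *)

Section Functionals.
Context {R : realType} {n : nat}.
Local Notation E := 'rV[R]_n.
Local Notation leb := (@lebesgue_tuple R n).
Local Notation row := (@row_of_tuple R n).
Local Notation tup := (n.-tuple R).
Implicit Types (f g h k : E -> R) (x y v : E) (i : 'I_n) (s : seq 'I_n).

(** The real functions of D_{L^1}. *)
Definition rDL1 f := csmooth f /\ forall s, (L1 (dparts s f) < +oo)%E.

Lemma rDL1_comb (c : R) f g : rDL1 f -> rDL1 g -> rDL1 (fun x => c * f x + g x).
Proof.
move=> [sf lf] [sg lg]; have scf := csmoothZ c sf.
split=> [|s]; first exact: csmoothD.
rewrite (dpartsD s scf sg) (dpartsZ s c sf).
have cf := (sf s).1; have cg := (sg s).1.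
apply: le_lt_trans (L1D (continuousZf (c := c) cf) cg) _.
by rewrite (L1Z c cf) lte_add_pinfty// lte_mul_pinfty.
Qed.

Lemma rDL1_tr y f : rDL1 f -> rDL1 (tr y f).
Proof.
move=> [sf lf]; split=> [|s]; first exact: csmooth_tr.
by rewrite dparts_tr L1_tr//; exact: (sf s).1.
Qed.

Lemma rDL1_dparts s f : rDL1 f -> rDL1 (dparts s f).
Proof.
move=> [sf lf]; split=> [|t]; first exact: csmooth_dparts.
by rewrite /dparts -foldr_cat; exact: lf.
Qed.

Lemma rDL1_0 : rDL1 (fun=> 0).
Proof.
have d0 s : dparts s (fun=> 0) = (fun=> 0) :> (E -> R).
  elim: s => //= i s ->; apply/funext => x; rewrite dpartE.
  exact: derive_cst.
split=> s; rewrite d0; last by rewrite /L1 normr0 integral0.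
by split => [|i x]; [exact: cst_continuous|exact: derivable_cst].
Qed.

Lemma rDL1_cont f : rDL1 f -> continuous f.
Proof. by move=> [/csmooth_cont]. Qed.

Lemma rDL1_integ f : rDL1 f -> integ f.
Proof. by move=> [sf lf]; apply/integP; [exact: csmooth_cont|exact: (lf [::])]. Qed.

(** There are finitely many lists of length at most M. *)
Lemma near_lists (T : Type) (F : set_system T) (FF : Filter F)
  (P : seq 'I_n -> T -> Prop) : (forall s, \forall t \near F, P s t) ->
  forall M, \forall t \near F, forall s, (size s <= M)%N -> P s t.
Proof.
move=> FP M; elim: M P FP => [|M IH] P FP.
  by apply: filterS (FP [::]) => t Pt s; rewrite leqn0 size_eq0 => /eqP ->.
have h1 : \forall t \near F, forall i s, (size s <= M)%N -> P (i :: s) t.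
  by apply: filter_forall => i; apply: (IH (fun s => P (i :: s))) => s; exact: FP.
by apply: filterS2 h1 (FP [::]) => t P1 P2 [|i s]//=; rewrite ltnS; exact: P1.
Qed.

Lemma rDL1_bound f M : rDL1 f -> exists C : R, 0 <= C /\
  forall s, (size s <= M)%N -> (L1 (dparts s f) <= C%:E)%E.
Proof.
move=> [sf lf].
have : \forall C \near (+oo : set_system R), forall s, (size s <= M)%N ->
    (L1 (dparts s f) <= C%:E)%E.
  apply: near_lists => s; near=> C.
  rewrite -(@fineK _ (L1 (dparts s f))) ?lee_fin.
    by near: C; apply: nbhs_pinfty_ge; exact: num_real.
  by rewrite ge0_fin_numE// L1_ge0.
move=> h; have [C [hC C0]] := filter_ex (filterI h (nbhs_pinfty_ge (num_real 0))).
by exists C.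
Unshelve. all: by end_near. Qed.

Section functional.
Variables (T : (E -> R) -> R) (M : nat) (K : R).
Hypothesis T_lin : forall (c : R) f g, rDL1 f -> rDL1 g ->
  T (fun x => c * f x + g x) = c * T f + T g.
Hypothesis T_bnd : forall f (e : R), rDL1 f -> 0 <= e ->
  (forall s, (size s <= M)%N -> (L1 (dparts s f) <= e%:E)%E) -> `|T f| <= K * e.

(** The regularization of T by f, up to a reflection; the integral of u against it
plays the role of T applied to the convolution of u and f. *)
Definition orbit f y := T (tr y f).

Lemma functional0 : T (fun=> 0) = 0.
Proof.
have := T_lin 1 rDL1_0 rDL1_0; rewrite mulr0 addr0 mul1r => h.
by apply: (addrI (T (fun=> 0))); rewrite -h addr0.
Qed.

Lemma functional_sum (I : Type) (r : seq I) (c : I -> R) (g : I -> E -> R) :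
  (forall z, rDL1 (g z)) ->
  rDL1 (fun x => \sum_(z <- r) c z * g z x) /\
  T (fun x => \sum_(z <- r) c z * g z x) = \sum_(z <- r) c z * T (g z).
Proof.
move=> gD; elim: r => [|z r [IH1 IH2]].
  rewrite (_ : (fun x => _) = fun=> 0); last by apply/funext => x; rewrite big_nil.
  by rewrite big_nil functional0; split=> //; exact: rDL1_0.
rewrite (_ : (fun x => _) = (fun x => c z * g z x + \sum_(z <- r) c z * g z x)); last first.
  by apply/funext => x; rewrite big_cons.
by split; [exact: rDL1_comb|rewrite T_lin// big_cons IH2].
Qed.

Lemma orbit_bounded g : rDL1 g -> exists B, forall y, `|orbit g y| <= B.
Proof.
move=> gD; have [C [C0 gC]] := rDL1_bound M gD.
exists (K * C) => y; apply: T_bnd => [|//|s sM]; first exact: rDL1_tr.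
by rewrite dparts_tr L1_tr ?gC//; exact: (gD.1 s).1.
Qed.

(** Differences of translates have L^1 norms controlled by one more derivative
(L1_difference), which makes the orbit Lipschitz. *)
Lemma orbit_continuous g : rDL1 g -> continuous (orbit g).
Proof.
move=> gD y.
have [C [C0 gC]] := rDL1_bound M.+1 gD.
have lip z : `|orbit g y - orbit g z| <= K * (n%:R * C * `|y - z|).
  have -> : orbit g y - orbit g z = T (fun x => -1 * tr z g x + tr y g x).
    by rewrite (T_lin _ (rDL1_tr z gD) (rDL1_tr y gD)) mulN1r [RHS]addrC.
  apply: T_bnd.
  - by apply: rDL1_comb; exact: rDL1_tr.
  - by rewrite !mulr_ge0.
  move=> s sM; have sg := gD.1; have sgz := csmooth_tr z sg.
  rewrite (dpartsD s (csmoothZ (-1) sgz) (csmooth_tr y sg)) (dpartsZ s (-1) sgz).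
  rewrite !dparts_tr.
  have sgs := csmooth_dparts s sg; have cgs := csmooth_cont sgs.
  have cd : continuous (fun w : E => dparts s g (w + (z - y)) - dparts s g w).
    exact: (continuousBf (shift_continuous (c := z - y) cgs) cgs).
  apply: (@le_trans _ _ (L1 (fun w : E => dparts s g (w + (z - y)) - dparts s g w))).
    rewrite -[leRHS](L1_shift (- z) cd) le_eqVlt; apply/orP; left; apply/eqP.
    congr L1; apply/funext => x.
    by rewrite /tr [x - z + _]addrA subrK mulN1r [LHS]addrC.
  apply: le_trans (L1_difference _ sgs) _.
  apply: (@le_trans _ _ (\sum_(i < n) (`|y - z| * C)%:E)%E).
    apply: lee_sum => i _; rewrite EFinM; apply: lee_pmul => //.
    - exact: L1_ge0.
    - by rewrite lee_fin [leRHS]distrC; exact: coord_le_norm.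
    - exact: (gC (i :: s)).
  rewrite sumEFin lee_fin sumr_const card_ord -(mulr_natr (_ * C)).
  by rewrite -mulrA mulrC [C * _]mulrC.
apply/(@cvgrPdist_le _ _ _ (nbhs y)) => e e0.
pose D := `|K| * (n%:R * C) + 1.
have D0 : 0 < D by rewrite ltr_wpDl// mulr_ge0// mulr_ge0.
have := nbhsx_ballx y _ (divr_gt0 e0 D0); apply: filterS => z.
rewrite -ball_normE /= => /ltW zy; apply: le_trans (lip z) _.
rewrite mulrA; apply: (@le_trans _ _ (D * `|y - z|)).
  by rewrite ler_wpM2r// /D ler_wpDr// ler_wpM2r ?ler_norm// mulr_ge0.
by rewrite -ler_pdivlMl// mulrC.
Qed.

(** T of a Riemann sum is the integral of f against the step function of the
orbit, and the orbit is bounded and continuous. *)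
Lemma pairing_limit f g : integ f -> continuous f -> rDL1 g ->
  T (grid_conv N f g) @[N --> \oo] --> Int (fun y => f y * orbit g y).
Proof.
move=> If cf gD.
have cU := orbit_continuous gD; have [B gB] := orbit_bounded gD.
have TE N : T (grid_conv N f g) =
    (\int[leb]_t (f (row t) * grid_step N (orbit g) t))%R.
  have [_ ->] := Int_grid_step N (orbit g) If.
  rewrite /grid_conv.
  have [_ ->] // := functional_sum (index_enum (grid_index (n := n) N))
    (fun z => cell_mass z f) (g := fun z => tr (grid_point z) g) (fun z => rDL1_tr _ gD).
under eq_fun do rewrite TE.
pose h N (t : tup) : \bar R := (f (row t) * grid_step N (orbit g) t)%:E.
pose l (t : tup) : \bar R := (f (row t) * orbit g (row t))%:E.
pose b (t : tup) : \bar R := (B%:E * `|(f (row t))%:E|)%E.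
have mf := measurable_cont_row cf.
have mh N : measurable_fun setT (h N).
  by apply/measurable_EFinP; apply: measurable_funM => //; exact: measurable_grid_step.
have ml : measurable_fun setT l.
  by apply/measurable_EFinP; apply: measurable_funM => //; exact: measurable_cont_row.
have hl : {ae leb, forall t, [set: tup] t -> h N t @[N --> \oo] --> l t}.
  apply: aeW => t _; apply/fine_cvgP; split; first by near=> N.
  apply: cvgMl_tmp; exact: grid_step_cvg.
have bint : leb.-integrable setT b.
  by apply: integrableZl => //; exact: integrable_abse.
have hb : {ae leb, forall t, forall N, [set: tup] t -> (`|h N t| <= b t)%E}.
  apply: aeW => t N _; rewrite /h /b !abse_EFin -EFinM lee_fin normrM mulrC.
  by rewrite ler_wpM2r//; exact: grid_step_le.
have [lint _ H] := dominated_convergence measurableT mh ml hl bint hb.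
have lfin : (\int[leb]_t l t)%E \is a fin_num.
  exact: (@integrable_fin_num _ _ _ leb setT measurableT _ lint).
rewrite /Int /Rintegral -/l; apply: fine_cvg; rewrite fineK//.
Unshelve. all: by end_near. Qed.

Lemma dparts_sum (I : Type) (r : seq I) (c : I -> R) (g : I -> E -> R) s :
  (forall z, csmooth (g z)) ->
  csmooth (fun x => \sum_(z <- r) c z * g z x) /\
  dparts s (fun x => \sum_(z <- r) c z * g z x) =
    (fun x => \sum_(z <- r) c z * dparts s (g z) x).
Proof.
move=> sg; elim: r => [|z r [IH1 IH2]].
  rewrite (_ : (fun x => \sum_(z <- [::]) c z * g z x) = fun=> 0); last first.
    by apply/funext => x; rewrite big_nil.
  split; first by case: rDL1_0.
  have := dpartsZ s 0 (rDL1_0.1); rewrite (_ : (fun x => 0 * _) = fun=> 0).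
    by move=> ->; apply/funext => x; rewrite mul0r big_nil.
  by apply/funext => x; rewrite mul0r.
rewrite (_ : (fun x => \sum_(z <- z :: r) c z * g z x) =
    (fun x => c z * g z x + \sum_(z <- r) c z * g z x)); last first.
  by apply/funext => x; rewrite big_cons.
have scz := csmoothZ (c z) (sg z).
split; first exact: csmoothD.
rewrite (dpartsD s scz IH1) (dpartsZ s (c z) (sg z)) IH2.
by apply/funext => x; rewrite big_cons.
Qed.

Lemma grid_conv_rDL1 N f g : rDL1 g -> rDL1 (grid_conv N f g).
Proof.
move=> gD; exact: (functional_sum (index_enum (grid_index (n := n) N))
  (fun z => cell_mass z f) (fun z => rDL1_tr (grid_point z) gD)).1.
Qed.

Lemma grid_conv_dparts N f g s : csmooth g ->
  dparts s (grid_conv N f g) = grid_conv N f (dparts s g).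
Proof.
move=> sg; have [_ ->] := dparts_sum (index_enum (grid_index (n := n) N))
  (fun z => cell_mass z f) s (fun z => csmooth_tr (grid_point z) sg).
by apply/funext => x; apply: eq_bigr => z _; rewrite dparts_tr.
Qed.

(** The difference of the two Riemann sums tends to 0 in L^1 with all
derivatives, because the convolutions that they approximate agree.  Hence T of the
difference tends to 0, while it also tends to the difference of the two
integrals. *)
Lemma pairing_eq f g f' g' :
  integ f -> continuous f -> rDL1 g -> integ f' -> continuous f' -> rDL1 g' ->
  (forall s x, integ (fun y => f y * dparts s g (x - y))) ->
  (forall s x, integ (fun y => f' y * dparts s g' (x - y))) ->
  (forall s x, conv f (dparts s g) x = conv f' (dparts s g') x) ->
  Int (fun y => f y * orbit g y) = Int (fun y => f' y * orbit g' y).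
Proof.
move=> If cf gD If' cf' gD' Ifg Ifg' cE.
have l1 := pairing_limit If cf gD; have l2 := pairing_limit If' cf' gD'.
pose D N x := -1 * grid_conv N f' g' x + grid_conv N f g x.
have DD N : rDL1 (D N) by apply: rDL1_comb; exact: grid_conv_rDL1.
have TD N : T (D N) = T (grid_conv N f g) - T (grid_conv N f' g').
  rewrite (T_lin _ (grid_conv_rDL1 N f' gD') (grid_conv_rDL1 N f gD)).
  by rewrite mulN1r addrC.
have D_le N s : (L1 (dparts s (D N)) <=
    \int[leb]_x grid_err N f (dparts s g) (row x) +
    \int[leb]_x grid_err N f' (dparts s g') (row x))%E.
  have cg := (gD.1 s).1; have cg' := (gD'.1 s).1.
  have E x : dparts s (D N) x =
      (grid_conv N f (dparts s g) x - conv f (dparts s g) x) -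
      (grid_conv N f' (dparts s g') x - conv f' (dparts s g') x).
    rewrite /D (dpartsD s (csmoothZ (-1) (grid_conv_rDL1 N f' gD').1)
      (grid_conv_rDL1 N f gD).1) (dpartsZ s (-1) (grid_conv_rDL1 N f' gD').1).
    rewrite !(grid_conv_dparts _ _ _ gD.1) !(grid_conv_dparts _ _ _ gD'.1) cE.
    by rewrite opprB addrA subrK mulN1r addrC.
  have m1 := measurable_grid_err N cf cg; have m2 := measurable_grid_err N cf' cg'.
  rewrite -ge0_integralD//; last 2 first.
  - by move=> t _; exact: grid_err_ge0.
  - by move=> t _; exact: grid_err_ge0.
  apply: (ge0_le_integral _ measurableT) => [t _|||t _].
  - by rewrite lee_fin.
  - exact: measurable_cont_row_norm ((DD N).1 s).1.
  - exact: emeasurable_funD.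
  rewrite E; apply: (@le_trans _ _ (`|grid_conv N f (dparts s g) (row t) - conv f (dparts s g) (row t)|%:E
    + `|grid_conv N f' (dparts s g') (row t) - conv f' (dparts s g') (row t)|%:E)%E).
    by rewrite -EFinD lee_fin ler_normB.
  by apply: leeD; apply: grid_conv_err.
have near_small (e : R) : 0 < e -> \forall N \near \oo, forall s, (size s <= M)%N ->
    (L1 (dparts s (D N)) <= e%:E)%E.
  move=> e0; apply: near_lists => s.
  have e20 : (0 < (e / 2)%:E)%E by rewrite lte_fin divr_gt0.
  have c1 := grid_err_cvg cf If (csmooth_dparts s gD.1) (gD.2 s) (fun i => gD.2 (i :: s)).
  have c2 := grid_err_cvg cf' If' (csmooth_dparts s gD'.1) (gD'.2 s) (fun i => gD'.2 (i :: s)).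
  have small (u : (\bar R)^nat) : u N @[N --> \oo] --> 0%E -> (\forall N \near \oo, u N <= (e / 2)%:E)%E.
    move=> cu; apply: (cu [set y | (y <= (e / 2)%:E)%E]); apply: (@filterS _ _ _ [set y | (y < (e / 2)%:E)%E]).
      by move=> y /ltW.
    by apply: open_nbhs_nbhs; split => //; exact: open_ereal_lt_ereal.
  apply: filterS2 (small _ c1) (small _ c2) => N h1 h2.
  apply: (le_trans (D_le N s)); apply: (le_trans (leeD h1 h2)).
  by rewrite -EFinD -splitr.
have T0 : T (D N) @[N --> \oo] --> 0.
  apply/cvgrPdist_le => e e0.
  pose d := e / (`|K| + 1).
  have d0 : 0 < d by rewrite divr_gt0// ltr_wpDl.
  apply: filterS (near_small d d0) => N H; rewrite sub0r normrN.
  apply: le_trans (T_bnd (DD N) (ltW d0) H) _.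
  apply: (@le_trans _ _ ((`|K| + 1) * d)).
    by rewrite ler_wpM2r ?(ltW d0)// ler_wpDr// ler_norm.
  by rewrite /d mulrC divfK// gt_eqF// ltr_wpDl.
have l12 : T (D N) @[N --> \oo] -->
    Int (fun y => f y * orbit g y) - Int (fun y => f' y * orbit g' y).
  rewrite (_ : (fun N => T (D N)) =
    (fun N => T (grid_conv N f g)) - (fun N => T (grid_conv N f' g'))).
    exact: cvgB l1 l2.
  by apply/funext => N; rewrite TD.
apply/eqP; rewrite -subr_eq0; apply/eqP.
exact: (cvg_unique (@Rhausdorff R) l12 T0).
Qed.

End functional.
End Functionals.

(** * Exchange of factors, integration by parts and the contraction step *)

Section Exchange.
Context {R : realType} {n : nat}.
Local Notation E := 'rV[R]_n.
Local Notation leb := (@lebesgue_tuple R n).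
Local Notation row := (@row_of_tuple R n).
Local Notation tup := (n.-tuple R).
Implicit Types (f g h k u : E -> R) (x y v : E) (i : 'I_n) (s : seq 'I_n).

(** Boundedness of u and its derivatives makes the products
u y * k (x - y) integrable for every x. *)
Definition bDL1 u := rDL1 u /\ forall s, exists B, forall x, `|dparts s u x| <= B.

Lemma bDL1_dparts s u : bDL1 u -> bDL1 (dparts s u).
Proof.
move=> [uD ub]; split=> [|t]; first exact: rDL1_dparts.
by have [B uB] := ub (t ++ s); exists B => x; rewrite /dparts -foldr_cat; exact: uB.
Qed.

Lemma bounded_mul_integ u k (B : R) : continuous u -> (forall x, `|u x| <= B) ->
  continuous k -> integ k -> integ (fun y => u y * k y).
Proof.
move=> cu uB ck kI; apply/integP; first exact: continuousMf.
apply: (@le_lt_trans _ _ (L1 (fun y => B * k y))).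
  apply: L1_le; [exact: continuousMf|exact: continuousZf|move=> x].
  by rewrite !normrM ler_wpM2r// (le_trans (uB x))// ler_norm.
by rewrite (L1Z B ck) lte_mul_pinfty//; apply/integP.
Qed.

Lemma reflect_integ k x : continuous k -> integ k -> integ (fun y => k (x - y)).
Proof.
move=> ck kI.
rewrite (_ : (fun y => _) = (fun y => k (x + (-1) *: y))); last first.
  by apply/funext => y; rewrite scaleN1r.
apply/integP; first exact: affine_continuous.
by rewrite (L1_affine x ck) ?normrN1//; apply/integP.
Qed.

Lemma Int_reflect k x : continuous k -> Int (fun y => k (x - y)) = Int k.
Proof.
move=> ck; rewrite -(Int_affine (s := -1) x ck) ?normrN1//; congr Int.
by apply/funext => y; rewrite scaleN1r.
Qed.

Lemma convC f g x : continuous f -> continuous g -> conv f g x = conv g f x.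
Proof.
move=> cf cg; rewrite /conv -[LHS](@Int_reflect _ x); last first.
  exact: continuousMf cf (reflect_continuous (x := x) cg).
by congr Int; apply/funext => y; rewrite mulrC subKr.
Qed.

(** Integration by parts: the derivative of y |-> u y * k (x - y) has integral 0. *)
Lemma conv_dpart u k i x : bDL1 u -> rDL1 k ->
  conv u (dpart i k) x = conv (dpart i u) k x.
Proof.
move=> [uD ub] kD.
have [su sk] := (uD.1, kD.1).
have cu := csmooth_cont su; have ck := csmooth_cont sk.
have cdu := csmooth_cont (csmooth_dpart i su).
have cdk := csmooth_cont (csmooth_dpart i sk).
have [B uB] := ub [::]; have [B' uB'] := ub [:: i].
pose h y := u y * k (x - y).
pose h1 y := dpart i u y * k (x - y).
pose h2 y := u y * dpart i k (x - y).
have crk := reflect_continuous (x := x) ck.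
have crdk := reflect_continuous (x := x) cdk.
have ch : continuous h by exact: continuousMf.
have ch1 : continuous h1 by exact: continuousMf.
have ch2 : continuous h2 by exact: continuousMf.
have Ih : integ h.
  apply: (bounded_mul_integ cu uB crk); apply: reflect_integ => //.
  exact: rDL1_integ.
have Ih1 : integ h1.
  apply: (bounded_mul_integ cdu uB' crk); apply: reflect_integ => //.
  exact: rDL1_integ.
have Ih2 : integ h2.
  apply: (bounded_mul_integ cu uB crdk); apply: reflect_integ => //.
  exact: (rDL1_integ (rDL1_dparts [:: i] kD)).
have d : derivable_along i h (fun y => h1 y - h2 y).
  move=> y t; set e := delta_mx 0 i.
  have du := csmooth_derivable_along i su y t.
  have dk : is_derive t (1 : R) (fun t : R => k (x - (y + t *: e)))
      (- dpart i k (x - (y + t *: e))).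
    have := csmooth_derivable_along i sk (x - y) (- t).
    have -> : (fun t : R => k (x - (y + t *: e))) =
       (fun t : R => k (x - y + t *: e)) \o -%R.
      by apply/funext => r /=; rewrite scaleNr opprD addrA.
    move=> dk; have dN : is_derive t (1 : R) (-%R : R -> R) (-1) by exact: is_deriveNid.
    have := is_derive1_comp dk dN.
    by rewrite mulrN1 scaleNr opprD addrA.
  apply: is_derive_eq (is_deriveM du dk) _.
  by rewrite /h1 /h2 /GRing.scale /= mulrN addrC mulrC.
have := Int_derivative ch (continuousBf ch1 ch2) d.
rewrite IntB// => /(_ _ _)/eqP; rewrite subr_eq0 => H.
apply/esym/eqP; apply: H; first by apply/integP.
by apply/integP; [exact: continuousBf|exact: (integrableB measurableT Ih1 Ih2)].
Qed.

Lemma conv_dparts u k s x : bDL1 u -> rDL1 k ->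
  conv u (dparts s k) x = conv (dparts s u) k x.
Proof.
elim: s u => //= i s IH u ub kD.
rewrite (conv_dpart i x ub (rDL1_dparts s kD)).
by rewrite (IH _ (bDL1_dparts [:: i] ub) kD) -dpart_dparts//; exact: ub.1.1.
Qed.

Lemma bDL1_conv_integ u k s x : bDL1 u -> rDL1 k ->
  integ (fun y => u y * dparts s k (x - y)).
Proof.
move=> ub kD; have [B uB] := ub.2 [::]; have csk := (kD.1 s).1.
apply: (bounded_mul_integ (rDL1_cont ub.1) uB (reflect_continuous (x := x) csk)).
by apply: reflect_integ => //; exact: (rDL1_integ (rDL1_dparts s kD)).
Qed.

Lemma bDL1_conv_integr u k s x : bDL1 u -> rDL1 k ->
  integ (fun y => k y * dparts s u (x - y)).
Proof.
move=> ub kD; have [B uB] := ub.2 s; have csu := (ub.1.1 s).1.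
rewrite (_ : (fun y => _) = (fun y => dparts s u (x - y) * k y)); last first.
  by apply/funext => y; rewrite mulrC.
apply: (bounded_mul_integ (B := B) (reflect_continuous (x := x) csu)) => //.
  exact: rDL1_cont.
exact: rDL1_integ.
Qed.

Lemma integZ (c : R) f : integ f -> integ (fun x => c * f x).
Proof. exact: integrableZl. Qed.

Lemma IntZ (c : R) f : integ f -> Int (fun x => c * f x) = c * Int f.
Proof. exact: RintegralZl. Qed.

Lemma integD f g : integ f -> integ g -> integ (fun x => f x + g x).
Proof. exact: integrableD. Qed.

Lemma IntD f g : integ f -> integ g -> Int (fun x => f x + g x) = Int f + Int g.
Proof. exact: RintegralD. Qed.

Section functional.
Variables (T : (E -> R) -> R) (M : nat) (K : R).
Hypothesis T_lin : forall (c : R) f g, rDL1 f -> rDL1 g ->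
  T (fun x => c * f x + g x) = c * T f + T g.
Hypothesis T_bnd : forall f (e : R), rDL1 f -> 0 <= e ->
  (forall s, (size s <= M)%N -> (L1 (dparts s f) <= e%:E)%E) -> `|T f| <= K * e.
Local Notation orbit := (orbit T).
Local Notation pair u f := (Int (fun y => u y * orbit f y)).

(** Both sides represent T (u * f), and the convolution is commutative. *)
Lemma pair_swap u f : bDL1 u -> rDL1 f -> pair u f = pair f u.
Proof.
move=> ub fD; have uD := ub.1.
apply: (pairing_eq T_lin T_bnd (rDL1_integ uD) (rDL1_cont uD) fD
  (rDL1_integ fD) (rDL1_cont fD) uD) => s x.
- exact: bDL1_conv_integ.
- exact: bDL1_conv_integr.
- rewrite (conv_dparts s x ub fD) convC//; last exact: rDL1_cont.
  exact: (uD.1 s).1.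
Qed.

(** Both sides represent T (u * d_i f). *)
Lemma pair_dpart u f i : bDL1 u -> rDL1 f -> pair u (dpart i f) = pair (dpart i u) f.
Proof.
move=> ub fD; have uD := ub.1.
have ub' := bDL1_dparts [:: i] ub; have fD' := rDL1_dparts [:: i] fD.
apply: (pairing_eq T_lin T_bnd (rDL1_integ uD) (rDL1_cont uD) fD'
  (rDL1_integ ub'.1) (rDL1_cont ub'.1) fD) => s x.
- exact: bDL1_conv_integ.
- exact: bDL1_conv_integ.
- rewrite -dpart_dparts//; last exact: fD.1.
  exact: (conv_dpart i x ub (rDL1_dparts s fD)).
Qed.

Lemma pair_le u f (c : R) : rDL1 u -> rDL1 f -> (forall y, `|orbit f y| <= c) ->
  (`|pair u f|%:E <= c%:E * L1 u)%E.
Proof.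
move=> uD fD fc; have cu := rDL1_cont uD; have co := orbit_continuous T_lin T_bnd fD.
apply: le_trans (Int_le (continuousMf cu co)) _.
have c0 : 0 <= c by rewrite (le_trans _ (fc 0)).
apply: (@le_trans _ _ (L1 (fun y => c * u y))).
  apply: L1_le; [exact: continuousMf|exact: continuousZf|move=> x].
  by rewrite !normrM mulrC ler_wpM2r// (le_trans (fc x))// ler_norm.
by rewrite (L1Z c cu) ger0_norm.
Qed.

Lemma pair_integ u f : rDL1 u -> rDL1 f -> integ (fun y => u y * orbit f y).
Proof.
move=> uD fD; have [B fB] := orbit_bounded T_bnd fD.
rewrite (_ : (fun y => _) = (fun y => orbit f y * u y)); last first.
  by apply/funext => y; rewrite mulrC.
apply: (bounded_mul_integ (orbit_continuous T_lin T_bnd fD) fB).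
  exact: rDL1_cont.
exact: rDL1_integ.
Qed.

(** The supremum S of |w| is finite and satisfies S <= (1 - e) c + e S, hence
S <= c.  The factor 1 - e is regained exactly, so that this can be
iterated without losing constants. *)
Lemma contraction_bound (w : E -> R) (v : E) (e c B : R) :
  0 <= e < 1 -> (forall y, `|w y| <= B) ->
  (forall y, `|w y - e * w (y + v)| <= (1 - e) * c) -> forall y, `|w y| <= c.
Proof.
move=> /andP[e0 e1] wB we.
pose S := sup [set `|w y| | y in setT].
have hS : has_sup [set `|w y| | y in setT].
  by split; [exists `|w 0|; exists 0|exists B => _ [y _ <-]].
have wS y : `|w y| <= S by apply: ub_le_sup; [exact: hS.2|exists y].
have SS : S <= (1 - e) * c + e * S.
  apply: ge_sup; first exact: hS.1.
  move=> _ [y _ <-]; rewrite -[w y](subrK (e * w (y + v))).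
  apply: le_trans (ler_normD _ _) _; apply: lerD => //.
  by rewrite normrM (ger0_norm e0) ler_wpM2l.
move=> y; apply: le_trans (wS y) _.
have : (1 - e) * S <= (1 - e) * c by rewrite mulrBl mul1r lerBlDr.
by rewrite ler_pM2l// subr_gt0.
Qed.

Lemma pair_orbit_tr u f v : rDL1 u -> rDL1 f ->
  Int (fun y => tr v u y * orbit f y) = pair u (tr v f).
Proof.
move=> uD fD; have cu := rDL1_cont uD; have co := orbit_continuous T_lin T_bnd fD.
have c : continuous (fun y => tr v u y * orbit f y).
  exact: continuousMf (shift_continuous (c := - v) cu) co.
rewrite -[LHS](Int_affine (s := 1) v c) ?normr1//; congr Int; apply/funext => y.
rewrite scale1r /tr addrAC subrr add0r /orbit; congr (_ * T _).
by apply/funext => x; rewrite /tr opprD addrA addrAC.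
Qed.

(** With w y the pairing of Q with the translate of f by y, the relation between
P and Q and an integration by parts turn w y - e w (y + v) into 1 - e times
the pairing of P with the translate of lam d_i f + f; then contraction_bound
applies. *)
Lemma pair_step P Q f i (lam e a c : R) : bDL1 P -> bDL1 Q -> rDL1 f ->
  0 <= e < 1 ->
  (forall x, (1 - e) * (P x + lam * dpart i P x) =
     Q x - e * tr (a *: delta_mx 0 i) Q x) ->
  (forall y, `|pair P (tr y (fun x => lam * dpart i f x + f x))| <= c) ->
  forall y, `|pair Q (tr y f)| <= c.
Proof.
move=> bP bQ fD e01 PQ Pc.
pose v : E := a *: delta_mx 0 i.
have [B fB] := orbit_bounded T_bnd fD.
have QB y : `|pair Q (tr y f)| <= B * fine (L1 Q).
  have fy z : `|orbit (tr y f) z| <= B.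
    rewrite (_ : orbit _ _ = orbit f (y + z))//; congr T.
    by apply/funext => x; rewrite /tr opprD addrAC addrA addrAC.
  have := pair_le bQ.1 (rDL1_tr y fD) fy.
  rewrite -(@fineK _ (L1 Q)) ?lee_fin//.
  by rewrite ge0_fin_numE ?L1_ge0//; exact: (bQ.1.2 [::]).
apply: (@contraction_bound _ v e c _ e01 QB) => y.
have fyD := rDL1_tr y fD; have dfyD := rDL1_dparts [:: i] fyD.
have bdP := bDL1_dparts [:: i] bP.
have QvD := rDL1_tr v bQ.1.
have -> : tr (y + v) f = tr v (tr y f).
  by apply/funext => x; rewrite /tr opprD addrA addrAC.
rewrite -(pair_orbit_tr v bQ.1 fyD).
have I1 := pair_integ bQ.1 fyD; have I2 := pair_integ QvD fyD.
have I3 := pair_integ bP.1 fyD; have I4 := pair_integ bdP.1 fyD.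
rewrite -(IntZ e I2) -(IntB I1 (integZ e I2)).
have oE z : orbit (tr y (fun x => lam * dpart i f x + f x)) z =
    lam * orbit (dpart i (tr y f)) z + orbit (tr y f) z.
  rewrite /orbit -T_lin; [|exact: rDL1_tr|exact: rDL1_tr].
  by congr T; rewrite dpart_tr.
have I5 := pair_integ bP.1 dfyD.
suff -> : Int (fun z => Q z * orbit (tr y f) z - e * (tr v Q z * orbit (tr y f) z)) =
    (1 - e) * pair P (tr y (fun x => lam * dpart i f x + f x)).
  rewrite normrM ger0_norm ?subr_ge0; last by case/andP: e01 => _ /ltW.
  by rewrite ler_wpM2l// subr_ge0; case/andP: e01 => _ /ltW.
have -> : pair P (tr y (fun x => lam * dpart i f x + f x)) =
   Int (fun z => lam * (P z * orbit (dpart i (tr y f)) z) + P z * orbit (tr y f) z).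
  by congr Int; apply/funext => z; rewrite oE mulrDr mulrCA.
rewrite (IntD (integZ lam I5) I3) (IntZ lam I5) (pair_dpart i bP fyD).
rewrite -(IntZ lam I4) -(IntD (integZ lam I4) I3).
rewrite -(IntZ (1 - e) (integD (integZ lam I4) I3)).
congr Int; apply/funext => z; move: (PQ z) => PQz.
move: (orbit (tr y f) z) PQz; rewrite -/v => o PQz.
transitivity ((Q z - e * tr v Q z) * o); first by ring.
by rewrite -PQz /=; ring.
Qed.

End functional.
End Exchange.

(** * Averages against truncated exponential densities *)

Section Averaging.
Context {R : realType}.
Local Notation mu := (@lebesgue_measure R).
Implicit Types (K P : R -> R) (x d a lam : R).

Definition causal K := forall x, x <= 0 -> K x = 0.
(** For causal K any negative lower bound gives the same values. *)
Definition weighted_primitive lam K x : R :=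
  (\int[mu]_(t in `[(-1)%R, x]) (expR (lam * t) * K t))%R.

Lemma is_derive_expM lam x : is_derive x 1 (fun t => expR (lam * t)) (lam * expR (lam * x)).
Proof.
have d1 : is_derive x (1 : R) (fun t : R => lam * t) lam.
  apply: is_derive_eq (is_deriveZ lam (is_derive_id x (1 : R))) _.
  exact: mulr1.
have := is_derive1_comp (is_derive_expR (lam * x)) d1.
by rewrite mulrC.
Qed.

Lemma derivable_continuous K K' : (forall x : R, is_derive x (1 : R) K (K' x)) -> continuous K.
Proof.
move=> dK x; apply: differentiable_continuous; apply/derivable1_diffP.
exact: (@ex_derive _ _ _ _ _ _ _ (dK x)).
Qed.

Lemma is_derive_weighted_primitive lam K x : continuous K -> causal K ->
  is_derive x 1 (weighted_primitive lam K) (expR (lam * x) * K x).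
Proof.
move=> cK K0; pose f t := expR (lam * t) * K t.
have cf : continuous f.
  move=> t; apply: (@cvgM R R (nbhs t) _ (fun t => expR (lam * t)) K); last exact: cK.
  exact: (derivable_continuous (is_derive_expM lam)).
have [x1|x1] := ltP (-1) x.
  have fi : mu.-integrable `[(-1)%R, x + 1] (EFin \o f).
    apply: continuous_compact_integrable; first exact: segment_compact.
    exact: continuous_subspaceT.
  have xx1 : x < x + 1 by rewrite ltrDl.
  have [d1 d2] : derivable (weighted_primitive lam K) x 1 /\
      derive1 (weighted_primitive lam K) x = f x.
    exact: (continuous_FTC1_closed xx1 fi x1 (cf x)).
  by apply: DeriveDef; [exact: d1|rewrite -derive1E; exact: d2].
have K0' t : t <= 0 -> weighted_primitive lam K t = 0.
  move=> t0; transitivity (\int[mu]_(r in `[(-1)%R, t]) (cst 0 r))%R; last first.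
    by rewrite Rintegral_cst// mul0r.
  apply: eq_Rintegral => r; rewrite inE/= in_itv/= => /andP[_ rt].
  by rewrite K0 ?mulr0// (le_trans rt).
rewrite (K0 x) ?mulr0; last by rewrite (le_trans x1)// lerN10.
apply: (@near_eq_is_derive _ _ _ (cst 0)).
  near=> y; rewrite K0'//; apply: ltW; near: y.
  by apply: lt_nbhsl; rewrite (le_lt_trans x1)// ltrN10.
Unshelve. all: by end_near. Qed.

(** Cauchy's mean value theorem for P and t |-> exp (lam t). *)
Lemma exp_weighted_MVT (P G : R -> R) lam a x : 0 < lam -> 0 < a ->
  (forall t : R, is_derive t (1 : R) P (expR (lam * t) * G t)) ->
  exists2 xi, x - a < xi < x &
    P x - P (x - a) = (expR (lam * x) - expR (lam * (x - a))) / lam * G xi.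
Proof.
move=> l0 a0 dP.
pose E t := expR (lam * t).
pose dE : R := E x - E (x - a).
pose dP' : R := P x - P (x - a).
(* this function takes the same value at x - a and at x *)
have dH (t : R) : is_derive t (1 : R) (dE \*: P - dP' \*: E)
    (dE *: (E t * G t) - dP' *: (lam * E t)).
  exact: (is_deriveB (is_deriveZ dE (dP t)) (is_deriveZ dP' (is_derive_expM lam t))).
have xa : x - a < x by rewrite ltrBlDr ltrDl.
have cH : {within `[x - a, x], continuous (dE \*: P - dP' \*: E)}.
  by apply: continuous_subspaceT; exact: (derivable_continuous dH).
have [xi + Exi] := MVT xa (fun t _ => dH t) cH.
rewrite in_itv/= => axi; exists xi => //; move: Exi.
rewrite [X in X = _](_ : _ = 0); last first.
  rewrite /dE /dP' /GRing.scale /= -[LHS]/((E x - E (x - a)) * P x - (P x - P (x - a)) * E x -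
   ((E x - E (x - a)) * P (x - a) - (P x - P (x - a)) * E (x - a))).
  by ring.
move/esym/eqP; rewrite mulf_eq0 subKr (gt_eqF a0) orbF subr_eq0 => /eqP.
rewrite /GRing.scale /= => Hxi.
have Exi0 : E xi != 0 by rewrite gt_eqF// expR_gt0.
have H : dE * G xi = dP' * lam.
  by apply: (mulfI Exi0); rewrite [LHS]mulrCA Hxi mulrA mulrC.
by rewrite -/dP' -/(E x) -/(E (x - a)) -/dE mulrAC H mulfK// gt_eqF.
Qed.

(** The mean of K (x - s) over s in [0, a], with weight proportional to
exp (- lam s). *)
Definition average lam a K x : R := lam / (1 - expR (- (lam * a))) *
  (expR (- (lam * x)) * (weighted_primitive lam K x - weighted_primitive lam K (x - a))).

(** A finite linear combination of translates: the entry (c, K, d) stands for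
x |-> c K (x + d), and op is applied to each K. *)
Definition combine (op : (R -> R) -> R -> R) (s : seq (R * (R -> R) * R)) x :=
  \sum_(p <- s) p.1.1 * op p.1.2 (x + p.2).

(** A weighted mean of a continuous function is one of its values.  Stating
this for linear combinations, with a common point xi, lets inequalities
between values and differences pass to the averages. *)
Lemma average_MVT lam a (s : seq (R * (R -> R) * R)) x : 0 < lam -> 0 < a ->
  (forall p, p \in s -> continuous p.1.2 /\ causal p.1.2) ->
  exists2 xi, x - a < xi < x &
    combine (average lam a) s x = combine id s xi.
Proof.
move=> l0 a0 sK.
pose P t := \sum_(p <- s) p.1.1 * expR (- (lam * p.2)) *
  weighted_primitive lam p.1.2 (t + p.2).
have dP (t : R) : is_derive t (1 : R) P (expR (lam * t) * combine id s t).
  rewrite /P /combine; elim: s sK {P} => [|p s IH] sK.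
    rewrite big_nil mulr0 (_ : (fun _ => _) = cst 0); last first.
      by apply/funext => u; rewrite big_nil.
    exact: is_derive_cst.
  have [cK K0] : continuous p.1.2 /\ causal p.1.2 by apply: sK; rewrite mem_head.
  have {}IH := IH (fun q qs => sK q (mem_behead (s := p :: s) qs)).
  rewrite big_cons mulrDr (_ : (fun t => _) = (fun t => p.1.1 * expR (- (lam * p.2)) *
     weighted_primitive lam p.1.2 (t + p.2)) + (fun t =>
     \sum_(p <- s) p.1.1 * expR (- (lam * p.2)) * weighted_primitive lam p.1.2 (t + p.2)));
    last by apply/funext => u; rewrite big_cons.
  apply: is_deriveD.
  have := @is_derive1_comp R (weighted_primitive lam p.1.2) (shift p.2) t _ _
    (is_derive_weighted_primitive lam (t + p.2) cK K0) (is_derive_shift t (1 : R) p.2).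
  move=> /(is_deriveZ (p.1.1 * expR (- (lam * p.2)))).
  move=> d; apply: is_derive_eq d _.
  rewrite /GRing.scale /= mulr1 mulrDr expRD expRN.
  by have := expR_gt0 (lam * p.2); move: (expR (lam * p.2)) => w w0; field; rewrite gt_eqF.
have [xi xix Exi] := exp_weighted_MVT x l0 a0 dP; exists xi => //.
transitivity (lam / (1 - expR (- (lam * a))) * (expR (- (lam * x)) * (P x - P (x - a)))).
  rewrite /combine /P -sumrB 2!mulr_sumr; apply: eq_bigr => p _.
  rewrite /average (mulrDr lam) opprD expRD [x + p.2 - a]addrAC.
  move: (weighted_primitive _ _ _) (weighted_primitive _ _ _) (_ / _) => w1 w2 q.
  by move: (expR _) (expR _) => e1 e2; ring.
have e1 : expR (- (lam * a)) < 1 by rewrite expR_lt1 oppr_lt0 mulr_gt0.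
rewrite Exi (mulrBr lam) expRD !expRN.
have ex := expR_gt0 (lam * x).
have ea : expR (lam * a) != 1.
  by rewrite gt_eqF// expR_gt1 mulr_gt0.
have ea0 := expR_gt0 (lam * a).
move: (combine _ _ _) (expR _) (expR _) ex ea ea0 => c E1 E2 E10 E21 E20.
by field; rewrite (gt_eqF l0) (gt_eqF E10) (gt_eqF E20) subr_eq0 E21.
Qed.

End Averaging.

(** * Infinitely iterated averages of the ramp *)

Section IteratedAverages.
Context {R : realType}.
Implicit Types (K : R -> R) (x d s : R).

(** The second primitive of the Dirac mass.  Averaging it instead of the Dirac
mass gives uniformly Lipschitz functions, whose limit is easy to take. *)
Definition ramp x : R := Num.max x 0.

(** Properties that are stable under averages and pointwise limits and
hold for the ramp.  Convexity, written with differences, yields the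
positivity of the second derivative. *)
Record ramp_like K : Prop := RampLike {
  ramp_causal : causal K;
  ramp_lip : forall x d, `|K (x + d) - K x| <= `|d|;
  ramp_convex : forall x d s, 0 <= d -> 0 <= s ->
    K (x + d) - K x <= K (x + s + d) - K (x + s) }.

Lemma ramp_like_continuous K : ramp_like K -> continuous K.
Proof.
move=> [_ Kl _] x; apply/(@cvgrPdist_le _ _ _ (nbhs x)) => e e0.
have := nbhsx_ballx x _ e0; apply: filterS => z.
rewrite -ball_normE /= => /ltW xz.
by have := Kl z (x - z); rewrite [z + _]addrC subrK => /le_trans; apply.
Qed.

Lemma ramp_like_ramp : ramp_like ramp.
Proof.
split => [x x0|x d|x d s d0 s0]; rewrite /ramp.
- by apply/max_idPr.
- have [h1|h1] := leP x 0; have [h2|h2] := leP (x + d) 0;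
    rewrite ler_norml; have := ler_norm d; have := ler_norm (- d); rewrite normrN => ? ?;
    by apply/andP; split; lra.
- have [h1|h1] := leP x 0; have [h2|h2] := leP (x + d) 0;
  have [h3|h3] := leP (x + s) 0; have [h4|h4] := leP (x + s + d) 0; lra.
Qed.

Section one_step.
Variables (lam a : R) (l0 : 0 < lam) (a0 : 0 < a).
Local Notation avg := (average lam a).

Let adm (s : seq (R * (R -> R) * R)) :=
  forall p, p \in s -> continuous p.1.2 /\ causal p.1.2.

Lemma average1 K x : ramp_like K -> exists2 xi, x - a < xi < x & avg K x = K xi.
Proof.
move=> Kr; have [|xi xix E] := average_MVT (s := [:: (1, K, 0)]) x l0 a0.
  by move=> p; rewrite inE => /eqP ->; split; [exact: ramp_like_continuous|exact: ramp_causal].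
by exists xi => //; move: E; rewrite /combine !big_seq1/= !mul1r !addr0.
Qed.

Lemma average2 K K' x d : ramp_like K -> ramp_like K' ->
  exists2 xi, x - a < xi < x & avg K (x + d) - avg K' x = K (xi + d) - K' xi.
Proof.
move=> Kr Kr'; have [|xi xix E] := average_MVT (s := [:: (1, K, d); (-1, K', 0)]) x l0 a0.
  by move=> p; rewrite !inE => /orP[] /eqP ->;
    split; solve [exact: ramp_like_continuous|exact: ramp_causal].
exists xi => //; move: E; rewrite /combine !big_cons !big_nil/=.
by rewrite !mul1r !mulN1r !addr0.
Qed.

Lemma average4 K x d s : ramp_like K -> exists2 xi, x - a < xi < x &
  (avg K (x + (s + d)) - avg K (x + s)) - (avg K (x + d) - avg K x) =
  (K (xi + (s + d)) - K (xi + s)) - (K (xi + d) - K xi).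
Proof.
move=> Kr; have [|xi xix E] := average_MVT
    (s := [:: (1, K, s + d); (-1, K, s); (-1, K, d); (1, K, 0)]) x l0 a0.
  by move=> p; rewrite !inE => /or4P[] /eqP ->;
    split; solve [exact: ramp_like_continuous|exact: ramp_causal].
exists xi => //; move: E; rewrite /combine !big_cons !big_nil/=.
by rewrite !mul1r !mulN1r !addr0; lra.
Qed.

Lemma ramp_like_average K : ramp_like K -> ramp_like (avg K).
Proof.
move=> Kr; split => [x x0|x d|x d s d0 s0].
- have [xi /andP[_ xix] ->] := average1 x Kr.
  by rewrite (ramp_causal Kr)// ltW// (lt_le_trans xix).
- by have [xi _ ->] := average2 x d Kr Kr; exact: ramp_lip.
- rewrite -subr_ge0 -[x + s + d]addrA; have [xi _ ->] := average4 x d s Kr.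
  by rewrite subr_ge0 [xi + (s + d)]addrA; exact: ramp_convex.
Qed.

(** The average A satisfies A + A' / lam = (K - e K (. - a)) / (1 - e) with
e = exp (- lam a): it is a one-sided inverse of 1 + d / lam up to the
truncation term. *)
Lemma is_derive_average K x : ramp_like K ->
  is_derive x (1 : R) (avg K)
   (lam / (1 - expR (- (lam * a))) * (K x - expR (- (lam * a)) * K (x - a)) -
    lam * avg K x).
Proof.
move=> Kr; have cK := ramp_like_continuous Kr; have K0 := ramp_causal Kr.
have d1 := is_derive_weighted_primitive lam x cK K0.
have d2 := @is_derive1_comp R (weighted_primitive lam K) (shift (- a)) x _ _
    (is_derive_weighted_primitive lam (x - a) cK K0) (is_derive_shift x (1 : R) (- a)).
have d3 := is_derive_expM (- lam) x.
have d4 := is_deriveZ (lam / (1 - expR (- (lam * a)))) (is_deriveM d3 (is_deriveB d1 d2)).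
set D := (X in is_derive _ _ _ X).
rewrite (_ : avg K = (lam / (1 - expR (- (lam * a)))) \*:
  ((fun t : R => expR (- lam * t)) * (weighted_primitive lam K -
    (weighted_primitive lam K \o shift (- a))))); last first.
  apply/funext => t; rewrite /average /GRing.scale /=.
  by rewrite -[RHS]/(_ * (expR (- lam * t) * _)) mulNr.
apply: is_derive_eq d4 _.
rewrite /D /average /GRing.scale /= !fctE /= mulr1 mulNr; rewrite (mulrBr lam) expRD !expRN.
have ex := expR_gt0 (lam * x); have ea := expR_gt0 (lam * a).
move: (weighted_primitive _ _ _) (weighted_primitive _ _ _) (lam / _) => w1 w2 q.
move: (expR (lam * x)) (expR (lam * a)) ex ea => E1 E2 E10 E20.
by field; rewrite (gt_eqF E10) (gt_eqF E20).
Qed.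

End one_step.

Section limit.
Variables (lam : nat -> R) (l0 : forall m, 0 < lam m).

Definition width (m : nat) : R := 2^-1 ^+ m.+1.

Lemma width_gt0 m : 0 < width m. Proof. by rewrite exprn_gt0. Qed.

(** The sum of width p over p >= m. *)
Definition tail_width (m : nat) : R := 2^-1 ^+ m.

Lemma tail_widthS m : tail_width m = width m + tail_width m.+1.
Proof.
rewrite /tail_width /width exprS; move: (_ ^+ m) => w.
by have := splitr w; rewrite ![w / 2]mulrC.
Qed.

Fixpoint iter_average N m : R -> R :=
  if N is N'.+1 then average (lam m) (width m) (iter_average N' m.+1) else ramp.

Lemma iter_average_ramp_like N m : ramp_like (iter_average N m).
Proof.
elim: N m => [|N IH] m /=; first exact: ramp_like_ramp.
by apply: ramp_like_average => //; exact: width_gt0.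
Qed.

Lemma iter_average_cauchy N m x :
  `|iter_average N.+1 m x - iter_average N m x| <= width (m + N).
Proof.
elim: N m x => [|N IH] m x.
  rewrite addn0 /=.
  have [xi /andP[h1 h2] ->] := average1 (l0 m) (width_gt0 m) x ramp_like_ramp.
  have := ramp_lip ramp_like_ramp x (xi - x); rewrite [x + _]addrC subrK.
  move=> /le_trans; apply; rewrite ler_norml; apply/andP; split; lra.
have [xi _] := average2 (l0 m) (width_gt0 m) x 0
  (iter_average_ramp_like N.+1 m.+1) (iter_average_ramp_like N m.+1).
by rewrite !addr0 => E; rewrite [X in `|X|]E addnS -addSn.
Qed.

Lemma iter_average_cauchy_add N p m x :
  `|iter_average (N + p) m x - iter_average N m x| <=
    tail_width (m + N) - tail_width (m + N + p).
Proof.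
elim: p => [|p IH]; first by rewrite !addn0 !subrr normr0.
rewrite !addnS.
rewrite -(subrK (iter_average (N + p) m x) (iter_average _ m x)) -addrA.
apply: le_trans (ler_normD _ _) _; apply: (le_trans (lerD (iter_average_cauchy _ _ _) IH)).
by rewrite (tail_widthS (m + N + p)) addnA; lra.
Qed.

Lemma tail_width_ge0 m : 0 <= tail_width m.
Proof. by rewrite exprn_ge0. Qed.

(** The error terms of the iterated averages vanish in the limit. *)
Lemma le_tail_width (A B C : R) (m : nat) : 0 <= C ->
  (forall N, A <= B + C * tail_width (m + N)) -> A <= B.
Proof.
move=> C0 H; apply/ler_addgt0Pr => e e0.
have C1 : 0 < C + 1 by rewrite ltr_wpDl.
have [N _ HN] := near_infty_natSinv_expn_lt (PosNum (divr_gt0 e0 C1)).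
apply: le_trans (H N) _; rewrite lerD2l.
have /= hN := HN N (leqnn N).
have : tail_width (m + N) <= e / (C + 1).
  apply: le_trans (ltW hN); rewrite /tail_width exprD div1r -exprVn.
  by rewrite ler_piMl ?exprn_ge0// exprn_ile1// invf_le1// ler1n.
move=> h; apply: le_trans (ler_wpM2l C0 h) _.
by rewrite mulrA ler_pdivrMr// mulrDr mulr1 mulrC lerDl ltW.
Qed.

(** The limit of the iterated averages as N grows.  By iter_average_cauchy_add
the corrected terms are nondecreasing in N, so that it is a supremum. *)
Definition ramp_limit m x : R :=
  sup [set iter_average N m x - tail_width (m + N) | N in setT].

Lemma ramp_limit_close m N x :
  `|ramp_limit m x - iter_average N m x| <= tail_width (m + N).
Proof.
have ub M p : iter_average p m x - tail_width (m + p) <=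
    iter_average M m x + tail_width (m + M).
  have [Mp|pM] := leqP M p.
    have := iter_average_cauchy_add M (p - M) m x; rewrite subnKC//.
    rewrite -addnA subnKC// ler_norml => /andP[_].
    by have := tail_width_ge0 (m + p); lra.
  have := iter_average_cauchy_add p (M - p) m x; rewrite subnKC ?(ltnW pM)//.
  rewrite -addnA subnKC ?(ltnW pM)// ler_norml => /andP[h _].
  by have := tail_width_ge0 (m + M); move: h; lra.
have hs : has_sup [set iter_average N m x - tail_width (m + N) | N in setT].
  split; first by exists (iter_average 0 m x - tail_width (m + 0)); exists 0%N.
  by exists (iter_average 0 m x + tail_width (m + 0)) => _ [p _ <-]; exact: ub.
rewrite ler_norml; apply/andP; split.
  rewrite lerBrDr addrC; apply: ub_le_sup; first exact: hs.2.
  by exists N.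
rewrite lerBlDr addrC; apply: ge_sup; first exact: hs.1.
by move=> _ [p _ <-]; exact: ub.
Qed.

Lemma ramp_limit_ramp_like m : ramp_like (ramp_limit m).
Proof.
have close N x := ramp_limit_close m N x.
split => [x x0|x d|x d s d0 s0].
- apply/eqP; rewrite -normr_le0; apply: (@le_tail_width _ _ 1 m) => // N.
  have := close N x; rewrite (ramp_causal (iter_average_ramp_like N m))//.
  by rewrite subr0 add0r mul1r.
- apply: (@le_tail_width _ _ 2 m) => // N.
  have := ramp_lip (iter_average_ramp_like N m) x d.
  have := close N x; have := close N (x + d); rewrite !ler_norml.
  by move=> /andP[? ?] /andP[? ?] /andP[? ?]; apply/andP; split; lra.
- apply: (@le_tail_width _ _ 4 m) => // N.
  have := ramp_convex (iter_average_ramp_like N m) x d0 s0.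
  have := close N x; have := close N (x + d); have := close N (x + s).
  have := close N (x + s + d); rewrite !ler_norml.
  by move=> /andP[? ?] /andP[? ?] /andP[? ?] /andP[? ?]; lra.
Qed.

Lemma ramp_limitE m : ramp_limit m = average (lam m) (width m) (ramp_limit m.+1).
Proof.
apply/funext => x; apply/eqP; rewrite -subr_eq0 -normr_le0.
apply: (@le_tail_width _ _ 2 m.+1) => // N; rewrite add0r.
have h1 := ramp_limit_close m N.+1 x.
have [xi _] := average2 (l0 m) (width_gt0 m) x 0
  (iter_average_ramp_like N m.+1) (ramp_limit_ramp_like m.+1).
rewrite !addr0 => h2.
have h3 := ramp_limit_close m.+1 N xi.
move: h1; rewrite /= addnS -addSn => h1.
rewrite -(subrK (average (lam m) (width m) (iter_average N m.+1) x) (ramp_limit m x)) -addrA h2.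
apply: le_trans (ler_normD _ _) _; rewrite distrC in h3.
by rewrite mulr_natl mulr2n lerD.
Qed.

(** Beyond the total width of the averages, they only see the part of the ramp of slope 1. *)
Lemma ramp_limit_slope m x d : tail_width m <= x -> 0 <= d ->
  ramp_limit m (x + d) - ramp_limit m x = d.
Proof.
move=> mx d0.
have slope N : forall m x, tail_width m <= x ->
    iter_average N m (x + d) - iter_average N m x = d.
  elim: N => [|N IH] k y ky /=.
    have y0 : 0 <= y by apply: le_trans ky; exact: tail_width_ge0.
    by rewrite /ramp !(max_idPl _) ?addr_ge0//; lra.
  have [xi /andP[h _] ->] := average2 (l0 k) (width_gt0 k) y d
    (iter_average_ramp_like N k.+1) (iter_average_ramp_like N k.+1).
  by apply: IH; move: ky h; rewrite tail_widthS; lra.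
apply/eqP; rewrite -subr_eq0 -normr_le0; apply: (@le_tail_width _ _ 2 m) => // N.
have := ramp_limit_close m N x; have := ramp_limit_close m N (x + d).
have := slope N m x mx; rewrite !ler_norml.
by move=> ? /andP[? ?] /andP[? ?]; apply/andP; split; lra.
Qed.

End limit.
End IteratedAverages.

(** * The smooth kernels *)

Section Kernels.
Context {R : realType}.
Local Notation mu := (@lebesgue_measure R).
Variables (lam : nat -> R) (l0 : forall m, 0 < lam m).
Implicit Types (x d : R).

Definition damping m : R := expR (- (lam m * width m)).

Lemma damping_ge0 m : 0 <= damping m. Proof. exact: expR_ge0. Qed.

Lemma damping_lt1 m : damping m < 1.
Proof. by rewrite expR_lt1 oppr_lt0 mulr_gt0 ?width_gt0. Qed.

(** The derivatives of ramp_limit lam m: the first one comes from is_derive_average,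
since ramp_limit lam m is the average of ramp_limit lam m.+1, and the next
ones by differentiating this formula.  This recursion is what makes the limit
smooth. *)
Fixpoint ramp_derivative k m x : R :=
  if k is k'.+1 then
    lam m / (1 - damping m) *
      (ramp_derivative k' m.+1 x - damping m * ramp_derivative k' m.+1 (x - width m))
    - lam m * ramp_derivative k' m x
  else ramp_limit lam m x.

Lemma is_derive_ramp_derivative k m x :
  is_derive x (1 : R) (ramp_derivative k m) (ramp_derivative k.+1 m x).
Proof.
elim: k m x => [|k IH] m x.
  have := is_derive_average (lam m) (width m) x (ramp_limit_ramp_like l0 m.+1).
  by rewrite -ramp_limitE.
have d1 := IH m.+1 x.
have d2 := @is_derive1_comp R (ramp_derivative k m.+1) (shift (- width m)) x _ _
    (IH m.+1 (x - width m)) (is_derive_shift x (1 : R) (- width m)).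
have d3 := IH m x.
have d4 := is_deriveB (is_deriveZ (lam m / (1 - damping m))
  (is_deriveB d1 (is_deriveZ (damping m) d2))) (is_deriveZ (lam m) d3).
apply: is_derive_eq d4 _.
by rewrite /GRing.scale /= mulr1.
Qed.

Lemma ramp_derivative_causal k m x : x <= 0 -> ramp_derivative k m x = 0.
Proof.
elim: k m x => [|k IH] m x x0 /=; first exact: (ramp_causal (ramp_limit_ramp_like l0 m)).
rewrite !IH//; first by rewrite !(mulr0, subr0).
by rewrite lerBlDr add0r (le_trans x0)// ltW// width_gt0.
Qed.

Lemma eq_near_derive (f g : R -> R) (x df dg : R) : (\near x, f x = g x) ->
  is_derive x (1 : R) f df -> is_derive x (1 : R) g dg -> df = dg.
Proof.
move=> fg d1 d2; have := near_eq_is_derive fg d1.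
by move=> [_ <-]; exact: (@derive_val _ _ _ _ _ _ _ d2).
Qed.

Lemma ramp_derivative1_tail m (x : R) : tail_width m < x -> ramp_derivative 1 m x = 1.
Proof.
move=> mx; have := is_derive_ramp_derivative 0 m x.
set t : R := tail_width m.
pose g (y : R) : R := ramp_limit lam m t + (y - t).
have dg : is_derive x (1 : R) g 1.
  have := is_deriveD (is_derive_cst (ramp_limit lam m t) x (1 : R)) (is_derive_shift x (1 : R) (- t)).
  by rewrite add0r.
move=> df; apply: (eq_near_derive _ df dg).
near=> y; rewrite /= /g.
have ty : t <= y by apply: ltW; near: y; exact: lt_nbhsr.
have := ramp_limit_slope l0 (lexx t) (d := y - t); rewrite subr_ge0 => /(_ ty).
by rewrite [t + _]addrC subrK => <-; rewrite addrC subrK.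
Unshelve. all: by end_near. Qed.

Lemma ramp_derivative_tail k m x : tail_width m < x -> ramp_derivative k.+2 m x = 0.
Proof.
have dc (c : R) y : is_derive y (1 : R) (cst c : R -> R) 0 by exact: is_derive_cst.
elim: k x => [|k IH] x mx.
  apply: (eq_near_derive _ (is_derive_ramp_derivative 1 m x) (dc 1 x)).
  by near=> y; apply: ramp_derivative1_tail; near: y; exact: lt_nbhsr.
apply: (eq_near_derive _ (is_derive_ramp_derivative k.+2 m x) (dc 0 x)).
by near=> y; apply: IH; near: y; exact: lt_nbhsr.
Unshelve. all: by end_near. Qed.

Lemma nondecreasing_derive_ge0 (f : R -> R) x (l : R) :
  (forall y z, y <= z -> f y <= f z) -> is_derive x (1 : R) f l -> 0 <= l.
Proof.
move=> nf [df <-]; apply: limr_ge => //; near=> h.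
have h0 : h != 0 by near: h; exact: nbhs_dnbhs_neq.
rewrite /= /GRing.scale /= mulr1.
move: h0; rewrite neq_lt => /orP[h0|h0].
- by rewrite nmulr_rge0 ?invr_lt0// subr_le0 nf// gerDr ltW.
- by rewrite pmulr_rge0 ?invr_gt0// subr_ge0 nf// lerDr ltW.
Unshelve. all: by end_near. Qed.

Lemma ramp_derivative2_ge0 m x : 0 <= ramp_derivative 2 m x.
Proof.
have D1 y z : y <= z -> ramp_derivative 1 m y <= ramp_derivative 1 m z.
  move=> yz; rewrite -subr_ge0.
  pose g (t : R) : R := ramp_limit lam m (t + (z - y)) - ramp_limit lam m t.
  have dg : is_derive y (1 : R) g (ramp_derivative 1 m z - ramp_derivative 1 m y).
    have dsh := @is_derive1_comp R (ramp_limit lam m) (shift (z - y)) y _ _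
      (is_derive_ramp_derivative 0 m (y + (z - y))) (is_derive_shift y (1 : R) (z - y)).
    have := is_deriveB dsh (is_derive_ramp_derivative 0 m y).
    by rewrite mulr1 [y + _]addrC subrK.
  apply: (nondecreasing_derive_ge0 _ dg) => s t st; rewrite /g.
  have := ramp_convex (ramp_limit_ramp_like l0 m) s (d := z - y) (s := t - s).
  by rewrite !subr_ge0 => /(_ yz st); rewrite [s + (t - s)]addrC subrK.
exact: (nondecreasing_derive_ge0 D1 (is_derive_ramp_derivative 1 m x)).
Qed.

(** The density of the infinite convolution of the truncated exponential
densities of index at least m, and its derivatives: ramp_limit lam m is the
convolution of that density with the ramp. *)
Definition kernel m k : R -> R := ramp_derivative k.+2 m.

Lemma is_derive_kernel m k x :
  is_derive x (1 : R) (kernel m k) (kernel m k.+1 x).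
Proof. exact: is_derive_ramp_derivative. Qed.

Lemma kernel_out m k x : x <= 0 \/ tail_width m < x -> kernel m k x = 0.
Proof.
by move=> [x0|mx]; [exact: ramp_derivative_causal|exact: ramp_derivative_tail].
Qed.

Lemma kernel_ge0 m x : 0 <= kernel m 0 x.
Proof. exact: ramp_derivative2_ge0. Qed.

Lemma kernel_continuous m k : continuous (kernel m k).
Proof. exact: (derivable_continuous (is_derive_kernel m k)). Qed.

Lemma kernel_recursion m x :
  (1 - damping m) * (kernel m 0 x + (lam m)^-1 * kernel m 1 x) =
  kernel m.+1 0 x - damping m * kernel m.+1 0 (x - width m).
Proof.
have -> : kernel m 1 x = lam m / (1 - damping m) *
   (kernel m.+1 0 x - damping m * kernel m.+1 0 (x - width m)) - lam m * kernel m 0 x by [].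
have := damping_lt1 m; have := l0 m.
move: (kernel _ _ _) (kernel _ _ _) (kernel _ _ _) (lam m) (damping m) => p q r l e lp e1.
have e1' : 1 - e != 0 by rewrite subr_eq0 gt_eqF.
have l' : l != 0 by rewrite gt_eqF.
by field; rewrite e1' l'.
Qed.

Lemma kernel_bounded m k : exists B, forall x, `|kernel m k x| <= B.
Proof.
have tm0 : 0 <= tail_width m :> R by exact: tail_width_ge0.
have ck : continuous (fun x => `|kernel m k x|).
  by apply: comp_continuous (@norm_continuous _ R); exact: kernel_continuous.
have [c _ Hc] := EVT_max tm0 (continuous_subspaceT ck).
exists `|kernel m k c| => x.
have [x0|x0] := leP x 0; first by rewrite kernel_out ?normr0//; left.
have [mx|xm] := ltP (tail_width m) x; first by rewrite kernel_out ?normr0//; right.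
by apply: Hc; rewrite in_itv/= (ltW x0).
Qed.

(** The integral is the total increase of the slope of ramp_limit, from 0 to 1. *)
Lemma kernel_integral m : (\int[mu]_x (kernel m 0 x)%:E = 1)%E.
Proof.
pose b := tail_width m + 1 : R.
have b0 : 0 < b by rewrite ltr_wpDl// tail_width_ge0.
have E : (\int[mu]_(x in `[0%R, b]) (kernel m 0 x)%:E = 1)%E.
  rewrite (@continuous_FTC2 R (kernel m 0) (ramp_derivative 1 m) 0 b)//.
  - rewrite ramp_derivative1_tail ?ltrDl// ramp_derivative_causal//.
    by rewrite -EFinB subr0.
  - by apply: continuous_subspaceT; exact: kernel_continuous.
  - have c1 := derivable_continuous (is_derive_ramp_derivative 1 m).
    split.
    + by move=> s _; exact: (@ex_derive _ _ _ _ _ _ _ (is_derive_ramp_derivative 1 m s)).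
    + by apply: cvg_at_right_filter; exact: c1.
    + by apply: cvg_at_left_filter; exact: c1.
  - move=> s _; rewrite derive1E.
    exact: (@derive_val _ _ _ _ _ _ _ (is_derive_ramp_derivative 1 m s)).
rewrite -E [RHS]integral_mkcond; apply: eq_integral => x _; rewrite patchE.
case: ifPn => //; rewrite notin_setE/= in_itv/= => /negP.
rewrite negb_and -!ltNge => /orP[x0|xb]; congr EFin; apply: kernel_out.
  by left; exact: ltW.
by right; rewrite (lt_trans _ xb)// ltrDl.
Qed.

End Kernels.

(** * Tensor products *)

Section TensorIntegral.
Context {R : realType}.
Local Notation mu := (@lebesgue_measure R).

Lemma integral_tensor n (h : 'I_n -> R -> R) (c : 'I_n -> R) :
  (forall i, measurable_fun setT (h i)) -> (forall i x, 0 <= h i x) ->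
  (forall i, \int[mu]_x (h i x)%:E = (c i)%:E)%E ->
  (\int[@lebesgue_tuple R n]_t (\prod_(i < n) h i (tnth t i))%:E =
   (\prod_(i < n) c i)%:E)%E.
Proof.
elim: n h c => [|n IH] h c mh h0 hc.
  under eq_integral do rewrite big_ord0.
  by rewrite integral_cst//= diracE mem_setT mule1 big_ord0.
have mprod m (g : 'I_m -> R -> R) : (forall i, measurable_fun setT (g i)) ->
    measurable_fun setT (fun t : m.-tuple R => (\prod_(i < m) g i (tnth t i))%:E).
  move=> mg; apply/measurable_EFinP; apply: measurable_prod => i _.
  by apply: (measurableT_comp (mg i)); exact: measurable_tnth.
rewrite lebesgue_tuple_fubini; last 2 first.
- exact: mprod.
- by move=> t; rewrite lee_fin prodr_ge0.
pose c' := \prod_(i < n) c (lift ord0 i).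
have E x : (\int[@lebesgue_tuple R n]_t
    (\prod_(i < n.+1) h i (tnth (cons_pair (x, t)) i))%:E = c'%:E * (h ord0 x)%:E)%E.
  under eq_integral => t _.
    rewrite big_ord_recl /cons_pair /= tnth0.
    under eq_bigr do rewrite tnthS.
    rewrite EFinM; over.
  rewrite (ge0_integralZl _ measurableT (mprod _ _ (fun i => mh (lift ord0 i))));
    [|by move=> t _; rewrite lee_fin prodr_ge0|by rewrite lee_fin].
  by rewrite (IH (fun i => h (lift ord0 i)) (fun i => c (lift ord0 i)))// muleC.
under eq_integral do rewrite E.
have c'0 : 0 <= c'.
  apply: prodr_ge0 => i _; rewrite -lee_fin -hc.
  by apply: integral_ge0 => x _; rewrite lee_fin.
have mh0 : measurable_fun setT (fun x => (h ord0 x)%:E).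
  by apply/measurable_EFinP; exact: mh.
transitivity (c'%:E * \int[mu]_x (h ord0 x)%:E)%E.
  by rewrite ge0_integralZl// => x _; rewrite lee_fin.
by rewrite hc big_ord_recl -EFinM mulrC.
Qed.

End TensorIntegral.

Section Tensor.
Context {R : realType} {n : nat}.
Local Notation mu := (@lebesgue_measure R).
Local Notation E := 'rV[R]_n.
Implicit Types (u : 'I_n -> nat -> R -> R) (k : 'I_n -> nat) (i : 'I_n) (x : E).

Definition tensor u k : E -> R := fun x => \prod_i u i (k i) (x 0 i).
Definition bump_index k i : 'I_n -> nat := fun j => (k j + (j == i))%N.
(** The index of u i counts derivatives, so that partial derivatives of a tensor
product only increment indices. *)
Definition derivative_tower u := forall i m (t : R),
  is_derive t (1 : R) (u i m) (u i m.+1 t).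

Lemma tensor_split u k i x : tensor u k x =
  u i (k i) (x 0 i) * \prod_(j | j != i) u j (k j) (x 0 j).
Proof. by rewrite /tensor (bigD1 i). Qed.

Lemma tensor_line u k i x (t : R) : tensor u k (x + t *: delta_mx 0 i) =
  u i (k i) (x 0 i + t) * \prod_(j | j != i) u j (k j) (x 0 j).
Proof.
rewrite (tensor_split u k i); congr (_ * _).
  by congr (u i _ _); rewrite !mxE !eqxx mulr1.
apply: eq_bigr => j ji; congr (u j _ _).
by rewrite !mxE eqxx /= (negbTE ji) mulr0 addr0.
Qed.

Lemma is_derive_tensor u k i x : derivative_tower u ->
  is_derive (0 : R) (1 : R) (fun t : R => tensor u k (x + t *: delta_mx 0 i))
    (tensor u (bump_index k i) x).
Proof.
move=> du.
have -> : (fun t : R => tensor u k (x + t *: delta_mx 0 i)) =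
    (\prod_(j | j != i) u j (k j) (x 0 j)) \*: (u i (k i) \o shift (x 0 i)).
  by apply/funext => t; rewrite tensor_line mulrC [x 0 i + t]addrC.
have d := @is_derive1_comp R (u i (k i)) (shift (x 0 i)) 0 _ _
  (du i (k i) (0 + x 0 i)) (is_derive_shift (0 : R) (1 : R) (x 0 i)).
apply: is_derive_eq (is_deriveZ _ d) _.
rewrite /GRing.scale /= mulr1 add0r (tensor_split _ _ i) /bump_index eqxx addn1.
rewrite mulrC; congr (_ * _); apply: eq_bigr => j /negbTE ji.
by rewrite ji addn0.
Qed.

Lemma dpart_tensor u k i : derivative_tower u ->
  dpart i (tensor u k) = tensor u (bump_index k i).
Proof.
move=> du; apply/funext => x; rewrite dpartE -derive_line.
exact: (@derive_val _ _ _ _ _ _ _ (is_derive_tensor k i x du)).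
Qed.

Lemma dparts_tensor u k s : derivative_tower u ->
  dparts s (tensor u k) = tensor u (fun j => (k j + count_mem j s)%N).
Proof.
move=> du; elim: s => [|i s IH] /=.
  by congr tensor; apply/funext => j; rewrite addn0.
rewrite IH dpart_tensor//; congr tensor; apply/funext => j.
by rewrite /bump_index -addnA eq_sym [(_ + (i == j))%N]addnC.
Qed.

Lemma tensor_continuous u k : derivative_tower u -> continuous (tensor u k).
Proof.
move=> du; rewrite /tensor; elim: (index_enum _) => [|i s IH].
  rewrite (_ : (fun x => _) = cst 1); first exact: cst_continuous.
  by apply/funext => x; rewrite big_nil.
rewrite (_ : (fun x => _) = (fun x => u i (k i) (x 0 i) *
    \prod_(j <- s) u j (k j) (x 0 j))); last first.
  by apply/funext => x; rewrite big_cons.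
apply: continuousMf IH; apply: comp_continuous; first exact: coord_continuous.
exact: derivable_continuous (du i (k i)).
Qed.

Lemma csmooth_tensor u k : derivative_tower u -> csmooth (tensor u k).
Proof.
move=> du s; rewrite dparts_tensor//; split; first exact: tensor_continuous.
move=> i x; apply: derivable_line.
exact: (@ex_derive _ _ _ _ _ _ _ (is_derive_tensor _ i x du)).
Qed.

Lemma bDL1_tensor u k : derivative_tower u ->
  (forall i m, exists B : R, forall t : R, `|u i m t| <= B) ->
  (forall i m, \int[mu]_t `|u i m t|%:E < +oo)%E -> bDL1 (tensor u k).
Proof.
move=> du ub ui; split.
  split=> [|s]; first exact: csmooth_tensor.
  have [k' ->] : exists k', dparts s (tensor u k) = tensor u k'.
    by eexists; exact: dparts_tensor.
  rewrite /L1 (_ : (fun t => _) = (fun t : n.-tuple R =>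
      (\prod_(i < n) `|u i (k' i) (tnth t i)|)%:E)); last first.
    apply/funext => t; rewrite /tensor normr_prod; congr EFin.
    by apply: eq_bigr => i _; rewrite mxE.
  rewrite (@integral_tensor R n (fun i t => `|u i (k' i) t|)
    (fun i => fine (\int[mu]_t `|u i (k' i) t|%:E)%E)) ?ltry//.
    move=> i; apply: measurableT_comp => //; apply: continuous_measurable_fun.
    exact: derivable_continuous (du i (k' i)).
  by move=> i; rewrite fineK// ge0_fin_numE ?ui// integral_ge0.
move=> s; have [k' ->] : exists k', dparts s (tensor u k) = tensor u k'.
  by eexists; exact: dparts_tensor.
have /choice[B uB] i : exists B : R, forall t : R, `|u i (k' i) t| <= B by exact: ub.
by exists (\prod_i B i) => x; rewrite normr_prod ler_prod// => i _; rewrite uB andbT.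
Qed.

End Tensor.

Section KernelTensor.
Context {R : realType} {n : nat}.
Local Notation mu := (@lebesgue_measure R).
Local Notation E := 'rV[R]_n.
Variables (lam : nat -> R) (l0 : forall m, 0 < lam m).
Implicit Types (j : 'I_n -> nat) (i : 'I_n) (x : E).

Definition kernel_tensor j : E -> R :=
  tensor (fun i => kernel lam (j i)) (fun=> 0%N).

Lemma kernel_abs_integral m k : (\int[mu]_t `|kernel lam m k t|%:E < +oo)%E.
Proof.
have ck := kernel_continuous l0 (m := m) (k := k).
have ik : mu.-integrable `[0%R, tail_width m] (EFin \o kernel lam m k).
  apply: continuous_compact_integrable; first exact: segment_compact.
  exact: continuous_subspaceT.
have [_] := integrableP _ _ _ ik; apply: le_lt_trans.
rewrite [leRHS]integral_mkcond le_eqVlt; apply/orP; left; apply/eqP.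
apply: eq_integral => x _; rewrite patchE; case: ifPn => //.
rewrite notin_setE/= in_itv/= => /negP; rewrite negb_and -!ltNge => h.
rewrite kernel_out ?normr0//; case/orP: h => h; [by left; exact: ltW|by right].
Qed.

Lemma kernel_tower j : derivative_tower (fun i => kernel lam (j i)).
Proof. by move=> i m t; exact: is_derive_kernel. Qed.

Lemma bDL1_kernel_tensor j : bDL1 (kernel_tensor j).
Proof.
apply: bDL1_tensor => [|i m|i m]; first exact: kernel_tower.
  exact: kernel_bounded.
exact: kernel_abs_integral.
Qed.

Lemma kernel_tensor_ge0 j x : 0 <= kernel_tensor j x.
Proof. by apply: prodr_ge0 => i _; exact: kernel_ge0. Qed.

Lemma L1_kernel_tensor j : L1 (kernel_tensor j) = 1%E.
Proof.
rewrite /L1 (_ : (fun t => _) = (fun t : n.-tuple R =>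
    (\prod_(i < n) kernel lam (j i) 0 (tnth t i))%:E)).
  rewrite (@integral_tensor R n (fun i => kernel lam (j i) 0) (fun=> 1)).
  - by rewrite big1.
  - by move=> i; apply: continuous_measurable_fun; exact: kernel_continuous.
  - by move=> i x; exact: kernel_ge0.
  - by move=> i; exact: kernel_integral.
apply/funext => t; rewrite ger0_norm ?kernel_tensor_ge0//; congr EFin.
by apply: eq_bigr => i _; rewrite mxE.
Qed.

Lemma Int_kernel_tensor j : Int (kernel_tensor j) = 1.
Proof.
rewrite /Int /Rintegral -[RHS]/(fine 1%E) -(L1_kernel_tensor j) /L1.
congr fine; apply: eq_integral => t _.
by rewrite ger0_norm ?kernel_tensor_ge0.
Qed.

Lemma kernel_tensor_support j x : kernel_tensor j x != 0 ->
  forall i, 0 < x 0 i <= tail_width (j i).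
Proof.
move=> h i; have : kernel lam (j i) 0 (x 0 i) != 0.
  by apply: contra_neq h => k0; rewrite /kernel_tensor (tensor_split _ _ i) k0 mul0r.
apply: contra_neqT; rewrite negb_and -leNgt -ltNge => out.
by apply: kernel_out => //; apply/orP.
Qed.

(** kernel_recursion in the coordinate i, the other factors being common to all
terms. *)
Lemma kernel_tensor_recursion j i x :
  (1 - damping lam (j i)) *
    (kernel_tensor j x + (lam (j i))^-1 * dpart i (kernel_tensor j) x) =
  kernel_tensor (bump_index j i) x -
    damping lam (j i) *
      tr (width (j i) *: delta_mx 0 i) (kernel_tensor (bump_index j i)) x.
Proof.
rewrite /kernel_tensor (dpart_tensor _ i (kernel_tower j)).
rewrite /tr -[- (width (j i) *: _)]scaleNr tensor_line !(tensor_split _ _ i) /bump_index /= eqxx /=.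
set p := \prod_(k | _) _.
rewrite [X in _ + _ * (_ * X)](_ : _ = p); last first.
  by apply: eq_bigr => k /negbTE ki; rewrite ki.
rewrite [X in _ = _ * X - _](_ : _ = p); last first.
  by apply: eq_bigr => k /negbTE ki; rewrite ki addn0.
rewrite [X in _ = _ - _ * (_ * X)](_ : _ = p); last first.
  by apply: eq_bigr => k /negbTE ki; rewrite ki addn0.
have := kernel_recursion l0 (j i) (x 0 i); rewrite !addn1.
move: (kernel lam (j i) 0 (x 0 i)) (kernel lam (j i) 1 (x 0 i)) => a b.
move: (kernel lam _ 0 (x 0 i)) (kernel lam _ 0 (_ - _)) => c d.
move: (damping _ _) (_^-1) => e l H.
transitivity ((1 - e) * (a + l * b) * p); first by ring.
by rewrite H; ring.
Qed.

End KernelTensor.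

(** * One test function for a bounded set *)

Section Core.
Context {R : realType} {n : nat}.
Local Notation E := 'rV[R]_n.
Implicit Types (f g : E -> R) (l : seq 'I_n) (i : 'I_n) (lam : nat -> R).

(** The product of the operators 1 + d_i / lam_k over the entries of l, where k
is the number of occurrences of i further down in l: with this numbering
the entry i turns a kernel of index k in the coordinate i into one of index
k + 1. *)
Fixpoint raise lam l f : E -> R :=
  if l is i :: l' then
    raise lam l' (fun x => (lam (count_mem i l'))^-1 * dpart i f x + f x)
  else f.

Lemma raise_rDL1 lam l f : rDL1 f -> rDL1 (raise lam l f).
Proof.
elim: l f => //= i l IH f fD; apply: IH; apply: rDL1_comb => //.
exact: (rDL1_dparts [:: i] fD).
Qed.

(** The rate of an entry depends only on the number k of later occurrences of i;
this condition bounds the number of all later entries, hence the order of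
the derivatives involved, by n (k + 1). *)
Fixpoint balanced l : bool :=
  if l is i :: l' then ((size l' < n * (count_mem i l').+1)%N && balanced l') else true.

Definition rounds N : seq 'I_n := flatten (nseq N (enum 'I_n)).

Lemma count_rounds N i : count_mem i (rounds N) = N.
Proof.
elim: N => //= N IH; rewrite count_cat -/(rounds N) IH.
by rewrite count_uniq_mem ?enum_uniq// mem_enum.
Qed.

Lemma size_rounds N : size (rounds N) = (N * n)%N.
Proof. by elim: N => //= N IH; rewrite size_cat -/(rounds N) IH size_enum_ord mulSn. Qed.

Lemma balanced_rounds N : balanced (rounds N).
Proof.
elim: N => // N IH; rewrite /rounds /= -/(rounds N).
have : (size (enum 'I_n) <= n)%N by rewrite size_enum_ord.
have := enum_uniq 'I_n; elim: (enum _) => [|i s IHs] //= /andP[is_ us] sn.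
rewrite IHs ?andbT//; last exact: ltnW.
rewrite count_cat count_rounds (count_memPn is_) add0n size_cat size_rounds.
by rewrite mulnS [(N * n)%N]mulnC ltn_add2r.
Qed.

Variable C : nat -> R.

Definition majorant m : R := \sum_(p < m.+1) `|C p|.
(** Large enough that dividing the L^1 norm of a derivative of order at most
n (k + 1) by it leaves at most 2^-(n (k + 1)). *)
Definition rate k : R := 2 ^+ (n * k.+1) * (majorant (n * k.+1) + 1).

Lemma majorant_ge0 m : 0 <= majorant m. Proof. exact: sumr_ge0. Qed.

Lemma majorant_ge m : C m <= majorant m.
Proof.
rewrite /majorant big_ord_recr/= (le_trans (ler_norm _))// lerDr.
exact: sumr_ge0.
Qed.

Lemma majorant_mono m p : (m <= p)%N -> majorant m <= majorant p.
Proof.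
move=> /subnKC <-; elim: (p - m)%N => [|q IH]; first by rewrite addn0.
by rewrite addnS (le_trans IH)// /majorant [leRHS]big_ord_recr lerDl.
Qed.

Lemma rate_gt0 k : 0 < rate k.
Proof. by rewrite mulr_gt0 ?exprn_gt0// ltr_wpDl// majorant_ge0. Qed.

(** Applying 1 + d_i / lambda increases the bounds by a term at most
2^-(size l), by the choice of the rates; d is the accumulated increase, and
the sum of all of them is at most 1. *)
Lemma raise_L1 l f (d : R) : balanced l -> rDL1 f -> 0 <= d <= 2^-1 ^+ size l ->
  (forall s, (size s <= size l)%N -> (L1 (dparts s f) <= (majorant (size s) + d)%:E)%E) ->
  (L1 (raise rate l f) <= (majorant 0 + 1)%:E)%E.
Proof.
elim: l f d => [|i l IH] f d /=.
  move=> _ _ /andP[_ d1] /(_ [::] (leqnn _)) /= /le_trans; apply.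
  by rewrite lee_fin lerD2l (le_trans d1)// expr0.
move=> /andP[li bl] fD /andP[d0 dl] fC.
have fD' := rDL1_dparts [:: i] fD.
set r := rate _.
have r0 : 0 < r by exact: rate_gt0.
have d1 : d <= 1 by rewrite (le_trans dl)// exprn_ile1// invf_le1// ler1n.
apply: (IH _ (d + 2^-1 ^+ (size l).+1)) => //.
- exact: rDL1_comb.
- rewrite addr_ge0 ?exprn_ge0//=.
  apply: le_trans (lerD dl (lexx _)) _.
  by rewrite exprS; move: (_ ^+ size l) => w; have := splitr w; rewrite mulrC; lra.
move=> s sl.
have sf := fD.1; have sf' := fD'.1.
rewrite (dpartsD s (csmoothZ r^-1 sf') sf) (dpartsZ s r^-1 sf').
have := L1D (continuousZf (c := r^-1) (sf' s).1) (sf s).1; move=> H; apply: (le_trans H).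
have rV0 : 0 <= r^-1 by rewrite invr_ge0 ltW.
rewrite (L1Z r^-1 (sf' s).1) (ger0_norm rV0).
have h1 : (L1 (dparts s (dparts [:: i] f)) <= (majorant (size l).+1 + 1)%:E)%E.
  rewrite -[dparts [:: i] f]/(dpart i f) -(dpart_dparts _ _ sf).
  apply: le_trans (fC (i :: s) _) _ => //.
  by rewrite lee_fin lerD// majorant_mono.
have h2 : (L1 (dparts s f) <= (majorant (size s) + d)%:E)%E by apply: fC; exact: leqW.
have h3 : ((r^-1)%:E * L1 (dparts s (dparts [:: i] f)) <=
    (r^-1)%:E * (majorant (size l).+1 + 1)%:E)%E.
  by exact: lee_wpmul2l.
apply: (le_trans (leeD h3 h2)).
rewrite -EFinM -EFinD lee_fin [leLHS]addrC addrA lerD2l.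
rewrite ler_pdivrMl// -ler_pdivrMr ?exprn_gt0 ?invr_gt0// exprVn invrK mulrC.
rewrite /r /rate ler_pM ?exprn_ge0 ?addr_ge0 ?majorant_ge0//.
  by rewrite ler_weXn2l ?ler1n.
by rewrite lerD2r majorant_mono.
Qed.

(** The order is the point: phi and K0 depend on the bounds C only, and then the
conclusion holds for all functionals T, whatever their order M and constant
K.  The iterated kernel of index 0 is phi; raise_L1 controls the
differential operators that pair_step moves to f, and T f is recovered as the
kernels concentrate at 0. *)
Lemma factor_bound : exists phi : E -> R,
  [/\ csmooth phi, compact (closure [set x | phi x != 0]) &
   exists2 K0 : R, 0 <= K0 & forall (T : (E -> R) -> R) (M : nat) (K : R),
     (forall (c : R) f g, rDL1 f -> rDL1 g ->
        T (fun x => c * f x + g x) = c * T f + T g) ->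
     (forall f (e : R), rDL1 f -> 0 <= e ->
        (forall s, (size s <= M)%N -> (L1 (dparts s f) <= e%:E)%E) ->
        `|T f| <= K * e) ->
     forall c : R, (forall y, `|T (tr y phi)| <= c) ->
     forall f, rDL1 f -> (forall s, L1 (dparts s f) <= (C (size s))%:E)%E ->
     `|T f| <= c * K0].
Proof.
pose P (j : 'I_n -> nat) := kernel_tensor rate j.
pose cnt l := fun i : 'I_n => count_mem i l.
have bP j : bDL1 (P j) by exact: (bDL1_kernel_tensor rate_gt0).
exists (P (cnt [::])); split.
- exact: (bP _).1.1.
- pose box := [set x : E | forall i, (`[0, 1]%classic : set R) (x ord0 i)].
  have cbox : compact box.
    by apply: (@rV_compact R n (fun=> `[0, 1]%classic)) => i; exact: segment_compact.
  apply: (subclosed_compact _ cbox); first exact: closed_closure.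
  have clbox : closed box by apply: compact_closed => //; exact: norm_hausdorff.
  have -> : box = closure box by apply/closure_id.
  apply: closureS => x /= Px i.
  have := kernel_tensor_support rate_gt0 Px i; rewrite /cnt/= /tail_width expr0 => /andP[x0 x1].
  by rewrite in_itv/= (ltW x0).
exists (majorant 0 + 1); first by rewrite addr_ge0// majorant_ge0.
move=> T M K T_lin T_bnd c Tc f fD fC.
pose pair u g := Int (fun y => u y * orbit T g y).
have c0 : 0 <= c by rewrite (le_trans _ (Tc 0)).
(* at the index 0, exchange the factors and use the bound on the orbit of phi *)
have base g : rDL1 g -> (L1 g <= (majorant 0 + 1)%:E)%E ->
    forall y, `|pair (P (cnt [::])) (tr y g)| <= c * (majorant 0 + 1).
  move=> gD gL y; have gyD := rDL1_tr y gD.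
  rewrite /pair (pair_swap T_lin T_bnd (bP _) gyD).
  have := pair_le T_lin T_bnd gyD (bP _).1 Tc.
  rewrite (L1_tr _ (rDL1_cont gD)) => h; rewrite -lee_fin; apply: le_trans h _.
  by rewrite EFinM; apply: lee_wpmul2l; rewrite ?lee_fin.
(* the indices of the kernels go up one at a time by pair_step *)
have chain l g d : rDL1 g -> (forall y, `|pair (P (cnt [::])) (tr y (raise rate l g))| <= d) ->
    forall y, `|pair (P (cnt l)) (tr y g)| <= d.
  elim: l g => //= i l IH g gD gd.
  apply: (pair_step T_lin T_bnd (bP (cnt l)) (bP (cnt (i :: l))) gD
    (i := i) (lam := (rate (cnt l i))^-1) (e := damping rate (cnt l i))
    (a := width (cnt l i))).
  - by rewrite damping_ge0 (damping_lt1 rate_gt0).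
  - move=> x; have -> : cnt (i :: l) = bump_index (cnt l) i.
      by apply/funext => k; rewrite /cnt /bump_index /= addnC eq_sym.
    exact: (kernel_tensor_recursion rate_gt0).
  - apply: IH; last exact: gd.
    by apply: rDL1_comb => //; exact: (rDL1_dparts [:: i] gD).
have bound N : `|pair (P (cnt (rounds N))) f| <= c * (majorant 0 + 1).
  have fr := raise_rDL1 rate (rounds N) fD.
  have Lr : (L1 (raise rate (rounds N) f) <= (majorant 0 + 1)%:E)%E.
    apply: (raise_L1 (d := 0)) => //; first exact: balanced_rounds.
      by rewrite lexx exprn_ge0.
    move=> s _; apply: le_trans (fC s) _.
    by rewrite lee_fin addr0 majorant_ge.
  have := chain _ _ _ fD (base _ fr Lr) 0; congr (`|pair _ _| <= _).
  by apply/funext => x; rewrite /tr subr0.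
apply/ler_addgt0Pr => e e0.
have co := orbit_continuous T_lin T_bnd fD.
have T0 : T f = orbit T f 0 by rewrite /orbit; congr T; apply/funext => x; rewrite /tr subr0.
have /cvgrPdist_le/(_ _ e0)/nbhs_normP[d /= d0 near0] := co 0.
(* the kernel of index N lives in a cube of side 2^-N, on which the orbit of f
   varies by at most e *)
have [N _ HN] := near_infty_natSinv_expn_lt (PosNum d0).
have /= Nd := HN N (leqnn N).
pose Q := P (cnt (rounds N)); have QD := (bP (cnt (rounds N))).1.
have cQ := rDL1_cont QD.
have small : `|T f - pair Q f| <= e.
  have IQ := rDL1_integ QD.
  have -> : T f - pair Q f = Int (fun y => T f * Q y - Q y * orbit T f y).
    rewrite (IntB (integZ (T f) IQ) (pair_integ T_lin T_bnd QD fD)) (IntZ _ IQ).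
    by rewrite (Int_kernel_tensor rate_gt0) mulr1.
  have cd : continuous (fun y => T f * Q y - Q y * orbit T f y).
    exact: (continuousBf (continuousZf (c := T f) cQ) (continuousMf cQ co)).
  rewrite -lee_fin; apply: le_trans (Int_le cd) _.
  have -> : e%:E = L1 (fun y => e * Q y).
    by rewrite (L1Z e cQ) (L1_kernel_tensor rate_gt0) mule1 gtr0_norm.
  apply: L1_le => //; first exact: continuousZf.
  move=> y; rewrite [X in X - _]mulrC -mulrBr normrM normrM mulrC.
  have [->|Qy] := eqVneq (Q y) 0; first by rewrite normr0 !mulr0.
  apply: ler_wpM2r => //; rewrite (gtr0_norm e0) T0; apply: near0 => /=.
  rewrite sub0r normrN [ltLHS]mx_normrE; apply: le_lt_trans Nd.
  apply/bigmax_leP; split; first by rewrite divr_ge0 ?exprn_ge0.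
  move=> [a b] _ /=; rewrite ord1.
  have := kernel_tensor_support rate_gt0 Qy b; rewrite /cnt count_rounds => /andP[y0 y1].
  by rewrite gtr0_norm// (le_trans y1)// /tail_width exprVn div1r.
rewrite -(subrK (pair Q f) (T f)); apply: le_trans (ler_normD _ _) _.
rewrite [leLHS]addrC; apply: lerD; [exact: bound|exact: small].
Qed.

End Core.

(** * Real and imaginary parts *)

Section ComplexReal.
Context {R : realType} {n : nat}.
Local Notation E := 'rV[R]_n.
Local Notation fct := (E -> Cplx R).
Local Notation leb := (@lebesgue_tuple R n).
Local Notation row := (@row_of_tuple R n).
Implicit Types (f g : fct) (h : E -> R) (s : seq 'I_n) (x y : E).

Definition re_part f : E -> R := fun x => complex.Re (f x).
Definition im_part f : E -> R := fun x => complex.Im (f x).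
Definition real_fct h : fct := fun x => (h x)%:C%C.

Lemma re_partials s f : re_part (partials s f) = dparts s (re_part f).
Proof.
elim: s => //= i s IH; apply/funext => x.
by rewrite dpartE -IH.
Qed.

Lemma im_partials s f : im_part (partials s f) = dparts s (im_part f).
Proof.
elim: s => //= i s IH; apply/funext => x.
by rewrite dpartE -IH.
Qed.

Lemma normcE (z : R[i]) : `|z| = (normc z)%:C%C.
Proof. by []. Qed.

Lemma normc_Re (z : R[i]) : `|complex.Re z| <= normc z.
Proof.
case: z => a b /=; rewrite -sqrtr_sqr ler_sqrt ?addr_ge0 ?sqr_ge0//.
by rewrite lerDl sqr_ge0.
Qed.

Lemma normc_Im (z : R[i]) : `|complex.Im z| <= normc z.
Proof.
case: z => a b /=; rewrite -sqrtr_sqr ler_sqrt ?addr_ge0 ?sqr_ge0//.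
by rewrite lerDr sqr_ge0.
Qed.

Lemma normc_le (z : R[i]) : normc z <= `|complex.Re z| + `|complex.Im z|.
Proof.
case: z => a b /=; rewrite -[leRHS]ger0_norm ?addr_ge0// -sqrtr_sqr ler_sqrt ?sqr_ge0//.
rewrite sqrrD !real_normK ?num_real// addrAC lerDl.
by rewrite mulrn_wge0// mulr_ge0.
Qed.

Lemma continuous_parts f : continuous f <->
  continuous (re_part f) /\ continuous (im_part f).
Proof.
split=> [cf|[cr ci]].
  split=> x; apply/(@cvgrPdist_lt _ _ _ (nbhs x)) => e e0.
    have e0' : 0 < e%:C%C :> R[i] by rewrite ltcR.
    have /cvgrPdist_lt/(_ _ e0') := cf x; apply: filterS => y.
    rewrite normcE ltcR; apply: le_lt_trans.
    by rewrite /re_part -raddfB; exact: normc_Re.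
  have e0' : 0 < e%:C%C :> R[i] by rewrite ltcR.
  have /cvgrPdist_lt/(_ _ e0') := cf x; apply: filterS => y.
  rewrite normcE ltcR; apply: le_lt_trans.
  by rewrite /im_part -raddfB; exact: normc_Im.
move=> x; apply/(@cvgrPdist_lt _ _ _ (nbhs x)) => -[e e'] e0.
move: e0; rewrite ltcE/= => /andP[/eqP -> e0].
have e20 : 0 < e / 2 by rewrite divr_gt0.
have /cvgrPdist_lt/(_ _ e20) h1 := cr x.
have /cvgrPdist_lt/(_ _ e20) h2 := ci x.
apply: filterS2 h1 h2 => y h1 h2.
rewrite normcE ltcR; apply: le_lt_trans (normc_le _) _.
by rewrite (splitr e) ltrD// raddfB.
Qed.

Lemma smooth_parts f : smooth f <-> csmooth (re_part f) /\ csmooth (im_part f).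
Proof.
split=> [sf|[sr si]].
  split=> s; have [/continuous_parts[c1 c2] d] := sf s.
    rewrite -re_partials; split=> // i x; exact: (d i x).1.
  rewrite -im_partials; split=> // i x; exact: (d i x).2.
move=> s; split.
  by apply/continuous_parts; rewrite re_partials im_partials; split; [exact: (sr s).1|exact: (si s).1].
move=> i x; have := (sr s).2 i x; have := (si s).2 i x.
by rewrite -re_partials -im_partials.
Qed.

Lemma continuous_normc f : continuous f -> continuous (fun x => normc (f x)).
Proof.
move=> cf x; apply/(@cvgrPdist_lt _ _ _ (nbhs x)) => e e0.
have e0' : 0 < e%:C%C :> R[i] by rewrite ltcR.
have /cvgrPdist_lt/(_ _ e0') := cf x; apply: filterS => y.
rewrite normcE ltcR; apply: le_lt_trans.
have := @ler_dist_dist R[i] R[i] (f x) (f y).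
by rewrite !normcE -rmorphB/= lecR /= expr0n/= addr0 sqrtr_sqr.
Qed.

Lemma L1norm_L1 f : L1norm f = L1 (fun x => normc (f x)).
Proof.
apply: eq_integral => t _; rewrite ger0_norm//.
by have := normr_ge0 (f (row t)); rewrite normcE lecR.
Qed.

Lemma L1_re_le f : continuous f -> (L1 (re_part f) <= L1norm f)%E.
Proof.
move=> cf; rewrite L1norm_L1; have /continuous_parts[c1 c2] := cf.
apply: L1_le => // [|x]; first exact: continuous_normc.
by rewrite (le_trans (normc_Re _))// ler_norm.
Qed.

Lemma L1_im_le f : continuous f -> (L1 (im_part f) <= L1norm f)%E.
Proof.
move=> cf; rewrite L1norm_L1; have /continuous_parts[c1 c2] := cf.
apply: L1_le => // [|x]; first exact: continuous_normc.
by rewrite (le_trans (normc_Im _))// ler_norm.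
Qed.

Lemma L1norm_le f : continuous f -> (L1norm f <= L1 (re_part f) + L1 (im_part f))%E.
Proof.
move=> cf; rewrite L1norm_L1; have /continuous_parts[c1 c2] := cf.
have m1 := measurable_cont_row_norm c1; have m2 := measurable_cont_row_norm c2.
rewrite -(ge0_integralD _ measurableT)//.
apply: (ge0_le_integral _ measurableT) => [t _|||t _].
- by rewrite lee_fin.
- exact: measurable_cont_row_norm (continuous_normc cf).
- exact: emeasurable_funD.
- rewrite -EFinD lee_fin ger0_norm; first exact: normc_le.
  by have := normr_ge0 (f (row t)); rewrite normcE lecR.
Qed.

Lemma count_multi_index (a : 'I_n -> nat) i : count_mem i (multi_index_seq a) = a i.
Proof.
rewrite /multi_index_seq count_flatten -map_comp sumnE big_map.
rewrite big_enum/= (bigD1 i)//= big1 ?addn0.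
  by rewrite count_nseq /= eqxx mul1n.
by move=> j ji; rewrite count_nseq /= (negbTE ji).
Qed.

Lemma perm_multi_index s : perm_eq s (multi_index_seq (fun i => count_mem i s)).
Proof. by apply/allP => i _ /=; rewrite count_multi_index. Qed.

Lemma size_multi_index (a : 'I_n -> nat) : size (multi_index_seq a) = (\sum_i a i)%N.
Proof.
rewrite /multi_index_seq size_flatten /shape -map_comp sumnE big_map big_enum/=.
by apply: eq_bigr => i _; rewrite size_nseq.
Qed.

Lemma DL1_rDL1 f : f \in @DL1_pred R n ->
  rDL1 (re_part f) /\ rDL1 (im_part f).
Proof.
move=> /asboolP[sf If]; have /smooth_parts[sr si] := sf.
have L s : integ (dparts s (re_part f)) /\ integ (dparts s (im_part f)).
  have ps := perm_multi_index s.
  rewrite (dparts_perm sr ps) (dparts_perm si ps) -re_partials -im_partials.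
  exact: If.
by split; split=> // s; apply/integP; [exact: (sr s).1|exact: (L s).1|exact: (si s).1|exact: (L s).2].
Qed.

Lemma rDL1_DL1 f : rDL1 (re_part f) -> rDL1 (im_part f) -> f \in @DL1_pred R n.
Proof.
move=> [sr Lr] [si Li]; apply/asboolP; split; first exact/smooth_parts.
move=> a; split.
  rewrite -[X in _.-integrable _ X]/(fun t => (re_part (mpartial a f) (row t))%:E).
  by rewrite re_partials; apply/integP; [exact: (sr _).1|exact: Lr].
rewrite -[X in _.-integrable _ X]/(fun t => (im_part (mpartial a f) (row t))%:E).
by rewrite im_partials; apply/integP; [exact: (si _).1|exact: Li].
Qed.

Lemma re_real_fct h : re_part (real_fct h) = h. Proof. by []. Qed.
Lemma im_real_fct h : im_part (real_fct h) = (fun=> 0). Proof. by []. Qed.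

Lemma real_fct_DL1 h : rDL1 h -> real_fct h \in @DL1_pred R n.
Proof. by move=> hD; apply: rDL1_DL1 => //; exact: rDL1_0. Qed.

Definition refl x h : E -> R := fun y => h (x - y).

Lemma dpart_refl x h i : csmooth h -> dpart i (refl x h) = (fun y => -1 * refl x (dpart i h) y).
Proof.
move=> sh; apply/funext => y; rewrite dpartE -derive_line mulN1r.
have := csmooth_derivable_along i sh (x - y) (- 0).
set e := delta_mx 0 i => dh.
have dN : is_derive (0 : R) (1 : R) (-%R : R -> R) (-1) by exact: is_deriveNid.
have := is_derive1_comp dh dN; rewrite (_ : _ \o _ = fun t : R => refl x h (y + t *: e)).
  move=> d; rewrite (@derive_val _ _ _ _ _ _ _ d) mulrN1 oppr0 scale0r addr0//.
by apply/funext => t; rewrite /refl /= scaleNr opprD addrA.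
Qed.

Lemma derivable_refl x h i y : csmooth h -> derivable (refl x h) y (delta_mx 0 i).
Proof.
move=> sh; apply: derivable_line.
have := csmooth_derivable_along i sh (x - y) (- 0).
set e := delta_mx 0 i => dh.
have dN : is_derive (0 : R) (1 : R) (-%R : R -> R) (-1) by exact: is_deriveNid.
have := is_derive1_comp dh dN; rewrite (_ : _ \o _ = fun t : R => refl x h (y + t *: e)).
  by move=> d; exact: (@ex_derive _ _ _ _ _ _ _ d).
by apply/funext => t; rewrite /refl /= scaleNr opprD addrA.
Qed.

Lemma dparts_refl x h s : csmooth h ->
  dparts s (refl x h) = (fun y => (-1) ^+ size s * refl x (dparts s h) y).
Proof.
move=> sh; elim: s => [|i s IH] /=; first by apply/funext => y; rewrite mul1r.
rewrite IH; apply/funext => y; rewrite dpartE.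
have d := @derivable_refl x _ i y (csmooth_dparts s sh).
rewrite (deriveZ _ d) -dpartE dpart_refl; last exact: csmooth_dparts.
by rewrite /GRing.scale /= exprSr mulrA.
Qed.

Lemma csmooth_refl x h : csmooth h -> csmooth (refl x h).
Proof.
move=> sh s; rewrite dparts_refl//; split.
  apply: continuousZf; apply: reflect_continuous; exact: (sh s).1.
by move=> i y; apply: derivableZ; apply: derivable_refl; exact: csmooth_dparts.
Qed.

(** Derivatives of a reflection only change sign. *)
Lemma L1_dparts_refl x h s : csmooth h ->
  L1 (dparts s (refl x h)) = L1 (dparts s h).
Proof.
move=> sh; rewrite dparts_refl//; have cs := (sh s).1.
rewrite L1Z; last exact: reflect_continuous.
rewrite normrX normrN1 expr1n mul1e -(L1_affine (s := -1) x cs) ?normrN1//.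
by congr L1; apply/funext => y; rewrite scaleN1r.
Qed.

Lemma rDL1_refl x h : rDL1 h -> rDL1 (refl x h).
Proof.
by move=> [sh Lh]; split=> [|s]; [exact: csmooth_refl|rewrite L1_dparts_refl].
Qed.

End ComplexReal.

(** * Schwartz functions have integrable derivatives *)

Section Schwartz.
Context {R : realType} {n : nat}.
Local Notation mu := (@lebesgue_measure R).
Local Notation E := 'rV[R]_n.
Local Notation fct := (E -> Cplx R).
Local Notation row := (@row_of_tuple R n).
Implicit Types (f g : fct) (h : E -> R) (s : seq 'I_n) (x y : E).

(** An integrable function, multiples of which dominate the Schwartz functions
and their derivatives. *)
Definition weight x : R := \prod_(i < n) (1 + x 0 i ^+ 2)^-1.

Lemma weight_gt0 x : 0 < weight x.
Proof. by apply: prodr_gt0 => i _; rewrite invr_gt0 ltr_pwDl// sqr_ge0. Qed.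

Lemma weight_continuous : continuous weight.
Proof.
rewrite /weight; elim: (index_enum _) => [|i s IH].
  rewrite (_ : (fun x => _) = cst 1); first exact: cst_continuous.
  by apply/funext => x; rewrite big_nil.
rewrite (_ : (fun x => _) = (fun x => (1 + x 0 i ^+ 2)^-1 *
    \prod_(j <- s) (1 + x 0 j ^+ 2)^-1)); last first.
  by apply/funext => x; rewrite big_cons.
apply: continuousMf IH.
apply: (comp_continuous (k := fun t : R => (1 + t ^+ 2)^-1)).
  exact: coord_continuous.
exact: continuous_oneDsqrV.
Qed.

Lemma weight_L1 : (L1 weight < +oo)%E.
Proof.
rewrite /L1 (_ : (fun t => _) = (fun t : n.-tuple R =>
    (\prod_(i < n) (1 + tnth t i ^+ 2)^-1)%:E)); last first.
  apply/funext => t; rewrite ger0_norm ?ltW ?weight_gt0//; congr EFin.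
  by apply: eq_bigr => i _; rewrite mxE.
have c1 : continuous (fun t : R => (1 + t ^+ 2)^-1) by exact: continuous_oneDsqrV.
have t0 (t : R) : 0 <= (1 + t ^+ 2)^-1 by rewrite invr_ge0 addr_ge0// sqr_ge0.
have Ifin : (\int[mu]_t ((1 + t ^+ 2)^-1)%:E < +oo :> \bar R)%E.
  have := @ge0_symfun_integralT R (fun t => (1 + t ^+ 2)^-1) t0 c1.
  rewrite /= => ->; last by move=> t /=; rewrite sqrrN.
  by rewrite -set_itvcy integral0y_oneDsqr lte_mul_pinfty// ltry.
rewrite (@integral_tensor R n (fun=> fun t => (1 + t ^+ 2)^-1)
  (fun=> fine (\int[mu]_t ((1 + t ^+ 2)^-1)%:E)%E)) ?ltry//.
  by move=> i; apply: continuous_measurable_fun.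
by move=> i; rewrite fineK// ge0_fin_numE// integral_ge0// => t _; rewrite lee_fin.
Qed.

Lemma partials_mpartial s f : smooth f ->
  partials s f = mpartial (fun i => count_mem i s) f.
Proof.
move=> /smooth_parts[sr si]; pose a i := count_mem i s.
apply/funext => x; rewrite /mpartial.
have e1 : re_part (partials s f) = re_part (partials (multi_index_seq a) f).
  by rewrite !re_partials; apply: dparts_perm => //; exact: perm_multi_index.
have e2 : im_part (partials s f) = im_part (partials (multi_index_seq a) f).
  by rewrite !im_partials; apply: dparts_perm => //; exact: perm_multi_index.
apply/eqP; rewrite eq_complex; apply/andP; split; apply/eqP.
  exact: (congr1 (fun g : E -> R => g x) e1).
exact: (congr1 (fun g : E -> R => g x) e2).
Qed.

(** For each i, 1 + x_i ^ 2 is at most 2 if |x_i| < 1 and at most 2 x_i ^ 2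
otherwise; the 2^n choices of exponents 0 or 2 cover all cases. *)
Lemma schwartz_weight f (a : 'I_n -> nat) : @schwartz R n f ->
  exists C : R, forall x, normc (mpartial a f x) <= C * weight x.
Proof.
move=> [_ fS].
have /choice[M HM] : forall b : {ffun 'I_n -> bool}, exists M : R, forall x,
    (\prod_(i < n) `|x 0 i| ^+ (b i).*2) * normc (mpartial a f x) <= M.
  by move=> b; have [M HM] := fS a (fun i => (b i).*2); exists M.
have nc0 x : 0 <= normc (mpartial a f x).
  by have := normr_ge0 (mpartial a f x); rewrite normcE lecR.
exists (2 ^+ n * \sum_b `|M b|) => x.
pose b : {ffun 'I_n -> bool} := [ffun i => 1 <= `|x 0 i|].
have wV : (weight x)^-1 = \prod_(i < n) (1 + x 0 i ^+ 2).
  by rewrite /weight -prodfV; apply: eq_bigr => i _; rewrite invrK.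
rewrite -ler_pdivrMr ?weight_gt0// wV.
have h1 : \prod_(i < n) (1 + x 0 i ^+ 2) <= 2 ^+ n * \prod_(i < n) `|x 0 i| ^+ (b i).*2.
  rewrite -[X in 2 ^+ X]card_ord -prodr_const -big_split/=.
  apply: ler_prod => i _; rewrite addr_ge0 ?sqr_ge0//= ffunE.
  rewrite -[x 0 i ^+ 2]real_normK ?num_real//.
  have := normr_ge0 (x 0 i); move: `|x 0 i| => r r0.
  have [r1|r1] := leP 1 r; rewrite /= ?expr0; nra.
apply: le_trans (ler_wpM2l (nc0 x) h1) _.
rewrite mulrCA ler_wpM2l ?exprn_ge0// mulrC (le_trans (HM b x))//.
rewrite (le_trans (ler_norm _))// (bigD1 b)//= lerDl.
exact: sumr_ge0.
Qed.

Lemma schwartz_rDL1 f : @schwartz R n f -> rDL1 (re_part f) /\ rDL1 (im_part f).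
Proof.
move=> fS; have sf := fS.1; have /smooth_parts[sr si] := sf.
have L s : (L1norm (partials s f) < +oo)%E.
  have E := partials_mpartial s sf; set a := fun i => _ in E.
  have [C HC] := schwartz_weight a fS.
  rewrite E L1norm_L1; apply: (@le_lt_trans _ _ (L1 (fun x => C * weight x))).
    apply: L1_le.
    - by apply: continuous_normc; rewrite -E; exact: (sf s).1.
    - by apply: continuousZf; exact: weight_continuous.
    - move=> x; rewrite ger0_norm; first by rewrite (le_trans (HC x))// ler_norm.
      by have := normr_ge0 (mpartial a f x); rewrite normcE lecR.
  rewrite L1Z; last exact: weight_continuous.
  by rewrite lte_mul_pinfty// weight_L1.
split; split=> // s.
  by rewrite -re_partials (le_lt_trans (L1_re_le (sf s).1)).
by rewrite -im_partials (le_lt_trans (L1_im_le (sf s).1)).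
Qed.

Lemma partials_out f s x : ~ fsupport f x -> partials s f x = 0.
Proof.
elim: s x => [|i s IH] x fx.
  apply: contrapT => h; apply: fx; apply: subset_closure.
  by apply/eqP.
have ox : \forall y \near x, ~ fsupport f y.
  apply: open_nbhs_nbhs; split => //.
  exact/closed_openC/closed_closure.
rewrite /= /partial.
have z (g : R[i] -> R) : g 0 = 0 -> 'D_(delta_mx 0 i) (fun y => g (partials s f y)) x = 0.
  move=> g0; rewrite (@near_eq_derive _ _ _ _ (cst 0)) ?derive_cst//.
  by apply: filterS ox => y /IH ->.
by rewrite !z.
Qed.

Lemma test_function_schwartz f : @test_function R n f -> @schwartz R n f.
Proof.
move=> [sf cf]; split=> // a b.
pose G x := (\prod_(i < n) `|x 0 i| ^+ b i) * normc (mpartial a f x).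
have cG : continuous G.
  apply: continuousMf; last by apply: continuous_normc; exact: (sf _).1.
  elim: (index_enum _) => [|i s IH].
    rewrite (_ : (fun x => _) = cst 1); first exact: cst_continuous.
    by apply/funext => x; rewrite big_nil.
  rewrite (_ : (fun x => _) = (fun x => `|x 0 i| ^+ b i *
      \prod_(j <- s) `|x 0 j| ^+ b j)); last first.
    by apply/funext => x; rewrite big_cons.
  apply: continuousMf IH.
  apply: (comp_continuous (k := fun t : R => `|t| ^+ b i)).
    exact: coord_continuous.
  apply: (comp_continuous (k := fun t : R => t ^+ b i)); first exact: norm_continuous.
  exact: exprn_continuous.
have /compact_bounded[M [_ HM]] := continuous_compact (continuous_subspaceT cG) cf.
exists (`|M| + 1) => x.
have [fx|fx] := pselect (fsupport f x); last first.
  rewrite /mpartial (partials_out _ fx) (_ : normc 0 = 0) ?mulr0 ?addr_ge0//.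
  exact: ComplexField.Normc.normc0.
apply: le_trans (ler_norm _) _; apply: (HM (`|M| + 1)).
  by rewrite (le_lt_trans (ler_norm M))// ltrDl.
by exists x.
Qed.

End Schwartz.

(** * Bounded sets of D_{L^1} *)

Section DL1Topology.
Context {R : realType} {n : nat}.
Local Notation V := 'rV[R]_n.
Local Notation fct := (V -> Cplx R).
Local Notation E := (DL1 R n).
Implicit Types (f g : E) (h k : V -> R) (s : seq 'I_n) (B U : set E).

Lemma openDL1E U :
  open U = seminorm_open setT (range (@DL1_seminorm R n)) U.
Proof. by []. Qed.

Lemma openDLooE (W : set (DLoo' R n)) : open W =
  seminorm_open setT [set strong_seminorm B | B in @von_neumann_bounded R[i] E] W.
Proof. by []. Qed.

Lemma DL1P f : (f : fct) \in @DL1_pred R n.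
Proof. by case: f. Qed.

Lemma DL1_smooth f : smooth (f : fct).
Proof. by have /asboolP[] := DL1P f. Qed.

Lemma DL1_lin (c : R[i]) f g : (c *: f + g : E) = c *: (f : fct) + (g : fct) :> fct.
Proof. by []. Qed.

Lemma DL1_seminorm_ge0 m f : (0 <= DL1_seminorm m f)%E.
Proof.
apply: (@le_trans _ _ (L1norm (mpartial (fun=> 0%N) (f : fct)))).
  by rewrite L1norm_L1; exact: L1_ge0.
by apply: ereal_sup_ubound; exists (fun=> 0%N) => //=; rewrite big1.
Qed.

Lemma normc_ge0 (z : R[i]) : 0 <= normc z.
Proof. by have := normr_ge0 z; rewrite normcE lecR. Qed.

Lemma normcD (z w : R[i]) : normc (z + w) <= normc z + normc w.
Proof. by have := ler_normD z w; rewrite !normcE -rmorphD lecR. Qed.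

Lemma normcM (z w : R[i]) : normc (z * w) = normc z * normc w.
Proof. exact: ComplexField.Normc.normcM. Qed.

Lemma normc_real (r : R) : normc r%:C%C = `|r|.
Proof. by rewrite /= expr0n/= addr0 sqrtr_sqr. Qed.

Lemma DL1_seminorm_lin m (c : R[i]) f g :
  (DL1_seminorm m (c *: f + g)%R <= (normc c)%:E * DL1_seminorm m f + DL1_seminorm m g)%E.
Proof.
apply: ge_ereal_sup => _ [a am <-].
have sf := DL1_smooth f; have sg := DL1_smooth g.
rewrite DL1_lin /mpartial (partials_lin c _ sf sg).
set p := partials _ (f : fct); set q := partials _ (g : fct).
have cp : continuous p by exact: (sf _).1.
have cq : continuous q by exact: (sg _).1.
have pm : (L1norm p <= DL1_seminorm m f)%E by apply: ereal_sup_ubound; exists a.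
have qm : (L1norm q <= DL1_seminorm m g)%E by apply: ereal_sup_ubound; exists a.
move: p q cp cq pm qm => p q cp cq pm qm.
have cpq : continuous (c *: p + q) := continuous_lin (c := c) cp cq.
apply: (@le_trans _ _ ((normc c)%:E * L1norm p + L1norm q)%E).
  rewrite !L1norm_L1.
  have cnp := continuous_normc cp; have cnq := continuous_normc cq.
  have h1 := L1D (continuousZf (c := normc c) cnp) cnq.
  rewrite (L1Z (normc c) cnp) (ger0_norm (normc_ge0 c)) in h1.
  apply: le_trans h1; apply: L1_le.
  - exact: continuous_normc cpq.
  - exact: continuousDf (continuousZf (c := normc c) cnp) cnq.
  - move=> x; rewrite ger0_norm ?normc_ge0// ger0_norm; last first.
      by rewrite addr_ge0 ?mulr_ge0 ?normc_ge0.
    by rewrite -normcM; exact: normcD.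
by apply: leeD qm; apply: lee_wpmul2l pm; rewrite lee_fin normc_ge0.
Qed.

Lemma DL1_seminorm0 m : DL1_seminorm m (0 : E) = 0%E.
Proof.
apply/eqP; rewrite eq_le DL1_seminorm_ge0 andbT.
apply: ge_ereal_sup => _ [a am <-].
rewrite (_ : (0 : E) = 0 :> fct)// /mpartial partials0 L1norm_L1.
rewrite (_ : (fun x => _) = fun=> 0); last first.
  by apply/funext => x; exact: ComplexField.Normc.normc0.
by rewrite /L1 normr0 integral0.
Qed.

Lemma DL1_seminormD m f g :
  (DL1_seminorm m (f + g)%R <= DL1_seminorm m f + DL1_seminorm m g)%E.
Proof.
have := DL1_seminorm_lin m 1 f g; rewrite scale1r => /le_trans; apply.
by rewrite -[X in normc X]/(1%:C%C) normc_real normr1 mul1e.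
Qed.

Lemma DL1_seminormZ m (c : R[i]) f :
  (DL1_seminorm m (c *: f)%R <= (normc c)%:E * DL1_seminorm m f)%E.
Proof.
by have := DL1_seminorm_lin m c f 0; rewrite addr0 DL1_seminorm0 adde0.
Qed.

Lemma DL1_seminorm_mono m p f : (m <= p)%N -> (DL1_seminorm m f <= DL1_seminorm p f)%E.
Proof.
move=> mp; apply: ereal_sup_le => _ [a am <-]; exists a => //=.
exact: leq_trans am mp.
Qed.

Lemma DL1_seminorm_open m (e : R) : open [set f : E | (DL1_seminorm m f < e%:E)%E].
Proof.
rewrite openDL1E; split=> // f fe.
have ffin : DL1_seminorm m f \is a fin_num.
  by rewrite ge0_fin_numE ?DL1_seminorm_ge0// (lt_trans fe) ?ltry.
exists [set DL1_seminorm m], (e - fine (DL1_seminorm m f)); split.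
- exact: finite_set1.
- by move=> _ ->; exists m.
- by rewrite subr_gt0 -lte_fin fineK.
- move=> g _ /(_ _ erefl) h /=.
  rewrite -(subrK f g); apply: le_lt_trans (DL1_seminormD _ _ _) _.
  by move: h; rewrite EFinB fineK// lteBrDr.
Qed.

(** The unit ball of a seminorm is a neighbourhood of 0 that absorbs B. *)
Lemma seminorm_bounded B : @von_neumann_bounded R[i] E B ->
  forall m, exists C : R, forall f, B f -> (DL1_seminorm m f <= C%:E)%E.
Proof.
move=> bB m.
have [|r r0] := bB [set f : E | (DL1_seminorm m f < 1%:E)%E].
  apply: open_nbhs_nbhs; split; first exact: DL1_seminorm_open.
  by rewrite /= DL1_seminorm0 lte_fin.
have rr : r <= `|r| by apply: real_ler_norm; rewrite realE ltW.
move=> Br.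
exists (normc r) => f /(Br r rr)[u /= u1 <-].
apply: le_trans (DL1_seminormZ _ _ _) _.
rewrite -[leRHS]mule1; apply: lee_wpmul2l; first by rewrite lee_fin normc_ge0.
exact: ltW.
Qed.

Lemma finite_bound (I : choiceType) d (D : orderType d) (x0 : D)
    (F : set I) (P : I -> D -> Prop) :
  finite_set F -> (forall p C C', P p C -> (C <= C')%O -> P p C') ->
  (forall p, F p -> exists C, P p C) -> exists C, forall p, F p -> P p C.
Proof.
move=> /finite_seqP[s ->] Pmono; elim: s => [|p s IH] FP; first by exists x0.
have [C1 h1] : exists C, P p C by apply: FP; exact: mem_head.
have [C2 h2] : exists C, forall p, [set` s] p -> P p C.
  by apply: IH => q qs; apply: FP; rewrite /= in_cons qs orbT.
exists (Order.max C1 C2) => q /=; rewrite in_cons => /orP[/eqP->|qs].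
  by apply: Pmono h1 _; rewrite le_max lexx.
by apply: Pmono (h2 _ qs) _; rewrite le_max lexx orbT.
Qed.

(** A neighbourhood of 0 involves finitely many seminorms, on which B is bounded
by one constant. *)
Lemma bounded_von_neumann B :
  (forall m, exists C : R, forall f, B f -> (DL1_seminorm m f <= C%:E)%E) ->
  @von_neumann_bounded R[i] E B.
Proof.
move=> BC U; rewrite nbhsE => -[W [oW W0] WU].
move: oW; rewrite openDL1E => -[_ /(_ _ W0)[F [e [finF FP e0 FW]]]].
have [C HC] : exists C, forall p, F p -> forall f, B f -> (p f <= C%:E)%E.
  apply: (@finite_bound _ _ R 0 F (fun p C => forall f, B f -> (p f <= C%:E)%E)) => //.
    by move=> p C C' h CC' f /h /le_trans; apply; rewrite lee_fin.
  by move=> p /FP[m _ <-]; exact: BC.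
exists ((`|C| / e + 1)%:C%C); first by rewrite ltcR ltr_wpDl// divr_ge0// ltW.
move=> c; rewrite normcE lecR => Cc f Bf.
have c0 : 0 < normc c by rewrite (lt_le_trans _ Cc)// ltr_wpDl// divr_ge0// ltW.
have cN0 : c != 0 by apply: contraTneq c0 => ->; rewrite ComplexField.Normc.normc0 ltxx.
exists (c^-1 *: f); last by rewrite scalerA mulfV// scale1r.
apply: WU; apply: FW => // p Fp; rewrite subr0.
have [m _ pE] := FP _ Fp; rewrite -pE.
apply: le_lt_trans (DL1_seminormZ _ _ _) _.
have cV : normc c^-1 = (normc c)^-1.
  by apply: (mulfI (lt0r_neq0 c0)); rewrite -normcM mulfV// mulfV ?gt_eqF//
    -[X in normc X]/(1%:C%C) normc_real normr1.
have h := HC _ Fp _ Bf; rewrite -pE in h.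
apply: (@le_lt_trans _ _ ((normc c)^-1%:E * (`|C|)%:E)%E).
  rewrite cV; apply: lee_wpmul2l; first by rewrite lee_fin invr_ge0 ltW.
  by rewrite (le_trans h)// lee_fin ler_norm.
rewrite -EFinM lte_fin ltr_pdivrMl// -ltr_pdivrMr//.
by rewrite (lt_le_trans _ Cc)// ltrDl.
Qed.

End DL1Topology.

(** * Elements of the dual and the test function of a bounded set *)

Section Functionals.
Context {R : realType} {n : nat}.
Local Notation V := 'rV[R]_n.
Local Notation fct := (V -> Cplx R).
Local Notation E := (DL1 R n).
Implicit Types (f g : E) (h k : V -> R) (s : seq 'I_n) (B U : set E) (S : DLoo' R n).

Definition real_DL1 h : E := insubd 0 (real_fct h).

Lemma insubd_DL1 (u : fct) : u \in @DL1_pred R n -> (insubd (0 : E) u : fct) = u.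
Proof. exact: insubdK. Qed.

Lemma real_DL1K h : rDL1 h -> (real_DL1 h : fct) = real_fct h.
Proof. by move=> hD; apply: insubd_DL1; exact: real_fct_DL1. Qed.

Lemma DL1_ext f g : (forall x, DL1_fun f x = DL1_fun g x) -> f = g.
Proof. by move=> h; apply/val_inj/funext. Qed.

Lemma DL1_linE (c : R[i]) f g x : DL1_fun (c *: f + g) x = c * DL1_fun f x + DL1_fun g x.
Proof. by []. Qed.

Lemma real_DL1_lin (c : R) h k : rDL1 h -> rDL1 k ->
  real_DL1 (fun x => c * h x + k x) = c%:C%C *: real_DL1 h + real_DL1 k.
Proof.
move=> hD kD; have hkD := rDL1_comb c hD kD; apply: DL1_ext => x; rewrite DL1_linE.
by rewrite !real_DL1K// /real_fct rmorphD rmorphM.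
Qed.

(** Through this decomposition the statements on real functions apply. *)
Lemma DL1_split f : f = 'i%C *: real_DL1 (im_part (f : fct)) + real_DL1 (re_part (f : fct)).
Proof.
have [rD iD] := DL1_rDL1 (DL1P f); apply: DL1_ext => x; rewrite DL1_linE !real_DL1K//.
rewrite /real_fct /re_part /im_part; case: (DL1_fun f x) => a b.
by apply/eqP; rewrite eq_complex /= !mul0r !mul1r subr0 !add0r !addr0 !eqxx.
Qed.

Lemma DL1_seminorm_real m h (e : R) : rDL1 h ->
  (forall s, (size s <= m)%N -> (L1 (dparts s h) <= e%:E)%E) ->
  (DL1_seminorm m (real_DL1 h) <= e%:E)%E.
Proof.
move=> hD he; apply: ge_ereal_sup => _ [a am <-].
rewrite real_DL1K//.
have sf : smooth (real_fct h) by have /asboolP[] := real_fct_DL1 hD.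
apply: le_trans (L1norm_le (sf _).1) _.
rewrite re_partials im_partials im_real_fct re_real_fct.
rewrite (_ : dparts _ (fun=> 0) = fun=> 0); last first.
  by elim: (multi_index_seq a) => //= i s ->; apply/funext => x; rewrite dpartE derive_cst.
by rewrite [X in (_ + X)%E]/L1 normr0 integral0 adde0 he// size_multi_index.
Qed.

Lemma dualP S : (forall (c : R[i]) f g, S (c *: f + g) = c * S f + S g) /\
  continuous (S : E -> Cplx R).
Proof. by case: S => S /= /asboolP. Qed.

Lemma dual0 S : S 0 = 0.
Proof.
have := (dualP S).1 1 0 0; rewrite scaler0 addr0 mul1r => h.
by apply: (addrI (S 0)); rewrite -h addr0.
Qed.

Lemma dualZ S (c : R[i]) f : S (c *: f) = c * S f.
Proof. by rewrite -[c *: f]addr0 (dualP S).1 dual0 addr0. Qed.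

Lemma dual_ball S : exists (m : nat) (d : R), 0 < d /\
  forall f, (DL1_seminorm m f < d%:E)%E -> normc (S f) < 1.
Proof.
have [_ cS] := dualP S.
have : nbhs (0 : E) [set f | normc (S f) < 1].
  have /cvgrPdist_lt/(_ 1 ltr01) := cS 0; apply: filterS => f /=.
  by rewrite dual0 sub0r normrN normcE ltcR.
rewrite nbhsE => -[W [oW W0] WS].
move: oW; rewrite openDL1E => -[_ /(_ _ W0)[F [d [finF FP d0 FW]]]].
have [m Hm] : exists m : nat, forall p, F p -> forall f, (p f <= DL1_seminorm m f)%E.
  apply: (@finite_bound _ _ nat 0%N F (fun p m => forall f, (p f <= DL1_seminorm m f)%E)) => //.
    by move=> p m m' h mm' f; rewrite (le_trans (h f))// DL1_seminorm_mono.
  by move=> p /FP[m _ <-]; exists m.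
exists m, d; split=> // f fd; apply: WS; apply: FW => // p Fp.
by rewrite subr0 (le_lt_trans (Hm p Fp f)).
Qed.

(** By homogeneity, from the ball on which S is less than 1.  The bound e may
be 0, whence the passage through larger e'. *)
Lemma dual_bound S : exists (m : nat) (K : R),
  forall f (e : R), 0 <= e -> (DL1_seminorm m f <= e%:E)%E -> normc (S f) <= K * e.
Proof.
have [m [d [d0 Hd]]] := dual_ball S; exists m, d^-1 => f e e0 fe.
apply/ler_addgt0Pr => t t0; set e' := e + d * t.
have e'0 : 0 < e' by rewrite ltr_wpDl// mulr_gt0.
have -> : d^-1 * e + t = e' / d by rewrite /e' mulrDl mulrAC mulfV ?gt_eqF// mul1r mulrC.
have de0 : 0 <= d / e' by rewrite divr_ge0// ltW.
have h : (DL1_seminorm m ((d / e')%:C%C *: f) < d%:E)%E.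
  apply: le_lt_trans (DL1_seminormZ _ _ _) _.
  rewrite normc_real ger0_norm//.
  apply: (@le_lt_trans _ _ ((d / e')%:E * e%:E)%E).
    by apply: lee_wpmul2l fe; rewrite lee_fin.
  rewrite -EFinM lte_fin mulrAC ltr_pdivrMr// ltr_pM2l//.
  by rewrite /e' ltrDl mulr_gt0.
have := Hd _ h; rewrite dualZ normcM normc_real ger0_norm//.
by rewrite -ltr_pdivlMl ?divr_gt0// mulr1 invf_div => /ltW.
Qed.

(** The reflection compensates the one in the definition of the convolution. *)
Lemma conv_real phi S y : convolution (real_fct (refl 0 phi)) S y = S (real_DL1 (tr y phi)).
Proof.
congr (S _); congr insubd; apply/funext => x.
by rewrite /real_fct /refl /tr sub0r opprB.
Qed.

Lemma compact_reflect (A : set V) : compact A -> compact (-%R @` A).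
Proof. by move=> cA; apply: continuous_compact => //; exact/continuous_subspaceT/opp_continuous. Qed.

Lemma test_function_real phi : csmooth phi -> compact (closure [set x | phi x != 0]) ->
  @test_function R n (real_fct (refl 0 phi)).
Proof.
move=> sphi cphi; split.
  apply/smooth_parts; split; first by apply: csmooth_refl.
  exact: (@rDL1_0 R n).1.
have cA := compact_reflect cphi.
apply: (subclosed_compact _ cA); first exact: closed_closure.
rewrite /fsupport [X in X `<=` _]closureE => x hx; apply: hx; split.
  exact: compact_closed (@norm_hausdorff _ _) cA.
move=> y /= hy; exists (- y); last by rewrite opprK.
apply: subset_closure => /=; move: hy; apply: contra_neq => h.
by rewrite /real_fct /refl sub0r h.
Qed.

(** Both the real and the imaginary part of S are real functionals to which
factor_bound applies, and so are the two parts of each f in B: four terms, whence the factor 4. *)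
Lemma test_function_bound B : @von_neumann_bounded R[i] E B ->
  exists phi : fct, test_function phi /\ exists2 K : R, 0 <= K &
    forall S (c : R), (conv_seminorm phi S <= c%:E)%E ->
      (strong_seminorm B S <= (c * K)%:E)%E.
Proof.
move=> bB; have /choice[C HC] := seminorm_bounded bB.
have [phi [sphi cphi [K0 K00 Hphi]]] := factor_bound (n := n) C.
exists (real_fct (refl 0 phi)); split; first exact: test_function_real.
exists (4 * K0); first by rewrite mulr_ge0.
move=> S c Sc.
have {}Sc y : normc (S (real_DL1 (tr y phi))) <= c.
  rewrite -lee_fin -conv_real; apply: le_trans Sc.
  by apply: ereal_sup_ubound; exists y.
have [m [K HK]] := dual_bound S.
pose G (rho : R[i] -> R) h := rho (S (real_DL1 h)).
have key (rho : R[i] -> R) : (forall (c : R) z w, rho (c%:C%C * z + w) = c * rho z + rho w) ->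
    (forall z, `|rho z| <= normc z) -> forall h, rDL1 h ->
    (forall s, L1 (dparts s h) <= (C (size s))%:E)%E -> `|G rho h| <= c * K0.
  move=> rlin rle; apply: (Hphi (G rho) m K) => [d u v uD vD|u e uD e0 ue|y].
  - by rewrite /G real_DL1_lin// (dualP S).1 rlin.
  - by apply: le_trans (rle _) _; apply: HK => //; exact: DL1_seminorm_real.
  - exact: le_trans (rle _) (Sc y).
have Rlin (d : R) (z w : R[i]) : complex.Re (d%:C%C * z + w) = d * complex.Re z + complex.Re w.
  by case: z w => ? ? [? ?] /=; rewrite mul0r subr0.
have Ilin (d : R) (z w : R[i]) : complex.Im (d%:C%C * z + w) = d * complex.Im z + complex.Im w.
  by case: z w => ? ? [? ?] /=; rewrite mul0r addr0.
have keyS h : rDL1 h -> (forall s, L1 (dparts s h) <= (C (size s))%:E)%E ->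
    normc (S (real_DL1 h)) <= 2 * (c * K0).
  move=> hD hC; apply: le_trans (normc_le _) _; rewrite mulr2n mulrDl mul1r.
  apply: lerD; first exact: (key _ Rlin (@normc_Re _) _ hD hC).
  exact: (key _ Ilin (@normc_Im _) _ hD hC).
apply: ge_ereal_sup => _ [f Bf <-]; rewrite lee_fin.
have [rD iD] := DL1_rDL1 (DL1P f).
have LC s : (L1norm (partials s (f : fct)) <= (C (size s))%:E)%E.
  apply: le_trans (HC (size s) f Bf); rewrite (partials_mpartial _ (DL1_smooth f)).
  apply: ereal_sup_ubound; exists (fun i => count_mem i s) => //=.
  by rewrite -size_multi_index -(perm_size (perm_multi_index s)).
have cf s : continuous (partials s (f : fct)) by have [] := DL1_smooth f s.
rewrite (DL1_split f) (dualP S).1; apply: le_trans (normcD _ _) _.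
have -> : c * (4 * K0) = 1 * (2 * (c * K0)) + 2 * (c * K0) by ring.
apply: lerD.
  rewrite normcM; apply: ler_pM => //; rewrite ?normc_ge0//.
    by rewrite /= expr0n expr1n add0r sqrtr1.
  by apply: keyS => // s; rewrite -im_partials; apply: le_trans (L1_im_le (cf s)) (LC s).
by apply: keyS => // s; rewrite -re_partials; apply: le_trans (L1_re_le (cf s)) (LC s).
Qed.

End Functionals.

(** * Comparison of the two topologies *)

Section Conclusion.
Context {R : realType} {n : nat}.
Local Notation V := 'rV[R]_n.
Local Notation fct := (V -> Cplx R).
Local Notation E := (DL1 R n).
Implicit Types (B : set E) (phi : fct) (S : DLoo' R n).

Definition reflected_translates phi : set E :=
  range (fun x => insubd (0 : E) (fun y => phi (x - y))).

Lemma conv_seminormE phi :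
  @conv_seminorm R n phi = strong_seminorm (reflected_translates phi).
Proof. by apply/funext => S; rewrite /strong_seminorm image_comp. Qed.

Lemma schwartz_translates_bounded phi : schwartz phi ->
  @von_neumann_bounded R[i] E (reflected_translates phi).
Proof.
move=> /schwartz_rDL1[rD iD]; apply: bounded_von_neumann => m.
have [C1 [_ H1]] := rDL1_bound m rD; have [C2 [_ H2]] := rDL1_bound m iD.
exists (C1 + C2) => _ [x _ <-].
pose u : fct := fun y => phi (x - y).
have ru : re_part u = refl x (re_part phi) by [].
have iu : im_part u = refl x (im_part phi) by [].
have uD : u \in @DL1_pred R n.
  by apply: rDL1_DL1; [rewrite ru|rewrite iu]; exact: rDL1_refl.
apply: ge_ereal_sup => _ [a am <-]; rewrite (insubd_DL1 uD).
have [su _] : smooth u /\ True by have /asboolP[] := uD.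
apply: le_trans (L1norm_le (su _).1) _; rewrite EFinD re_partials im_partials ru iu.
rewrite !L1_dparts_refl; [|exact: iD.1|exact: rD.1].
by apply: leeD; [apply: H1|apply: H2]; rewrite size_multi_index.
Qed.

Lemma strong_seminorm0 B (e : R) : 0 < e -> (strong_seminorm B 0%R < e%:E)%E.
Proof.
move=> e0; apply: (@le_lt_trans _ _ 0%E); last by rewrite lte_fin.
apply: ge_ereal_sup => _ [f _ <-].
by rewrite (_ : (0 : DLoo' R n) f = 0)// ComplexField.Normc.normc0.
Qed.

(** Subadditivity: it makes the sets defined by finitely many strict inequalities
open.  The seminorm of the empty set is -oo, which is why an intermediate
real r is chosen. *)
Lemma strong_seminorm_shift B S (e : R) : (strong_seminorm B S < e%:E)%E ->
  exists2 d : R, 0 < d & forall z, (strong_seminorm B z < d%:E)%E ->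
    (strong_seminorm B (z + S)%R < e%:E)%E.
Proof.
move=> Se; have [r Sr re] : exists2 r, (strong_seminorm B S <= r%:E)%E & r < e.
  case: (strong_seminorm B S) Se => [r||] //; first by exists r.
  by exists (e - 1); rewrite ?leNye// ltrBlDr ltrDl.
exists ((e - r) / 2); first by rewrite divr_gt0// subr_gt0.
move=> z zd; apply: (@le_lt_trans _ _ ((e - r) / 2 + r)%:E); last by rewrite lte_fin; lra.
apply: ge_ereal_sup => _ [f Bf <-]; rewrite lee_fin.
rewrite (_ : (z + S) f = z f + S f)//; apply: le_trans (normcD _ _) _.
apply: lerD; rewrite -lee_fin; last first.
  by apply: le_trans Sr; apply: ereal_sup_ubound; exists f.
by apply: le_trans (ltW zd); apply: ereal_sup_ubound; exists f.
Qed.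

(** Finitely many conditions, each implied by a condition p z < d on one
seminorm, are implied by finitely many such conditions with a common d. *)
Lemma finite_refine (T : Type) (F P : set (T -> \bar R)) (Q : (T -> \bar R) -> set T) :
  finite_set F ->
  (forall p, F p -> exists q d, [/\ P q, 0 < d & forall z, (q z < d%:E)%E -> Q p z]) ->
  exists G (d : R), [/\ finite_set G, G `<=` P, 0 < d &
    forall z, (forall q, G q -> (q z < d%:E)%E) -> forall p, F p -> Q p z].
Proof.
move=> /finite_seqP[s ->]; elim: s => [|p s IH] FP; first by exists set0, 1; split.
have [q [d1 [Pq d10 H1]]] := FP _ (mem_head p s).
have [|G [d2 [finG GP d20 H2]]] := IH.
  by move=> p' p's; apply: FP; rewrite /= in_cons p's orbT.
exists (q |` G), (Num.min d1 d2); split.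
- by rewrite finite_setU; split=> //; exact: finite_set1.
- by move=> q0 [->|/GP].
- by rewrite lt_min d10.
move=> z Hz p'; rewrite /= in_cons => /orP[/eqP->|p's].
  by apply: H1; apply: lt_le_trans (Hz q (or_introl erefl)) _; rewrite lee_fin ge_min lexx.
apply: H2 p's => q' Gq'; apply: lt_le_trans (Hz q' (or_intror Gq')) _.
by rewrite lee_fin ge_min lexx orbT.
Qed.

(** An open set for the strong topology is open for the convolution seminorms by
test_function_bound.  Conversely, a set that is open in X for these
seminorms is the trace of the union of the corresponding balls in the whole
dual, which are open by strong_seminorm_shift and
schwartz_translates_bounded. *)
Lemma induced_openE (X : set (DLoo' R n)) (A : set fct) :
  @test_function R n `<=` A -> A `<=` @schwartz R n ->
  induced_open X = seminorm_open X [set @conv_seminorm R n phi | phi in A].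
Proof.
move=> tA As; apply/seteqP; split=> U.
  move=> [W oW <-]; move: oW; rewrite openDLooE => -[_ oW].
  split=> [x []//|x [Wx Xx]]; have [F [e [finF FP e0 FW]]] := oW _ Wx.
  have [|G [d [finG GP d0 H]]] := finite_refine
      (P := [set @conv_seminorm R n phi | phi in A])
      (Q := fun p z => (p z < e%:E)%E) finF.
    move=> p /FP[B bB <-]; have [phi [tphi [K K0 HK]]] := test_function_bound bB.
    have K1 : 0 < K + 1 by rewrite ltr_wpDl.
    exists (conv_seminorm phi), (e / (K + 1)); split; first by exists phi => //; exact: tA.
      by rewrite divr_gt0.
    move=> z /ltW/HK /le_lt_trans; apply; rewrite lte_fin mulrAC ltr_pdivrMr//.
    by rewrite ltr_pM2l// ltrDl.
  exists G, d; split=> // y Xy Hy; split=> //; apply: FW => // p Fp.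
  exact: H Hy _ Fp.
move=> [UX oU].
(* y lies in a ball of the whole dual, centred at a point x, whose trace on X
   is contained in U *)
pose near x (F : set (DLoo' R n -> \bar R)) e y := [/\ finite_set F,
  F `<=` [set @conv_seminorm R n phi | phi in A],
  forall y, X y -> (forall p, F p -> (p (y - x)%R < e%:E)%E) -> U y &
  forall p, F p -> (p (y - x)%R < e%:E)%E].
exists [set y | exists x F e, near x F e y]; last first.
  apply/seteqP; split=> [y [[x [F [e [_ _ FU yx]]]] Xy]|x Ux]; first exact: FU.
  split; last exact: UX; have [F [e [finF FP e0 FU]]] := oU _ Ux.
  exists x, F, e; split=> // p /FP[phi _ <-]; rewrite subrr conv_seminormE.
  exact: strong_seminorm0.
rewrite openDLooE; split=> // y [x [F [e [finF FP FU yx]]]].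
have [|G [d [finG GP d0 H]]] := finite_refine
    (P := [set strong_seminorm B | B in @von_neumann_bounded R[i] E])
    (Q := fun p z => (p (z + (y - x))%R < e%:E)%E) finF.
  move=> p Fp; have [phi Aphi pE] := FP _ Fp; have := yx _ Fp.
  rewrite -pE conv_seminormE => /strong_seminorm_shift[d d0 H].
  exists (strong_seminorm (reflected_translates phi)), d; split=> //.
  by exists (reflected_translates phi) => //; apply/schwartz_translates_bounded/As.
exists G, d; split=> // z _ Hz; exists x, F, e; split=> // p Fp.
by have := H _ Hz _ Fp; rewrite addrA subrK.
Qed.

End Conclusion.

Theorem proposition4p17 (R : realType) (n : nat) :
  induced_open (@Bdot' R n) =
    seminorm_open (@Bdot' R n)
      [set conv_seminorm phi | phi in @test_function R n] /\
  induced_open (@Bdot' R n) =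
    seminorm_open (@Bdot' R n)
      [set conv_seminorm phi | phi in @schwartz R n].
Proof.
by split; apply: induced_openE => // phi; exact: test_function_schwartz.
Qed.
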